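(* Let $T>0$ and let $\Gamma^0_1,\Gamma^0_2>0$ be constants such that $(x,\nabla_xV^\varepsilon_N(t,x))\in\mathcal A_{N,\Gamma^0_1,\Gamma^0_2}$ for all $N\ge1$, $\varepsilon>0$, $(t,x)\in[0,T]\times\mathbb R^N$. Suppose that Hypothesis (R1) (see context) holds with $(\Gamma_1,\Gamma_2)=(\Gamma^0_1,\Gamma^0_2)$. Then there exists a constant $\tilde C_6=\tilde C_6(f,\lambda^{-1/2},T,L,U,(\lambda-\lambda_0)^{-1})$, independent of $N$ and $\varepsilon$, such that $$0\le\sum_{i,j=1}^N\partial^2_{x_ix_j}V^\varepsilon_N(t,x)\,\xi_i\xi_j\le\frac{\tilde C_6}N|\xi|^2,\qquad\xi\in\mathbb R^N,\ (t,x)\in[0,T]\times\mathbb R^N.$$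
   Context: **Setting.** $T,\lambda>0$, $\sigma\in\mathbb R$, $\Theta=\mathbb R$. $\mathcal P_2(\mathbb R)$ is the set of Borel probability measures on $\mathbb R$ with finite second moment, with the 2-Wasserstein distance. $\partial_\mu$ denotes the intrinsic (Wasserstein/Lions) derivative; the extra variable it creates is written after the measure variable. Data: $f:[0,T]\times\Theta\times\mathbb R\times\mathcal P_2(\mathbb R)\to\mathbb R$ and $L,U:\mathbb R\to\mathbb R$. **Standing assumption.** (1) $(t,\theta)\mapsto f(t,\theta,0,\delta_0)$ is continuous; (2) $\partial_tf$ is bounded and $f$ has bounded derivatives with respect to $(\theta,x,\mu)$ up to second order; (3) for $\varphi\in\{L,U\}$: $\varphi\ge0$, $|\varphi'(x)|\le C^\varphi_{11}|x|+C^\varphi_{10}$, $|\varphi''(x)|\le C^\varphi_{20}$ for constants $C^\varphi_{11},C^\varphi_{10},C^\varphi_{20}$; (4) there are $\alpha\in(0,2)$, $C_g>0$ with $|L(x)|+|U(x)|\le C_g(|x|^{2-\alpha}+1)$. **Regularized problem.** Put $\tilde H_N(t,x,p):=\inf_{\theta\in\mathbb R}\{\frac\lambda2|\theta|^2+\sum_{i=1}^Nf(t,\theta,x_i,\frac1N\sum_j\delta_{x_j})p_i+\frac1N\sum_{i=1}^NL(x_i)\}$. For $\varepsilon>0$, $V^\varepsilon_N$ is the classical solution of $$\partial_tV+\frac{\sigma^2}2\sum_{i,j}\partial^2_{x_ix_j}V+\frac{\varepsilon^2}2\sum_i\partial^2_{x_ix_i}V+\tilde H_N(t,x,\nabla_xV)=0,\qquad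 V(T,x)=\frac1N\sum_{i=1}^NU(x_i);$$ equivalently, $V^\varepsilon_N(s,x)$ is the infimum over adapted real-valued controls $\theta$ of $\mathbb E[\frac1N\sum_i\int_s^TL(X^i(t))dt+\frac1N\sum_iU(X^i(T))+\frac\lambda2\int_s^T|\theta(t)|^2dt]$ subject to $dX^i(t)=f(t,\theta(t),X^i(t),\frac1N\sum_j\delta_{X^j(t)})dt+\varepsilon dW^i(t)+\sigma dW^0(t)$, $X^i(s)=x_i$, with independent Brownian motions $W^0,\dots,W^N$. **Hypothesis (R)** (with parameters $\Gamma_1,\Gamma_2\in\mathbb R$). For $\Gamma\in\mathbb R$ put $G_{N,i}(x,\Gamma)=\frac{\Gamma(C^L_{11}+C^U_{11})}N\big(1+|x_i|^2+\frac1N\sum_j|x_j|^2\big)^{1/2}+\frac{\Gamma(C^L_{10}+C^U_{10})}N$ and $\mathcal A_{N,\Gamma_1,\Gamma_2}=\{(x,p)\in\mathbb R^N\times\mathbb R^N:\ -G_{N,i}(x,\Gamma_1)\le p_i\le G_{N,i}(x,\Gamma_2),\ 1\le i\le N\}$. Hypothesis (R) requires: (i) there is $\lambda_0>0$ such that for all $N\ge1$, $t\in[0,T]$, $\theta\in\Theta$, $(x,p)\in\mathcal A_{N,\Gamma_1,\Gamma_2}$: $\lambda_0+\sum_{i=1}^N\partial^2_{\theta\theta}f(t,\theta,x_i,\frac1N\sum_j\delta_{x_j})p_i\ge0$; (ii) there is $C^Q>0$ such that for the same $(N,t,\theta,x,p)$, all $i$, and all $\varphi\in\{|\partial^2_{x\theta}f|,|\partial^2_{xx}f|\}$,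 $\phi\in\{|\partial^2_{x\mu}f|,|\partial^2_{\theta\mu}f|\}$: $C^Q>\varphi(t,\theta,x_i,\frac1N\sum_j\delta_{x_j})Np_i+\phi(t,\theta,x_i,\frac1N\sum_j\delta_{x_j},x_i)Np_i$; (iii) $\lambda>\lambda_0$. **Hypothesis (R1)** (with parameters $\Gamma_1,\Gamma_2$). Hypothesis (R) holds with $\Gamma_1,\Gamma_2$, $U$ is convex, and $\tilde H_N$ is convex in $x$, in particular $\nabla^2_{xx}\tilde H_N(t,x,p)\ge0$ for all $(t,x,p)\in[0,T]\times\mathbb R^N\times\mathbb R^N$ (positive semidefinite order), $N\ge1$. *)

(* Defs.v *)
From HB Require Import structures.
From mathcomp Require Import all_boot all_order all_algebra.
From mathcomp Require Import all_classical all_reals all_analysis.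
From mathcomp Require Import measurable_realfun.

Set Implicit Arguments.
Unset Strict Implicit.
Unset Printing Implicit Defensive.

Import Order.TTheory GRing.Theory Num.Theory.
Import numFieldNormedType.Exports.

Local Open Scope ring_scope.
Local Open Scope classical_set_scope.

Definition finite_moment2 (R : realType)
    (mu : set R -> \bar R) : Prop :=
  (\int[mu]_x (x ^+ 2)%:E < +oo)%E.

Definition P2 (R : realType) : Type :=
  {mu : probability R R | finite_moment2 mu}.

Section empirical_measure.
Context (R : realType) (n : nat) (x : 'rV[R]_n.+1).

Definition empirical : set R -> \bar R :=
  mscale (n.+1%:R^-1)%:nng
    (msum (fun k => @dirac _ R (x 0 (inord k)) R) n.+1).

HB.instance Definition _ := Measure.on empirical.

Lemma empiricalE (A : set R) :
  empirical A = ((n.+1%:R^-1)%:E * \sum_(i < n.+1) \d_(x 0%R i) A)%E.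
Proof.
rewrite /empirical /mscale /msum /=; congr (_ * _)%E.
by apply: eq_bigr => i _; rewrite inord_val.
Qed.

Lemma empirical_setT : empirical setT = 1%E.
Proof.
rewrite empiricalE (eq_bigr (fun=> 1%E)); last by move=> i _; rewrite diracT.
by rewrite sumEFin sumr_const card_ord -EFinM mulVf// pnatr_eq0.
Qed.

HB.instance Definition _ :=
  Measure_isProbability.Build _ _ _ empirical empirical_setT.

Lemma empirical_moment2 : finite_moment2 empirical.
Proof.
rewrite /finite_moment2 /empirical ge0_integral_mscale//; last 2 first.
- by apply/measurable_EFinP; exact: exprn_measurable.
- by move=> y _; rewrite lee_fin sqr_ge0.
rewrite ge0_integral_measure_sum//; last 2 first.
- by move=> y _; rewrite lee_fin sqr_ge0.
- by apply/measurable_EFinP; exact: exprn_measurable.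
rewrite (eq_bigr (fun k : 'I_n.+1 => ((x 0%R (inord k)) ^+ 2)%:E)).
  by rewrite sumEFin -EFinM ltry.
move=> i _; rewrite integral_dirac// ?diracT ?mul1e//.
by apply/measurable_EFinP; exact: exprn_measurable.
Qed.

Definition empP2 : P2 R :=
  exist _ (empirical : probability R R) empirical_moment2.

End empirical_measure.

Section dirac_measure_P2.
Context (R : realType) (a : R).

Lemma dirac_moment2 :
  finite_moment2 (@dirac _ R a R).
Proof.
rewrite /finite_moment2 integral_dirac//; first by rewrite diracT mul1e ltry.
by apply/measurable_EFinP; exact: exprn_measurable.
Qed.

Definition diracP2 : P2 R :=
  exist _ (@dirac _ R a R : probability _ R) dirac_moment2.

End dirac_measure_P2.

Section lions_derivative.
Context (R : realType).

Definition has_law d (Om : measurableType d) (P : probability Om R)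
    (X : Om -> R) (mu : P2 R) : Prop :=
  forall A, measurable A -> P (X @^-1` A) = sval mu A.

(* [g] is the derivative of [u] at [mu]: the lift X |-> u (law of X) is Frechet
   differentiable on L^2 at every X with law [mu], and its gradient there is
   g(X).  Both X and X + Y have a law in P2, hence Y is in L^2 and the
   (real-valued) integrals below are those of integrable functions. *)
Definition is_Lions_derivative (u : P2 R -> R) (mu : P2 R) (g : R -> R) :
    Prop :=
  [/\ measurable_fun [set: R] g,
      (sval mu).-integrable setT (fun y => (g y ^+ 2)%:E) &
      forall d (Om : measurableType d) (P : probability Om R)
        (X : {RV P >-> R}), has_law P X mu ->
      forall e : R, 0 < e -> exists2 del : R, 0 < del &
      forall (Y : {RV P >-> R}) (nu : P2 R),
        has_law P (X \+ Y) nu ->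
        Num.sqrt (\int[P]_w (Y w ^+ 2)) <= del ->
        `|u nu - u mu - \int[P]_w (g (X w) * Y w)|
          <= e * Num.sqrt (\int[P]_w (Y w ^+ 2))].

End lions_derivative.

Section data.
Context (R : realType).

(* arguments: t, theta, x, mu *)
Definition coef : Type := R -> R -> R -> P2 R -> R.

Definition Dtheta (h : coef) : coef :=
  fun t th x mu => (fun th' => h t th' x mu)^`() th.

Definition Dx (h : coef) : coef :=
  fun t th x mu => (fun x' => h t th x' mu)^`() x.

(* A measure derivative hmu t th x mu y carries its extra variable y last;
   [slice hmu y] freezes it and [at_y D hmu] applies D at frozen y. *)
Definition mcoef : Type := R -> R -> R -> P2 R -> R -> R.

Definition slice (hmu : mcoef) (y : R) : coef :=
  fun t th x mu => hmu t th x mu y.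

Definition at_y (D : coef -> coef) (hmu : mcoef) : mcoef :=
  fun t th x mu y => D (slice hmu y) t th x mu.

(* On [0,T], h has derivatives in theta, x and mu, the last one being hmu, all
   bounded by K. *)
Definition derivatives_bounded (T K : R) (h : coef) (hmu : mcoef) : Prop :=
  forall (t th x : R) (mu : P2 R), 0 <= t <= T ->
  [/\ derivable (fun th' => h t th' x mu) th 1,
      derivable (fun x' => h t th x' mu) x 1,
      is_Lions_derivative (h t th x) mu (hmu t th x mu),
      `|Dtheta h t th x mu| <= K /\ `|Dx h t th x mu| <= K &
      forall y, `|hmu t th x mu y| <= K].

(* fmu and fmumu are the first and second measure derivatives of f;
   fmumu t th x mu y is the measure derivative of fmu t th x mu y.  The mixed
   derivatives are independent of the order in which mu and theta, or mu and x,
   are taken. *)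
Definition f_assumption (T : R) (f : coef) (fmu : mcoef)
    (fmumu : R -> R -> R -> P2 R -> R -> R -> R) : Prop :=
  [/\ {within [set z : R * R | 0 <= z.1 <= T],
         continuous (fun z : R * R => f z.1 z.2 0 (diracP2 0))},
      forall th x mu, derivable_oo_LRcontinuous (fun t => f t th x mu) 0 T &
      exists K : R,
      [/\ forall (t th x : R) (mu : P2 R), 0 < t < T ->
            `|(fun t' => f t' th x mu)^`() t| <= K,
          derivatives_bounded T K f fmu,
          derivatives_bounded T K (Dtheta f) (at_y Dtheta fmu) /\
          derivatives_bounded T K (Dx f) (at_y Dx fmu),
          forall y, derivatives_bounded T K (slice fmu y)
                      (fun t th x mu => fmumu t th x mu y) &
          forall (t th x : R) (mu : P2 R) (y : R), 0 <= t <= T ->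
            derivable (fmu t th x mu) y 1 /\
            `|(fmu t th x mu)^`() y| <= K]].

Definition cost_assumption (phi : R -> R) (C11 C10 C20 : R) : Prop :=
  forall x,
  [/\ 0 <= phi x, derivable phi x 1, derivable phi^`() x 1,
      `|phi^`() x| <= C11 * `|x| + C10 & `|phi^`()^`() x| <= C20].

Definition growth_assumption (L U : R -> R) : Prop :=
  exists alpha Cg : R, [/\ 0 < alpha < 2, 0 < Cg &
    forall x, `|L x| + `|U x| <= Cg * (`|x| `^ (2 - alpha) + 1)].

End data.

Section regularized_problem.
Context (R : realType).

Definition partial n (i : 'I_n) (g : 'rV[R]_n -> R) (x : 'rV[R]_n) : R :=
  'D_(delta_mx 0 i) g x.

Definition grad n (g : 'rV[R]_n -> R) (x : 'rV[R]_n) : 'rV[R]_n :=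
  \row_i partial i g x.

Definition dtime n (V : R -> 'rV[R]_n -> R) (t : R) (x : 'rV[R]_n) : R :=
  derive1 (fun s => V s x) t.

(* N = n.+1 throughout. *)
Definition Htilde (f : coef R) (L : R -> R) (lambda : R) n (t : R)
    (x p : 'rV[R]_n.+1) : R :=
  inf [set lambda / 2 * th ^+ 2
           + \sum_i f t th (x 0 i) (empP2 x) * p 0 i
           + n.+1%:R^-1 * \sum_i L (x 0 i) | th in [set: R]].

(* V is C^{1,2} on [0,T) x R^N and continuous on [0,T] x R^N.  The time
   derivative is only taken on (0,T): by the equation it extends continuously
   to t = 0. *)
Definition classical_solution (T : R) (f : coef R) (L U : R -> R)
    (lambda sigma eps : R) n (V : R -> 'rV[R]_n.+1 -> R) : Prop :=
  [/\ {within [set z : R * 'rV[R]_n.+1 | 0 <= z.1 <= T],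
         continuous (fun z : R * 'rV[R]_n.+1 => V z.1 z.2)},
      (forall (t : R) x, 0 < t < T -> derivable (fun s => V s x) t 1) /\
      {within [set z : R * 'rV[R]_n.+1 | 0 < z.1 < T],
         continuous (fun z : R * 'rV[R]_n.+1 => dtime V z.1 z.2)},
      forall i j,
      [/\ forall (t : R) x, 0 <= t < T -> derivable (V t) x (delta_mx 0 j),
          {within [set z : R * 'rV[R]_n.+1 | 0 <= z.1 < T],
             continuous (fun z : R * 'rV[R]_n.+1 => partial j (V z.1) z.2)},
          forall (t : R) x, 0 <= t < T ->
            derivable (partial j (V t)) x (delta_mx 0 i) &
          {within [set z : R * 'rV[R]_n.+1 | 0 <= z.1 < T],
             continuous (fun z : R * 'rV[R]_n.+1 =>
               partial i (partial j (V z.1)) z.2)}],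
      forall (t : R) x, 0 < t < T ->
        dtime V t x
        + sigma ^+ 2 / 2 * \sum_i \sum_j partial i (partial j (V t)) x
        + eps ^+ 2 / 2 * \sum_i partial i (partial i (V t)) x
        + Htilde f L lambda t x (grad (V t) x) = 0 &
      forall x, V T x = n.+1%:R^-1 * \sum_i U (x 0 i)].

(* C11 and C10 stand for C^L_11 + C^U_11 and C^L_10 + C^U_10. *)
Definition Gbound (C11 C10 : R) n (i : 'I_n.+1) (x : 'rV[R]_n.+1)
    (Gamma : R) : R :=
  Gamma * C11 / n.+1%:R
    * Num.sqrt (1 + x 0 i ^+ 2 + n.+1%:R^-1 * \sum_j x 0 j ^+ 2)
  + Gamma * C10 / n.+1%:R.

Definition Aset (C11 C10 Gamma1 Gamma2 : R) n :
    set ('rV[R]_n.+1 * 'rV[R]_n.+1) :=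
  [set xp : 'rV[R]_n.+1 * 'rV[R]_n.+1 | forall i,
     - Gbound C11 C10 i xp.1 Gamma1 <= xp.2 0 i
       <= Gbound C11 C10 i xp.1 Gamma2].

Definition hypothesis_R (T : R) (f : coef R) (fmu : mcoef R)
    (C11 C10 Gamma1 Gamma2 lambda lambda0 : R) : Prop :=
  [/\ 0 < lambda0,
      forall n (t th : R) (x p : 'rV[R]_n.+1), 0 <= t <= T ->
        Aset C11 C10 Gamma1 Gamma2 (x, p) ->
        0 <= lambda0
             + \sum_i Dtheta (Dtheta f) t th (x 0 i) (empP2 x) * p 0 i,
      exists2 CQ : R, 0 < CQ &
        forall n (t th : R) (x p : 'rV[R]_n.+1), 0 <= t <= T ->
        Aset C11 C10 Gamma1 Gamma2 (x, p) ->
        forall i (phi psi : R),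
          phi \in [:: `|Dx (Dtheta f) t th (x 0 i) (empP2 x)|;
                      `|Dx (Dx f) t th (x 0 i) (empP2 x)|] ->
          psi \in [:: `|at_y (@Dx R) fmu t th (x 0 i) (empP2 x) (x 0 i)|;
                      `|at_y (@Dtheta R) fmu t th (x 0 i) (empP2 x) (x 0 i)|] ->
          phi * n.+1%:R * p 0 i + psi * n.+1%:R * p 0 i < CQ &
      lambda0 < lambda].

Definition hypothesis_R1 (T : R) (f : coef R) (fmu : mcoef R) (L U : R -> R)
    (C11 C10 Gamma1 Gamma2 lambda lambda0 : R) : Prop :=
  [/\ hypothesis_R T f fmu C11 C10 Gamma1 Gamma2 lambda lambda0,
      convex_function (setT : set R^o) U &
      forall n (t : R) (p : 'rV[R]_n.+1), 0 <= t <= T ->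
        convex_function (setT : set 'rV[R]_n.+1)
          (fun x => Htilde f L lambda t x p)].

End regularized_problem.

(* Main.v *)
(* Second differences of V obey a maximum principle. Let S = 1 or S = -1 and consider
   a maximum of S (V(m+h) + V(m-h) - 2 V(m)) - c(t) |h|^2 - rho w^2, where
   w = 1 + |m|^2 + |h|^2 makes V, which grows quadratically, irrelevant at infinity.
   There the gradients of V at m+h, m-h and m are tied by the first-order conditions,
   and the second-order terms have a sign because their coefficients are constant.
   For S = -1, convexity of H in x yields convexity of V. For S = 1, the control nearly
   optimal at m is used at m+h and m-h; what remains is to bound the second difference
   of the drift f(x_i, mu_x), weighted by the momentum p = grad V(m), by C |h|^2 / N.
   If C11 = 0 then |p_i| <= C / N and the bounds on the second derivatives of f suffice.
   If C11 > 0, momenta are unbounded on the set A: condition (i) of (R), tested on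
   empirical measures with one remote atom, forces f to be affine in theta. Then H is a
   quadratic polynomial in p, and its convexity in x for every p forces the drift to be
   affine in x, so that its second differences vanish. *)

(* Second differences replace a differentiation of the equation because [V] is only of class C^{1,2}
   and [Htilde], an infimum, need not be smooth. For S = 1 the weight is c(t) = M exp(B (T - t))
   with M of order 1/N but at least 1/N, so that every error of size |h|^2 / N is a multiple of c(t)
   |h|^2 and is absorbed by the rate B, which involves neither N nor the noise. The power w^2 in the
   penalty does two things. It outgrows [V], and it reproduces itself: its gradient perturbs the
   momenta by an amount of order rho w^{3/2}, the Hamiltonian is Lipschitz in the momentum with a
   constant of order w^{1/2}, and the second derivatives of w^2 are at most of order w^2. All errors
   caused by the penalty are thus O(rho w^2), and a factor exp(k (T - t)) in rho absorbs them. Their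
   constants may depend on N, eps, sigma and lambda, as may the growth constant of [V]: they affect
   only k and the size of the penalty, neither of which survives in the final inequality. *)
From HB Require Import structures.
Require Import Defs.
From mathcomp Require Import all_boot all_order all_algebra.
From mathcomp Require Import all_classical all_reals all_analysis.
From mathcomp Require Import ring lra.
Import Order.TTheory GRing.Theory Num.Theory.
Import numFieldNormedType.Exports.
Local Open Scope ring_scope.
Local Open Scope classical_set_scope.

Set Implicit Arguments.
Unset Strict Implicit.

(** * Calculus along lines *)

Section directional_calculus.
Context (R : realType) (W : normedModType R).
Implicit Types (f : W -> R) (x v w : W).

(** The division-free form also covers [h = 0], which makes derivatives easy to rescale and to add
    along different directions. *)
Lemma is_derive_epsP f x v (d : R) :
  is_derive x v f d <->
  forall e : R, 0 < e -> exists2 del : R, 0 < del &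
    forall h : R, `|h| < del -> `|f (x + h *: v) - f x - h * d| <= e * `|h|.
Proof.
have E h : h != 0 -> `|f (x + h *: v) - f x - h * d| =
    `|d - h^-1 *: (f (h *: v + x) - f x)| * `|h|.
  move=> h0; rewrite -normrM distrC mulrBl -[h^-1 *: _]/(h^-1 * _).
  by rewrite -[_ * _ * h]mulrC mulrA mulfV// mul1r [d * h]mulrC (addrC x).
split=> [[cf df] e e0|H].
  have : (fun h => h^-1 *: ((f \o shift x) (h *: v) - f x)) @ 0^' --> d.
    by rewrite -df.
  move=> /cvgrPdist_le /(_ e e0) [del /= del0 Hdel]; exists del => // h hdel.
  have [->|h0] := eqVneq h 0.
    by rewrite scale0r addr0 subrr mul0r subrr normr0 mulr0.
  have := Hdel h; rewrite /= sub0r normrN => /(_ hdel h0) ?.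
  by rewrite E// ler_wpM2r.
have cf : (fun h => h^-1 *: ((f \o shift x) (h *: v) - f x)) @ 0^' --> d.
  apply/cvgrPdist_le => e e0; have [del del0 Hdel] := H e e0.
  exists del => //= h; rewrite /= sub0r normrN => hdel h0.
  by have := Hdel h hdel; rewrite E// ler_pM2r// normr_gt0.
by split; [apply/cvg_ex; exists d|apply: cvg_lim].
Qed.

Lemma is_derive_line f x v (s d : R) :
  is_derive (x + s *: v) v f d -> is_derive s 1 (fun s => f (x + s *: v)) d.
Proof.
move=> [cf df]; have E : (fun h : R => h^-1 *: (((fun s => f (x + s *: v)) \o shift s)
    (h *: 1) - f (x + s *: v))) =
    (fun h => h^-1 *: ((f \o shift (x + s *: v)) (h *: v) - f (x + s *: v))).
  apply/funext => h /=; congr (_ *: (f _ - _)).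
  by rewrite [h%:A]mulr1 scalerDl addrCA.
by split; rewrite /derivable /derive E.
Qed.

Lemma is_derive_line_at0 f x v (d : R) :
  is_derive x v f d <-> is_derive (0 : R) (1 : R) (fun s : R => f (x + s *: v)) d.
Proof.
split=> [H|]; first by apply: is_derive_line; rewrite scale0r addr0.
move=> [cf df]; have E : (fun h : R => h^-1 *: (((fun s => f (x + s *: v)) \o shift 0)
    (h *: 1) - f (x + 0 *: v))) =
    (fun h => h^-1 *: ((f \o shift x) (h *: v) - f x)).
  apply/funext => h /=.
  by rewrite [h%:A]mulr1 addr0 scale0r addr0 (addrC x).
by split; rewrite /derivable /derive -E.
Qed.

Lemma MVT_line f (df : R -> R) x v :
  (forall s : R, 0 <= s <= 1 -> is_derive (x + s *: v) v f (df s)) ->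
  exists2 s : R, 0 < s < 1 & f (x + v) - f x = df s.
Proof.
move=> H; pose g (s : R) := f (x + s *: v).
have dg (s : R) : 0 <= s <= 1 -> is_derive s 1 g (df s).
  by move=> /H /is_derive_line.
have [||c] := @MVT _ g df 0 1 ltr01.
- by move=> s; rewrite in_itv/= => /andP[s0 s1]; apply: dg; rewrite !ltW.
- apply: derivable_within_continuous => s; rewrite in_itv/= => /dg ds.
  exact: ex_derive.
rewrite in_itv/= => c01; rewrite /g scale1r scale0r addr0 subr0 mulr1.
by move=> E; exists c.
Qed.

Lemma is_derive_scaled_direction f x v (a d : R) :
  is_derive x v f d -> is_derive x (a *: v) f (a * d).
Proof.
move=> /is_derive_epsP H; apply/is_derive_epsP => e e0.
have a1 : 0 < 1 + `|a| by rewrite ltr_pwDl.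
have [del del0 Hdel] := H (e / (1 + `|a|)) ltac:(by rewrite divr_gt0).
exists (del / (1 + `|a|)) => [|h]; first by rewrite divr_gt0.
rewrite ltr_pdivlMr// => hd.
have hah : `|h * a| <= `|h| * (1 + `|a|) by rewrite normrM ler_wpM2l// lerDr.
have := Hdel (h * a) (le_lt_trans hah hd); rewrite scalerA mulrA.
move=> /le_trans; apply; rewrite mulrAC ler_pdivrMr// -mulrA ler_wpM2l// ltW//.
Qed.

End directional_calculus.

Section one_variable.
Context (R : realType).
Implicit Types g : R -> R.

Lemma is_derive_affine g (a b s d : R) : is_derive (a + s * b) 1 g d ->
  is_derive s 1 (fun s => g (a + s * b)) (b * d).
Proof.
move=> /(is_derive_scaled_direction (W := R^o) b) H.
by apply: (@is_derive_line R R^o g a b s (b * d)); rewrite -[X in is_derive _ X]mulr1.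
Qed.

Lemma MVT_R g (dg : R -> R) a b : (forall x : R, is_derive x 1 g (dg x)) ->
  exists2 s : R, 0 < s < 1 & g b - g a = dg (a + s * (b - a)) * (b - a).
Proof.
move=> H.
have [s _|s s01] := @MVT_line R R^o g
    (fun s => (b - a) * dg (a + s * (b - a))) a (b - a).
  have := is_derive_scaled_direction (W := R^o) (b - a) (H (a + s * (b - a))).
  by rewrite [(b - a)%:A]mulr1.
by rewrite subrKC => E; exists s => //; rewrite E mulrC.
Qed.

(** One-sided on purpose: a maximum in time may sit at the left end of the time interval, where only
    later times can be compared. *)
Lemma right_max_derive_le0 g (d e : R) : 0 < e -> is_derive (0 : R) 1 g d ->
  (forall s : R, 0 <= s <= e -> g s <= g 0) -> d <= 0.
Proof.
move=> e0 /(@is_derive_epsP R R^o _ 0 1) H gm.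
rewrite leNgt; apply/negP => d0.
have [del del0 Hdel] := H (d / 2) ltac:(by rewrite divr_gt0).
pose h := Num.min (del / 2) e.
have h0 : 0 < h by rewrite lt_min e0 divr_gt0.
have hd : h < del by rewrite gt_min gtr_pMr// invf_lt1// ltr1n.
have he : h <= e by rewrite ge_min lexx orbT.
have := Hdel h; rewrite gtr0_norm// => /(_ hd).
rewrite add0r [h%:A]mulr1.
have := gm h; rewrite (ltW h0) he => /(_ isT) gh.
have hd0 : 0 < h * d by rewrite mulr_gt0.
rewrite ler_norml => /andP[+ _]; lra.
Qed.

Lemma max_derive_eq0 g (d e : R) : 0 < e -> is_derive (0 : R) 1 g d ->
  (forall s : R, `|s| <= e -> g s <= g 0) -> d = 0.
Proof.
move=> e0 gd gm; apply/eqP; rewrite eq_le; apply/andP; split.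
  apply: (right_max_derive_le0 e0 gd) => s /andP[s0 se].
  by apply: gm; rewrite ger0_norm.
rewrite -oppr_le0.
apply: (@right_max_derive_le0 (fun s => g (- s)) _ _ e0) => [|s /andP[s0 se]].
  have := @is_derive_affine g 0 (-1) 0 d.
  rewrite mul0r addr0 => /(_ gd); rewrite mulN1r.
  by under eq_fun do rewrite add0r mulrN1.
by rewrite oppr0; apply: gm; rewrite normrN ger0_norm.
Qed.

(** The mean value theorem is applied to [g s + g (- s) - 2 * g 0 - c * s ^+ 2], whose derivative
    would be positive for small [s > 0] if [g2 > c]. *)
Lemma second_difference_derive2_le g (g1 : R -> R) (g2 c : R) :
  (forall s : R, is_derive s 1 g (g1 s)) -> is_derive (0 : R) 1 g1 g2 ->
  (forall s : R, `|s| <= 1 -> g s + g (- s) - 2 * g 0 <= c * s ^+ 2) -> g2 <= c.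
Proof.
move=> dg dg1 H; rewrite leNgt; apply/negP => cg.
move: dg1 => /(@is_derive_epsP R R^o _ 0 1) H1.
have [del del0 Hdel] := H1 ((g2 - c) / 2) ltac:(by rewrite divr_gt0// subr_gt0).
pose h := Num.min (del / 2) 1.
have h0 : 0 < h by rewrite lt_min ltr01 divr_gt0.
have hd : h < del by rewrite gt_min gtr_pMr// invf_lt1// ltr1n.
have he : h <= 1 by rewrite ge_min lexx orbT.
pose phi s := g s + g (- s) - 2 * g 0 - c * s ^+ 2.
have dphi (s : R) : is_derive s 1 phi (g1 s - g1 (- s) - 2 * c * s).
  have dm : is_derive s 1 (fun s => g (- s)) (- g1 (- s)).
    have := @is_derive_affine g 0 (-1) s (g1 (- s)).
    rewrite add0r mulrN1 mulN1r => /(_ (dg _)).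
    by under eq_fun do rewrite add0r mulrN1.
  have := dg s; move=> ?.
  apply: is_derive_eq. rewrite -[c *: _]/(c * _) ![s%:A]mulr1; ring.
have [s /andP[s0 s1]] := MVT_R 0 h dphi.
rewrite add0r subr0 {1 2}/phi oppr0.
have := H h; rewrite ger0_norm ?(ltW h0)// => /(_ he) Hh.
move=> E; have : (g1 (s * h) - g1 (- (s * h)) - 2 * c * (s * h)) * h <= 0.
  by rewrite -E; rewrite expr0n/=; lra.
rewrite pmulr_lle0// leNgt => /negP; apply.
have sh0 : 0 < s * h by rewrite mulr_gt0.
have shd : `|s * h| < del.
  by rewrite gtr0_norm// (le_lt_trans _ hd)// ler_piMl// ltW.
have := Hdel _ shd; have := Hdel (- (s * h)); rewrite normrN => /(_ shd).
rewrite !add0r ![_%:A]mulr1 (gtr0_norm sh0) !ler_norml => /andP[_ A] /andP[B _].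
have : 0 < s * h * (g2 - c) by rewrite mulr_gt0// subr_gt0.
nra.
Qed.

End one_variable.

Section gradient.
Context (R : realType) (n : nat).
Local Notation rV := 'rV[R]_n.+1.
Implicit Types (g : rV -> R) (x v w : rV).

(** Regularity of the solution is given through partial derivatives; their continuity at [x] yields
    all directional ones. The coordinates of [v] are switched on one at a time, with the mean value
    theorem for each. *)
Lemma partial_line_derive g (G : 'I_n.+1 -> rV -> R) x v :
  (forall j y, is_derive y (delta_mx 0 j) g (G j y)) ->
  (forall j, {for x, continuous (G j)}) ->
  is_derive x v g (\sum_j v 0 j * G j x).
Proof.
move=> dg cG.
suff H (r : seq 'I_n.+1) : is_derive x (\sum_(j <- r) v 0 j *: delta_mx 0 j) g
    (\sum_(j <- r) v 0 j * G j x).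
  by have := H (index_enum 'I_n.+1); rewrite -row_sum_delta.
elim: r => [|k r IH]; first by rewrite !big_nil; exact: is_derive0.
rewrite !big_cons; set u := \sum_(j <- r) _ in IH *; set d := \sum_(j <- r) _ in IH *.
set a := v 0 k; set ek : rV := delta_mx 0 k.
apply/is_derive_epsP => e e0.
have e2 : 0 < e / 2 by rewrite divr_gt0.
move/is_derive_epsP: IH => /(_ _ e2)[d1 d10 H1].
have a1 : 0 < 1 + `|a| by rewrite ltr_pwDl.
have /cvgrPdist_le/(_ (e / 2 / (1 + `|a|))) := cG k.
rewrite divr_gt0// => /(_ isT)/nbhs_ballP[d2 /= d20 H2].
(* [M] bounds the displacement of the intermediate point per unit of |h|, so |h| M < d2 keeps that
   point where [G k] is close to its value at [x]. *)
pose M := 1 + `|u| + `|a *: ek|.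
have M0 : 0 < M by rewrite /M -addrA ltr_pwDl// addr_ge0.
exists (Num.min d1 (d2 / M)) => [|h]; first by rewrite lt_min d10 divr_gt0.
rewrite lt_min => /andP[hd1]; rewrite ltr_pdivlMr// => hd2.
have [s /andP[s0 s1]|s /andP[s0 s1]] := @MVT_line R _ g
   (fun s => h * a * G k (x + h *: u + s *: (h * a *: ek))) (x + h *: u) (h * a *: ek).
  by apply: is_derive_scaled_direction; apply: dg.
set y := x + h *: u + s *: _ => E.
have yb : ball x d2 y.
  rewrite -ball_normE/= /y -addrA opprD addNKr normrN.
  rewrite (le_lt_trans _ hd2)// (le_trans (ler_normD _ _))//.
  have -> : s *: (h * a *: ek) = (s * h) *: (a *: ek) by rewrite !scalerA mulrA.
  rewrite !normrZ (gtr0_norm s0) /M.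
  have : s * `|h| * (`|a| * `|ek|) <= `|h| * (`|a| * `|ek|).
    by rewrite ler_wpM2r ?mulr_ge0// ler_piMl// ltW.
  by rewrite normrZ; have := normr_ge0 h; lra.
have {}H2 := H2 _ yb.
have -> : x + h *: (a *: ek + u) = x + h *: u + h * a *: ek.
  by rewrite scalerDr scalerA addrA addrAC.
have -> : g (x + h *: u + h * a *: ek) - g x - h * (a * G k x + d) =
    (g (x + h *: u) - g x - h * d) + h * a * (G k y - G k x).
  by rewrite -[g (_ + _ *: ek)](subrK (g (x + h *: u))) E; ring.
rewrite (le_trans (ler_normD _ _))//.
rewrite [e in leRHS]splitr mulrDl lerD// ?H1// !normrM -mulrA mulrC ler_wpM2r//.
rewrite distrC (le_trans (ler_wpM2l _ H2))//.
rewrite mulrCA ler_piMr//; first by rewrite ltW.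
by rewrite ler_pdivrMr// mul1r lerDr.
Qed.

Definition C2 g : Prop := forall i j : 'I_n.+1,
  [/\ forall x, derivable g x (delta_mx 0 j), continuous (partial j g),
      forall x, derivable (partial j g) x (delta_mx 0 i) &
      continuous (partial i (partial j g))].

Definition dgrad g v x : R := \sum_j v 0 j * partial j g x.
Definition hess g v x : R :=
  \sum_i \sum_j partial i (partial j g) x * v 0 i * v 0 j.

Lemma C2_is_derive g x v (s : R) : C2 g ->
  is_derive s 1 (fun s : R => g (x + s *: v)) (dgrad g v (x + s *: v)).
Proof.
move=> g2; apply: is_derive_line.
apply: (@partial_line_derive g (fun j => partial j g)) => [j y|j].
  by have [+ _ _ _] := g2 j j => /(_ y) /derivableP.
by have [_ + _ _] := g2 j j; apply.
Qed.

Lemma C2_is_derive2 g x v (s : R) : C2 g ->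
  is_derive s 1 (fun s : R => dgrad g v (x + s *: v)) (hess g v (x + s *: v)).
Proof.
move=> g2; pose y : rV := x + s *: v.
have dj j : is_derive s 1 (fun s : R => v 0 j * partial j g (x + s *: v))
    (v 0 j * \sum_i v 0 i * partial i (partial j g) y).
  have := @partial_line_derive (partial j g) (fun i => partial i (partial j g)) y v.
  move=> /(_ _ _)/is_derive_line H.
  have {}H : is_derive s 1 (fun s : R => partial j g (x + s *: v))
     (\sum_i v 0 i * partial i (partial j g) y).
    apply: H => [i z|i]; first by have [_ _ + _] := g2 i j => /(_ z) /derivableP.
    by have [_ _ _] := g2 i j; apply.
  exact: is_deriveZ.
have := @is_derive_sum R R R _ (fun j (s : R) => v 0 j * partial j g (x + s *: v)) s 1 _ dj.
rewrite (_ : \sum_(i < n.+1) _ = fun s : R => dgrad g v (x + s *: v)); last first.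
  by apply/funext => r; rewrite fct_sumE.
rewrite (_ : \sum_(i < n.+1) _ = hess g v y)//.
rewrite /hess exchange_big; apply: eq_bigr => j _; rewrite mulr_sumr.
by apply: eq_bigr => i _; ring.
Qed.

(** Three base points carried along by one common translation: this is how a maximum in [m] acts on
    [m + h], [m - h] and [m]. With two zero weights it also recovers a single Hessian at the end. *)
Lemma hess_le_second_difference g (a b d c : R) x y z v : C2 g ->
  (forall s : R, `|s| <= 1 ->
    a * g (x + s *: v) + b * g (y + s *: v) + d * g (z + s *: v) +
    (a * g (x + - s *: v) + b * g (y + - s *: v) + d * g (z + - s *: v)) -
    2 * (a * g x + b * g y + d * g z) <= c * s ^+ 2) ->
  a * hess g v x + b * hess g v y + d * hess g v z <= c.
Proof.
move=> g2 H.
pose A (s : R) := a * g (x + s *: v) + b * g (y + s *: v) + d * g (z + s *: v).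
pose A1 s := a * dgrad g v (x + s *: v) + b * dgrad g v (y + s *: v)
   + d * dgrad g v (z + s *: v).
apply: (@second_difference_derive2_le _ A A1 _ c) => [s||s s1]; last first.
- by rewrite /A !scale0r !addr0; exact: H.
- have := (C2_is_derive2 x v 0 g2, C2_is_derive2 y v 0 g2, C2_is_derive2 z v 0 g2).
  move=> [[? ?] ?]; apply: is_derive_eq.
  by rewrite !scale0r !addr0.
- have := (C2_is_derive x v s g2, C2_is_derive y v s g2, C2_is_derive z v s g2).
  by move=> [[? ?] ?]; apply: is_derive_eq.
Qed.

End gradient.

Lemma fst_continuous_map (X Y : topologicalType) : continuous (@fst X Y).
Proof. by move=> [x y]; exact: cvg_fst. Qed.

Lemma snd_continuous_map (X Y : topologicalType) : continuous (@snd X Y).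
Proof. by move=> [x y]; exact: cvg_snd. Qed.

Lemma pair_continuous_map (X Y Z : topologicalType) (f : X -> Y) (g : X -> Z) :
  continuous f -> continuous g -> continuous (fun x => (f x, g x)).
Proof. by move=> cf cg x; exact: (cvg_pair (cf x) (cg x)). Qed.

Lemma within_continuous_comp (X Y Z : topologicalType) (phi : X -> Y) (f : Y -> Z)
    (K : set X) (S : set Y) : continuous phi -> (forall x, K x -> S (phi x)) ->
  {within S, continuous f} -> {within K, continuous (fun x => f (phi x))}.
Proof.
move=> cphi KS /subspace_continuousP cf; apply/subspace_continuousP => x Kx A.
move=> /(cf _ (KS _ Kx)) /= H.
have : nbhs (phi x) [set y | S y -> A (f y)] by [].
move=> /cphi H'; move: (H' : nbhs x _); rewrite /within/=.
by apply: filterS => y SA Ky; apply: SA; apply: KS.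
Qed.

(** * Squared norms and the penalty *)

Section squared_norm.
Context (R : realType) (n : nat).
Local Notation rV := 'rV[R]_n.+1.
Implicit Types (x v w : rV).

Definition sqn x : R := \sum_i x 0 i ^+ 2.
Definition dot x v : R := \sum_i x 0 i * v 0 i.

Lemma sqn_ge0 x : 0 <= sqn x.
Proof. by apply: sumr_ge0 => i _; exact: sqr_ge0. Qed.

Lemma sqr_coord_le_sqn x i : x 0 i ^+ 2 <= sqn x.
Proof.
by rewrite /sqn (bigD1 i)//= lerDl sumr_ge0// => j _; exact: sqr_ge0.
Qed.

Lemma sqnDZ x v (s : R) : sqn (x + s *: v) = sqn x + 2 * s * dot x v + s ^+ 2 * sqn v.
Proof.
rewrite /sqn /dot !mulr_sumr -!big_split/=; apply: eq_bigr => i _.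
by rewrite !mxE; ring.
Qed.

Lemma dot_sqr_le x v : dot x v ^+ 2 <= sqn x * sqn v.
Proof.
have [v0|v0] := eqVneq (sqn v) 0.
  rewrite /dot big1 ?expr0n ?mulr_ge0 ?sqn_ge0// => i _.
  have := sqr_coord_le_sqn v i; rewrite v0.
  by rewrite exprn_even_le0//= => /eqP->; rewrite mulr0.
have vp : 0 < sqn v by rewrite lt_neqAle eq_sym v0 sqn_ge0.
have := sqn_ge0 (sqn v *: x + - dot x v *: v); rewrite sqnDZ.
have -> : sqn (sqn v *: x) = sqn v ^+ 2 * sqn x.
  by rewrite /sqn mulr_sumr; apply: eq_bigr => i _; rewrite mxE exprMn.
have -> : dot (sqn v *: x) v = sqn v * dot x v.
  by rewrite /dot mulr_sumr; apply: eq_bigr => i _; rewrite mxE mulrA.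
move=> H; have : 0 <= sqn v * (sqn x * sqn v - dot x v ^+ 2) by nra.
by rewrite pmulr_rge0// subr_ge0.
Qed.

Lemma sqnN x : sqn (- x) = sqn x.
Proof. by apply: eq_bigr => i _; rewrite mxE sqrrN. Qed.

Lemma sqnD_le x y : sqn (x + y) <= 2 * (sqn x + sqn y).
Proof.
rewrite /sqn -big_split mulr_sumr; apply: ler_sum => i _; rewrite mxE /=.
by have := sqr_ge0 (x 0 i - y 0 i); nra.
Qed.

Lemma sqn_delta i : sqn (delta_mx 0 i) = 1.
Proof.
rewrite /sqn (bigD1 i)//= big1 ?addr0 ?mxE ?eqxx ?expr1n// => j ji.
by rewrite mxE eqxx/= (negbTE ji) expr0n.
Qed.

Lemma dot_delta x i : dot x (delta_mx 0 i) = x 0 i.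
Proof.
rewrite /dot (bigD1 i)//= big1 ?addr0 ?mxE ?eqxx ?mulr1// => j ji.
by rewrite mxE eqxx/= (negbTE ji) mulr0.
Qed.

Lemma hess_delta g x i : hess g (delta_mx 0 i) x = partial i (partial i g) x.
Proof.
rewrite /hess (bigD1 i)//= [X in _ + X]big1 ?addr0 => [|j ji].
  rewrite (bigD1 i)//= big1 ?addr0 ?mxE ?eqxx ?mulr1// => j ji.
  by rewrite !mxE !eqxx/= (negbTE ji) mulr0.
by rewrite big1// => k _; rewrite !mxE !eqxx/= (negbTE ji) mulr0 mul0r.
Qed.

Lemma hess_ones g x :
  hess g (const_mx 1) x = \sum_i \sum_j partial i (partial j g) x.
Proof. by apply: eq_bigr => i _; apply: eq_bigr => j _; rewrite !mxE !mulr1. Qed.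

Lemma sqn_ones : sqn (const_mx 1) = n.+1%:R.
Proof.
rewrite /sqn (eq_bigr (fun=> 1)) => [|i _]; last by rewrite mxE expr1n.
by rewrite sumr_const card_ord.
Qed.

Lemma continuous_sqn : continuous sqn.
Proof.
suff H (r : seq 'I_n.+1) : continuous (fun x : rV => \sum_(i <- r) x 0 i ^+ 2).
  exact: H.
elim: r => [|i r IH].
  rewrite (_ : (fun _ => _) = cst (0 : R)); first exact: cst_continuous.
  by apply/funext => x; rewrite big_nil.
rewrite (_ : (fun _ => _) = (fun x : rV => x 0 i ^+ 2)
    + (fun x : rV => \sum_(i <- r) x 0 i ^+ 2)).
  move=> x; apply: continuousD; last exact: IH.
  apply: (@continuous_comp _ _ _ (fun x : rV => x 0 i) (fun y : R => y ^+ 2)).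
    exact: coord_continuous.
  exact: exprn_continuous.
by apply/funext => x; rewrite big_cons.
Qed.

(** The penalty dominates its own second differences with a factor depending on [v] only, so the
    second-order terms of the equation cost a multiple of the penalty itself. The quartic remainder
    in [s] is absorbed through |s| <= 1. *)
Lemma barrier_second_difference m h v (s : R) : `|s| <= 1 ->
  (1 + sqn (m + s *: v) + sqn h) ^+ 2 + (1 + sqn (m + - s *: v) + sqn h) ^+ 2
    - 2 * (1 + sqn m + sqn h) ^+ 2 <=
  (12 * sqn v + 2 * sqn v ^+ 2) * (1 + sqn m + sqn h) ^+ 2 * s ^+ 2.
Proof.
move=> s1; rewrite !sqnDZ; have := dot_sqr_le m v.
have := (sqn_ge0 m, sqn_ge0 h, sqn_ge0 v).
move: (sqn m) (sqn h) (sqn v) (dot m v) => a b c d [[a0 b0] c0] H.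
have s2 : s ^+ 2 <= 1 by rewrite -real_normK ?num_real// expr_le1.
have s20 := sqr_ge0 s.
have -> : (1 + (a + 2 * s * d + s ^+ 2 * c) + b) ^+ 2 +
  (1 + (a + 2 * - s * d + (- s) ^+ 2 * c) + b) ^+ 2 -
  2 * (1 + a + b) ^+ 2 =
  (4 * c * (1 + a + b) + 2 * s ^+ 2 * c ^+ 2 + 8 * d ^+ 2) * s ^+ 2 by ring.
apply: ler_wpM2r => //.
have W0 : 1 <= 1 + a + b by lra.
have W1 : 1 <= (1 + a + b) ^+ 2 by nra.
have W2 : 1 + a + b <= (1 + a + b) ^+ 2 by nra.
have : 4 * c * (1 + a + b) <= 4 * c * (1 + a + b) ^+ 2 by rewrite ler_wpM2l// mulr_ge0.
have : 2 * s ^+ 2 * c ^+ 2 <= 2 * c ^+ 2 * (1 + a + b) ^+ 2.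
  have c20 := sqr_ge0 c.
  have : s ^+ 2 * c ^+ 2 <= 1 * c ^+ 2 by rewrite ler_wpM2r.
  have : c ^+ 2 * 1 <= c ^+ 2 * (1 + a + b) ^+ 2 by rewrite ler_wpM2l.
  lra.
have : a * c <= c * (1 + a + b) ^+ 2 by rewrite mulrC ler_wpM2l//; lra.
lra.
Qed.

End squared_norm.

(** * Maximum principle for second differences *)

Section maximum_principle.
Context (R : realType) (n : nat).
Local Notation rV := 'rV[R]_n.+1.
Implicit Types (x v w m h : rV).

Lemma box_compact (r : R) : compact [set v : rV | forall i, `|v 0 i| <= r].
Proof.
rewrite (_ : mkset _ = [set v : rV | forall i, `[- r, r]%classic (v 0 i)]).
  by apply: (@rV_compact R _ (fun=> `[- r, r]%classic)) => i; exact: segment_compact.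
by apply/seteqP; split=> v /= H i; have := H i; rewrite /= in_itv/= ler_norml.
Qed.

Lemma sqn_gt_outside_box (r : R) x :
  ~ (forall i, `|x 0 i| <= r) -> 0 <= r -> r ^+ 2 < sqn x.
Proof.
move=> /existsNP[i /negP]; rewrite -ltNge => rx r0.
apply: lt_le_trans (sqr_coord_le_sqn x i).
by rewrite -[ltRHS]real_normK ?num_real// ltrXn2r.
Qed.

Lemma global_max_of_nonpositive_far (t0 T C : R) (Phi : R -> rV -> rV -> R) m0 h0 :
  t0 <= T -> 0 <= C ->
  {within [set z : R * (rV * rV) | t0 <= z.1 <= T],
    continuous (fun z : R * (rV * rV) => Phi z.1 z.2.1 z.2.2)} ->
  (forall t m h, t0 <= t <= T -> C <= 1 + sqn m + sqn h -> Phi t m h <= 0) ->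
  0 < Phi t0 m0 h0 ->
  exists t1 m1 h1, [/\ t0 <= t1 <= T, 0 < Phi t1 m1 h1 &
    forall t m h, t0 <= t <= T -> Phi t m h <= Phi t1 m1 h1].
Proof.
move=> t0T C0 cPhi far pos.
pose r := C + 1; have r1 : 1 <= r by rewrite /r lerDr.
have r0 : 0 <= r by exact: le_trans r1.
pose K : set (R * (rV * rV)) := `[t0, T]%classic `*`
  ([set v : rV | forall i, `|v 0 i| <= r] `*` [set v : rV | forall i, `|v 0 i| <= r]).
have out t m h : t0 <= t <= T -> ~ K (t, (m, h)) -> Phi t m h <= 0.
  move=> tT nK; apply: far => //.
  have rr : r <= r ^+ 2 by rewrite expr2 ler_peMl.
  have Cr : C <= r ^+ 2 by rewrite (le_trans _ rr)// /r lerDl.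
  have [m_in|m_out] := pselect (forall i, `|m 0 i| <= r); last first.
    have := sqn_gt_outside_box m_out r0; have := sqn_ge0 h; lra.
  have [h_in|h_out] := pselect (forall i, `|h 0 i| <= r); last first.
    have := sqn_gt_outside_box h_out r0; have := sqn_ge0 m; lra.
  by exfalso; apply: nK; split => //=; rewrite in_itv.
have K0 : K (t0, (m0, h0)).
  apply: contrapT => /out; rewrite lexx t0T => /(_ isT).
  by rewrite leNgt pos.
have cK : compact K.
  by apply: compact_setX; [exact: segment_compact|apply: compact_setX; exact: box_compact].
have KS : K `<=` [set z | t0 <= z.1 <= T] by move=> [t [m h]] [/=]; rewrite in_itv.
have [|[t1 [m1 h1]] + H] := compact_EVT_max _ cK (continuous_subspaceW KS cPhi).
  by exists (t0, (m0, h0)).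
rewrite inE => K1; exists t1, m1, h1.
have p1 : 0 < Phi t1 m1 h1 by apply: lt_le_trans pos (H (t0, (m0, h0)) _); rewrite inE.
split => // [|t m h tT]; first exact: (KS _ K1).
have [Kt|/(out _ _ _ tT) Pt] := pselect (K (t, (m, h))).
  by apply: (H (t, (m, h))); rewrite inE.
exact: le_trans Pt (ltW p1).
Qed.

Lemma is_derive_expR_affine (a k T s : R) :
  is_derive s 1 (fun s => a * expR (k * (T - s))) (- (k * (a * expR (k * (T - s))))).
Proof.
have := @is_derive_affine R expR (k * T) (- k) s (expR (k * T + s * - k)) (is_derive_expR _).
rewrite (_ : (fun _ => _) = (fun s => expR (k * (T - s)))); last first.
  by apply/funext => r; congr expR; ring.
move=> H; apply: is_derive_eq.
rewrite -[_ *: _]/(_ * _) (_ : k * T + s * - k = k * (T - s)); ring.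
Qed.

End maximum_principle.

Section penalized_maximum.
Context (R : realType) (n : nat).
Local Notation rV := 'rV[R]_n.+1.
Implicit Types (x v w m h : rV).

Definition diff2 (g : rV -> R) m h : R := g (m + h) + g (m - h) - 2 * g m.

Definition penalized S c rho (g : rV -> R) m h : R :=
  S * diff2 g m h - c * sqn h - rho * (1 + sqn m + sqn h) ^+ 2.

Variables (S c rho : R) (g : rV -> R) (m h : rV).
Hypothesis g2 : C2 g.
Hypothesis rho0 : 0 <= rho.
Hypothesis maxmh : forall m' h', penalized S c rho g m' h' <= penalized S c rho g m h.

Lemma penalized_shift v (s : R) : penalized S c rho g (m + s *: v) h =
  (S * g (m + h + s *: v) + S * g (m - h + s *: v) + (- (2 * S)) * g (m + s *: v))
  - c * sqn h - rho * (1 + sqn (m + s *: v) + sqn h) ^+ 2.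
Proof. by rewrite /penalized /diff2 !(addrAC m _ (s *: v)); ring. Qed.

(** Translating [m] moves the three points together and leaves [h] alone: [c * sqn h] drops out and
    only the penalty contributes. *)
Lemma penalized_max_hess v :
  S * (hess g v (m + h) + hess g v (m - h) - 2 * hess g v m) <=
  rho * ((12 * sqn v + 2 * sqn v ^+ 2) * (1 + sqn m + sqn h) ^+ 2).
Proof.
have E (a b d e : R) : d * (a + b - 2 * e) = d * a + d * b + (- (2 * d)) * e by ring.
rewrite E.
apply: (@hess_le_second_difference R n g S S (- (2 * S)) _ (m + h) (m - h) m v g2) => s s1.
have := barrier_second_difference m h v s1.
move=> /(ler_wpM2l rho0).
have := maxmh (m + s *: v) h; have := maxmh (m + (- s) *: v) h.
rewrite !penalized_shift.
rewrite /penalized /diff2 => H1 H2 H3.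
have aux (A1 A2 w1 w2 w0 Q cc r x y z S' : R) :
   A1 - cc - r * w1 <= S' * (x + y - 2 * z) - cc - r * w0 ->
   A2 - cc - r * w2 <= S' * (x + y - 2 * z) - cc - r * w0 ->
   r * (w2 + w1 - 2 * w0) <= Q -> A2 + A1 - 2 * (S' * x + S' * y + - (2 * S') * z) <= Q.
  by move=> *; lra.
apply: (aux _ _ _ _ _ _ _ _ _ _ _ _ H1 H2).
by rewrite (le_trans H3)// !mulrA.
Qed.

Lemma dgrad_delta x i : dgrad g (delta_mx 0 i) x = partial i g x.
Proof.
rewrite /dgrad (bigD1 i)//= big1 ?addr0 ?mxE ?eqxx ?mul1r// => j ji.
by rewrite mxE eqxx/= (negbTE ji) mul0r.
Qed.

(** The sum and the difference of this condition and the next determine the gradients at [m + h] and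
    [m - h] separately: up to the sign [S], they differ from the gradient at [m] by c h_i and - c
    h_i respectively, plus 2 rho w times the coordinate of the point itself. *)
Lemma penalized_max_grad_center i :
  S * (partial i g (m + h) + partial i g (m - h) - 2 * partial i g m) =
  4 * rho * (1 + sqn m + sqn h) * m 0 i.
Proof.
pose v : rV := delta_mx 0 i.
apply/eqP; rewrite -subr_eq0; apply/eqP.
have gd : is_derive (0 : R) 1 (fun s : R => (S * g (m + h + s *: v) + S * g (m - h + s *: v)
      + (- (2 * S)) * g (m + s *: v))
    - c * sqn h - rho * (1 + (sqn m + 2 * s * m 0 i + s ^+ 2) + sqn h) ^+ 2)
    (S * (partial i g (m + h) + partial i g (m - h) - 2 * partial i g m) -
     4 * rho * (1 + sqn m + sqn h) * m 0 i).
  have := (C2_is_derive (m + h) v 0 g2, C2_is_derive (m - h) v 0 g2,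
    C2_is_derive m v 0 g2); rewrite !scale0r !addr0 !dgrad_delta.
  move=> [[? ?] ?]; apply: is_derive_eq; move: (partial i g (m + h)) => p.
  move: (partial i g (m - h)) (partial i g m) => q r.
  by rewrite /GRing.scale/=; ring.
apply: (max_derive_eq0 ltr01 gd) => s _.
have E r : penalized S c rho g (m + r *: v) h =
    (S * g (m + h + r *: v) + S * g (m - h + r *: v)
      + (- (2 * S)) * g (m + r *: v))
    - c * sqn h - rho * (1 + (sqn m + 2 * r * m 0 i + r ^+ 2) + sqn h) ^+ 2.
  by rewrite penalized_shift sqnDZ dot_delta sqn_delta mulr1.
by rewrite -!E scale0r addr0.
Qed.

Lemma penalized_max_grad_step i :
  S * (partial i g (m + h) - partial i g (m - h)) =
  (2 * c + 4 * rho * (1 + sqn m + sqn h)) * h 0 i.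
Proof.
pose v : rV := delta_mx 0 i.
apply/eqP; rewrite -subr_eq0; apply/eqP.
(* Varying [h] moves [m + h] and [m - h] in opposite directions and fixes [m]. *)
have gd : is_derive (0 : R) 1 (fun s : R =>
    S * (g (m + h + s *: v) + g (m - h + s *: - v) - 2 * g m)
    - c * (sqn h + 2 * s * h 0 i + s ^+ 2)
    - rho * (1 + sqn m + (sqn h + 2 * s * h 0 i + s ^+ 2)) ^+ 2)
    (S * (partial i g (m + h) - partial i g (m - h)) -
     (2 * c + 4 * rho * (1 + sqn m + sqn h)) * h 0 i).
  have := (C2_is_derive (m + h) v 0 g2, C2_is_derive (m - h) (- v) 0 g2).
  have dgradN y : dgrad g (- v) y = - partial i g y.
    by rewrite -dgrad_delta /dgrad -sumrN; apply: eq_bigr => j _; rewrite !mxE mulNr.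
  rewrite !scale0r !addr0 !dgrad_delta dgradN.
  move=> [? ?]; apply: is_derive_eq; move: (partial i g (m + h)) => p.
  move: (partial i g (m - h)) => q.
  by rewrite /GRing.scale/=; ring.
apply: (max_derive_eq0 ltr01 gd) => s _.
have E r : penalized S c rho g m (h + r *: v) =
    S * (g (m + h + r *: v) + g (m - h + r *: - v) - 2 * g m)
    - c * (sqn h + 2 * r * h 0 i + r ^+ 2)
    - rho * (1 + sqn m + (sqn h + 2 * r * h 0 i + r ^+ 2)) ^+ 2.
  by rewrite /penalized /diff2 sqnDZ dot_delta sqn_delta mulr1 scalerN !opprD !addrA.
by rewrite -!E scale0r addr0.
Qed.

End penalized_maximum.

(* Arithmetic of the equation at an interior maximum: a, b, c, g stand for the time
   derivatives, the two second-order terms and the Hamiltonians at m + h, m - h, m. *)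
Lemma maximum_balance (R : realType) (a1 a2 a3 b1 b2 b3 c1 c2 c3 g1 g2 g3 : R)
    (s2 e2 S' N W Bc r Ck' k' : R) :
a1 + s2 * b1 + e2 * c1 + g1 = 0 -> a2 + s2 * b2 + e2 * c2 + g2 = 0 ->
a3 + s2 * b3 + e2 * c3 + g3 = 0 -> 0 <= s2 -> 0 <= e2 ->
S' * (b1 + b2 - 2 * b3) <= r * ((12 * N + 2 * N ^+ 2) * W) ->
S' * (c1 + c2 - 2 * c3) <= N * (r * (14 * W)) ->
S' * (g1 + g2 - 2 * g3) <= Bc + Ck' * r * W ->
S' * (a1 + a2 - 2 * a3) + Bc + k' * r * W <= 0 ->
k' = Ck' + (s2 * (12 * N + 2 * N ^+ 2) + e2 * (14 * N)) + 1 ->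
r * W <= 0.
Proof.
move=> A1 A2 A3 s20 e20 Hb Hc Hg Ht kE.
have {}Hb := ler_wpM2l s20 Hb; have {}Hc := ler_wpM2l e20 Hc.
have E1 : a1 = - (s2 * b1 + e2 * c1 + g1) by apply/eqP; rewrite -addr_eq0 !addrA A1.
have E2 : a2 = - (s2 * b2 + e2 * c2 + g2) by apply/eqP; rewrite -addr_eq0 !addrA A2.
have E3 : a3 = - (s2 * b3 + e2 * c3 + g3) by apply/eqP; rewrite -addr_eq0 !addrA A3.
have EX : S' * (a1 + a2 - 2 * a3) = - (s2 * (S' * (b1 + b2 - 2 * b3))
    + e2 * (S' * (c1 + c2 - 2 * c3)) + S' * (g1 + g2 - 2 * g3)).
  by rewrite E1 E2 E3; ring.
have EY : k' * r * W = Ck' * r * W + s2 * (r * ((12 * N + 2 * N ^+ 2) * W))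
    + e2 * (N * (r * (14 * W))) + r * W by rewrite kE; ring.
have fin (x y z p q w Bc' C' : R) : - (x + y + z) + Bc' + (C' + p + q + w) <= 0 ->
  x <= p -> y <= q -> z <= Bc' + C' -> w <= 0 by move=> *; lra.
by move: Ht; rewrite EX EY => /fin; apply.
Qed.

Section three_point_comparison.
Context (R : realType) (n : nat).
Local Notation rV := 'rV[R]_n.+1.
Implicit Types (x v w m h : rV).

Variables (T sigma eps S M B C Ck : R) (V G : R -> rV -> R).
Hypothesis S1 : `|S| <= 1.
Hypothesis M0 : 0 <= M.
Hypothesis C0 : 0 <= C.
Hypothesis Ck0 : 0 <= Ck.
Hypothesis cV : {within [set z : R * rV | 0 <= z.1 <= T],
  continuous (fun z : R * rV => V z.1 z.2)}.
Hypothesis dV : forall (t : R) x, 0 < t < T -> derivable (fun s => V s x) t 1.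
Hypothesis V2 : forall t : R, 0 < t < T -> C2 (V t).
Hypothesis pde : forall (t : R) x, 0 < t < T ->
  dtime V t x + sigma ^+ 2 / 2 * \sum_i \sum_j partial i (partial j (V t)) x
  + eps ^+ 2 / 2 * \sum_i partial i (partial i (V t)) x + G t x = 0.
Hypothesis growth : forall (t : R) x, 0 <= t <= T -> `|V t x| <= C * (1 + sqn x).
Hypothesis terminal : forall m h, S * diff2 (V T) m h <= M * sqn h.
(** All that is asked of the first-order part of the equation. The premises on the gradients are the
    first-order conditions at a maximum, so the inequality has to hold only where they do. *)
Hypothesis hamiltonian : forall (t rho : R) m h, 0 < t < T -> 0 <= rho ->
  let w := 1 + sqn m + sqn h in
  (forall i, S * (partial i (V t) (m + h) + partial i (V t) (m - h)
      - 2 * partial i (V t) m) = 4 * rho * w * m 0 i) ->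
  (forall i, S * (partial i (V t) (m + h) - partial i (V t) (m - h)) =
     (2 * (M * expR (B * (T - t))) + 4 * rho * w) * h 0 i) ->
  S * diff2 (G t) m h <= B * (M * expR (B * (T - t))) * sqn h + Ck * rho * w ^+ 2.

(** [trC] measures the second-order operator on the penalty: the direction (1,...,1) of the common
    noise has squared norm N, and each of the N coordinate directions contributes 12 + 2 = 14. The
    extra 1 in [k] leaves a positive multiple of the penalty in the final balance. *)
Let trC := sigma ^+ 2 / 2 * (12 * n.+1%:R + 2 * n.+1%:R ^+ 2)
  + eps ^+ 2 / 2 * (14 * n.+1%:R).
Let k := Ck + trC + 1.

Let Phi d t := penalized S (M * expR (B * (T - t))) (d * expR (k * (T - t))) (V t).

Let trC0 : 0 <= trC.
Proof.
rewrite /trC; apply: addr_ge0; (apply: mulr_ge0; first by rewrite divr_ge0 ?sqr_ge0).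
  by rewrite addr_ge0// mulr_ge0 ?sqr_ge0.
by rewrite mulr_ge0.
Qed.

Let k0 : 0 <= k.
Proof. by rewrite /k addr_ge0// addr_ge0. Qed.

(** Quadratic growth bounds the second difference of [V] by 6 C w, which the penalty, at least d
    w^2, outweighs once d w >= 6 C. *)
Lemma Phi_le0_far d t m h : 0 < d -> 0 <= t <= T -> 6 * C / d <= 1 + sqn m + sqn h ->
  Phi d t m h <= 0.
Proof.
move=> d0 tT; set w := 1 + _ + _; rewrite ler_pdivrMr// => wd.
have w1 : 1 <= w by rewrite /w; have := (sqn_ge0 m, sqn_ge0 h) => -[]; lra.
have A : S * diff2 (V t) m h <= 6 * C * w.
  apply: (le_trans (ler_norm _)); rewrite normrM.
  apply: (@le_trans _ _ (1 * `|diff2 (V t) m h|)); first by rewrite ler_wpM2r.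
  rewrite mul1r /diff2; apply: (le_trans (ler_normB _ _)).
  apply: (le_trans (lerD (ler_normD _ _) (lexx _))); rewrite normrM (ger0_norm (x := 2))//.
  have := (growth (m + h) tT, growth (m - h) tT, growth m tT) => -[[a b] c].
  have := sqnD_le m h; have := sqnD_le m (- h); rewrite sqnN => H1 H2.
  have := ler_wpM2l C0 H1; have := ler_wpM2l C0 H2.
  have : 0 <= C * sqn h by rewrite mulr_ge0// sqn_ge0.
  have aux (D x1 x2 x3 y1 y2 y3 y4 : R) :
    x3 <= D * (1 + y1) -> x2 <= D * (1 + y2) -> x1 <= D * (1 + y3) -> 0 <= D ->
    0 <= D * y4 -> D * y1 <= D * (2 * (y3 + y4)) -> D * y2 <= D * (2 * (y3 + y4)) ->
    x3 + x2 + 2 * x1 <= 6 * D * (1 + y3 + y4) by move=> *; lra.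
  by move=> *; apply: (aux C _ _ _ (sqn (m + h)) (sqn (m - h))).
have Bpos : 0 <= M * expR (B * (T - t)) * sqn h.
  by rewrite mulr_ge0 ?sqn_ge0// mulr_ge0// expR_ge0.
have E1 : 1 <= expR (k * (T - t)).
  by rewrite -expR0 ler_expR mulr_ge0// subr_ge0; case/andP: tT.
have : d * w * w <= d * expR (k * (T - t)) * w ^+ 2.
  rewrite expr2 !mulrA ler_wpM2r//; first lra.
  rewrite ler_wpM2r//; first lra.
  by rewrite ler_peMr// ltW.
have : 6 * C * w <= d * w * w by rewrite ler_wpM2r// ?[d * _]mulrC//; lra.
rewrite /Phi /penalized -/w; lra.
Qed.

Lemma Phi_continuous d (t0 : R) : 0 <= t0 ->
  {within [set z : R * (rV * rV) | t0 <= z.1 <= T],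
    continuous (fun z : R * (rV * rV) => Phi d z.1 z.2.1 z.2.2)}.
Proof.
move=> t00; set K := mkset _.
have KV (phi : R * (rV * rV) -> rV) : continuous phi ->
    {within K, continuous (fun z => V z.1 (phi z))}.
  move=> cphi; apply: (@within_continuous_comp _ _ _ (fun z => (z.1, phi z)) _ _ _ _ _ cV).
    by apply: pair_continuous_map => //; exact: fst_continuous_map.
  by move=> [t z] /= /andP[a ->]; rewrite (le_trans t00 a).
have cm : continuous (fun z : R * (rV * rV) => z.2.1).
  by move=> z; apply: (@continuous_comp _ _ _ snd fst);
    [exact: snd_continuous_map|exact: fst_continuous_map].
have ch : continuous (fun z : R * (rV * rV) => z.2.2).
  by move=> z; apply: (@continuous_comp _ _ _ snd snd); exact: snd_continuous_map.
have cexp (a : R) : continuous (fun z : R * (rV * rV) => expR (a * (T - z.1))).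
  move=> z; apply: (@continuous_comp _ _ _ (fun z : R * (rV * rV) => a * (T - z.1)) expR).
    apply: cvgM; first exact: cvg_cst.
    by apply: cvgB; [exact: cvg_cst|exact: fst_continuous_map].
  exact: continuous_expR.
have csq (phi : R * (rV * rV) -> rV) : continuous phi -> continuous (fun z => sqn (phi z)).
  by move=> cphi z; apply: continuous_comp; [exact: cphi|exact: continuous_sqn].
pose P (z : R * (rV * rV)) := M * expR (B * (T - z.1)) * sqn z.2.2
  + d * expR (k * (T - z.1)) * (1 + sqn z.2.1 + sqn z.2.2) ^+ 2.
have cP : continuous P.
  move=> z; apply: (@cvgD _ R^o).
    apply: (@cvgM R); last exact: csq.
    by apply: (@cvgM R); [exact: cvg_cst|exact: cexp].
  apply: (@cvgM R); first by apply: cvgM; [exact: cvg_cst|exact: cexp].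
  apply: (@continuous_comp _ _ _ (fun z : R * (rV * rV) => 1 + sqn z.2.1 + sqn z.2.2)
    (fun y : R => y ^+ 2)).
    apply: (@cvgD _ R^o); last exact: (csq _ ch).
    by apply: (@cvgD _ R^o); [exact: cvg_cst|exact: (csq _ cm)].
  exact: exprn_continuous.
have V1 := KV (fun z : R * (rV * rV) => z.2.1 + z.2.2) (fun z => cvgD (cm z) (ch z)).
have V3 := KV (fun z : R * (rV * rV) => z.2.1 - z.2.2) (fun z => cvgB (cm z) (ch z)).
have V4 := KV (fun z : R * (rV * rV) => z.2.1) cm.
rewrite (_ : (fun _ => _) = (fun z => S * (V z.1 (z.2.1 + z.2.2) + V z.1 (z.2.1 - z.2.2)
    - 2 * V z.1 z.2.1) - P z)); last first.
  by apply/funext => z; rewrite /Phi /penalized /diff2 /P opprD addrA.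
move=> z; apply: (@cvgB _ R^o); last exact: (continuous_subspaceT cP).
apply: (@cvgM R); first exact: cvg_cst.
apply: (@cvgB _ R^o); first by apply: (@cvgD _ R^o); [exact: V1|exact: V3].
by apply: (@cvgM R); [exact: cvg_cst|exact: V4].
Qed.


Lemma Phi_interior_max_absurd d t m h : 0 < d -> 0 < t < T ->
  (forall m' h', Phi d t m' h' <= Phi d t m h) ->
  (forall t', t <= t' <= T -> Phi d t' m h <= Phi d t m h) -> False.
Proof.
move=> d0 tT maxmh maxt; case/andP: (tT) => tpos tltT.
pose rho := d * expR (k * (T - t)); have rho0 : 0 < rho by rewrite mulr_gt0 ?expR_gt0.
have hessle v := penalized_max_hess (V2 tT) (ltW rho0) maxmh v.
have Hones := hessle (const_mx 1); rewrite !hess_ones sqn_ones in Hones.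
have Hdelta i := hessle (delta_mx 0 i).
have Hlap : S * (\sum_i partial i (partial i (V t)) (m + h)
     + \sum_i partial i (partial i (V t)) (m - h)
     - 2 * \sum_i partial i (partial i (V t)) m) <=
    n.+1%:R * (rho * (14 * (1 + sqn m + sqn h) ^+ 2)).
  rewrite mulr_sumr -big_split/= -sumrB mulr_sumr.
  rewrite (_ : n.+1%:R * _ = \sum_(i < n.+1) rho * (14 * (1 + sqn m + sqn h) ^+ 2)).
    apply: ler_sum => i _; rewrite -!hess_delta; apply: (le_trans (Hdelta i)).
    by rewrite sqn_delta expr1n !mulr1 -natrD.
  by rewrite sumr_const card_ord mulr_natl.
have gc := penalized_max_grad_center (V2 tT) maxmh.
have gs := penalized_max_grad_step (V2 tT) maxmh.
have HG : S * diff2 (G t) m h <= B * (M * expR (B * (T - t))) * sqn h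
    + Ck * rho * (1 + sqn m + sqn h) ^+ 2.
  by apply: hamiltonian => //; exact: ltW.
have dt x : is_derive (0 : R) 1 (fun s => V (t + s * 1) x) (dtime V t x).
  have H : is_derive t 1 (V ^~ x) (dtime V t x).
    by rewrite /dtime derive1E; apply/derivableP; exact: dV.
  rewrite -[dtime V t x]mul1r; apply: (@is_derive_affine R (V ^~ x)).
  by rewrite mul0r addr0.
have dexp (a b : R) : is_derive (0 : R) 1 (fun s => a * expR (b * (T - (t + s * 1))))
    (- (b * (a * expR (b * (T - t))))).
  rewrite -[X in is_derive _ _ _ X]mul1r.
  apply: (@is_derive_affine R (fun s => a * expR (b * (T - s)))).
  by rewrite mul0r addr0; exact: is_derive_expR_affine.
have dPhi : is_derive (0 : R) 1 (fun s => Phi d (t + s * 1) m h)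
    (S * (dtime V t (m + h) + dtime V t (m - h) - 2 * dtime V t m)
     + B * (M * expR (B * (T - t))) * sqn h + k * rho * (1 + sqn m + sqn h) ^+ 2).
  rewrite /Phi /penalized /diff2.
  have := (dt (m + h), dt (m - h), dt m, dexp M B, dexp d k) => -[[[[? ?] ?] ?] ?].
  apply: is_derive_eq; rewrite -/rho.
  move: (dtime V t (m + h)) (dtime V t (m - h)) (dtime V t m) => p q r.
  by rewrite /GRing.scale/=; ring.
(* Maximality against later times controls only the right derivative, and this is the useful side:
   [rho] decreases in time and contributes the positive term that beats all the errors. *)
have Htime : S * (dtime V t (m + h) + dtime V t (m - h) - 2 * dtime V t m)
     + B * (M * expR (B * (T - t))) * sqn h + k * rho * (1 + sqn m + sqn h) ^+ 2 <= 0.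
  apply: (right_max_derive_le0 (e := T - t) _ dPhi); first by rewrite subr_gt0.
  move=> s /andP[s0 sT]; rewrite mul0r addr0; apply: maxt.
  by rewrite mulr1 lerDl s0 -lerBrDl.
have := (pde (m + h) tT, pde (m - h) tT, pde m tT); move=> [[p1 p2] p3].
have W0 : 0 < (1 + sqn m + sqn h) ^+ 2.
  by rewrite exprn_gt0// -addrA ltr_pwDl// addr_ge0// sqn_ge0.
have : rho * (1 + sqn m + sqn h) ^+ 2 <= 0.
  by apply: (maximum_balance p1 p2 p3 _ _ Hones Hlap HG Htime);
    rewrite ?divr_ge0 ?sqr_ge0.
by rewrite leNgt mulr_gt0.
Qed.

Lemma three_point_comparison (t : R) m h : 0 < t < T ->
  S * diff2 (V t) m h <= M * expR (B * (T - t)) * sqn h.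
Proof.
move=> tT; case/andP: (tT) => tpos tltT; rewrite leNgt; apply/negP => Z0.
set Z := S * diff2 (V t) m h - M * expR (B * (T - t)) * sqn h.
have {}Z0 : 0 < Z by rewrite subr_gt0.
pose q := expR (k * (T - t)) * (1 + sqn m + sqn h) ^+ 2.
have q0 : 0 < q.
  by rewrite mulr_gt0 ?expR_gt0// exprn_gt0// -addrA ltr_pwDl// addr_ge0// sqn_ge0.
(* With this [d] the penalty at the offending point is exactly half of the excess [Z], so [Phi] is
   still positive there. *)
pose d := Z / (2 * q); have d0 : 0 < d by rewrite divr_gt0// mulr_gt0.
have pos : 0 < Phi d t m h.
  have E : d * expR (k * (T - t)) * (1 + sqn m + sqn h) ^+ 2 = Z / 2.
    have F (a b : R) : b != 0 -> a / (2 * b) * b = a / 2 by move=> ?; field.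
    rewrite -mulrA -/q /d.
    by rewrite F// gt_eqF.
  rewrite /Phi /penalized -/Z E subr_gt0.
  by rewrite ltr_pdivrMr// mulr_natr mulr2n ltrDl.
have Cd : 0 <= 6 * C / d by apply: divr_ge0; [exact: mulr_ge0|exact: ltW].
(* The search starts at the offending time [t > 0] and not at 0, because the equation is available
   only at positive times. *)
have [|t1 [m1 [h1 [t1T pos1 max1]]]] := global_max_of_nonpositive_far (ltW tltT) Cd
  (Phi_continuous (d := d) (ltW tpos)) _ pos.
  move=> t' m' h' /andP[tt' t'T]; apply: Phi_le0_far => //.
  by rewrite t'T (le_trans (ltW tpos)).
case/andP: t1T => tt1 t1T.
have t1lt : t1 < T.
  rewrite lt_neqAle t1T andbT; apply/negP => /eqP t1E.
  move: pos1; rewrite t1E /Phi /penalized subrr !mulr0 expR0 !mulr1 ltNge => /negP; apply.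
  have := terminal m1 h1 => H.
  rewrite subr_le0; apply: (@le_trans _ _ 0); first by rewrite subr_le0.
  by rewrite mulr_ge0 ?sqr_ge0// ltW.
have t1pos : 0 < t1 by exact: lt_le_trans tt1.
apply: (@Phi_interior_max_absurd d t1 m1 h1 d0); first by rewrite t1pos.
- by move=> m' h'; apply: max1; rewrite tt1 t1T.
- by move=> t' /andP[t1t' t'T]; apply: max1; rewrite (le_trans tt1 t1t').
Qed.

End three_point_comparison.

(** * Lions derivatives at empirical measures *)

Section uniform_measure_nat.
Context (R : realType) (n : nat).

(** A probability space on which empirical measures are realised. Every function on [nat] is
    measurable, so any sequence is an admissible random variable or increment. *)
Definition unif_nat : set nat -> \bar R :=
  mscale (n.+1%:R^-1)%:nng (msum (fun k => @dirac _ nat k R) n.+1).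

HB.instance Definition _ := Measure.on unif_nat.

Lemma unif_natE (A : set nat) :
  unif_nat A = (n.+1%:R^-1 * \sum_(k < n.+1) ((k : nat) \in A)%:R)%:E.
Proof.
rewrite /unif_nat /mscale /msum /= EFinM -sumEFin; congr (_ * _)%E.
Qed.

Lemma unif_nat_setT : unif_nat setT = 1%E.
Proof.
rewrite unif_natE (eq_bigr (fun=> 1)) => [|i _]; last by rewrite in_setT.
by rewrite sumr_const card_ord mulVf// pnatr_eq0.
Qed.

HB.instance Definition _ :=
  Measure_isProbability.Build _ _ _ unif_nat unif_nat_setT.

Lemma ge0_integral_unif_nat (f : nat -> R) : (forall k, 0 <= f k) ->
  (\int[unif_nat]_k (f k)%:E = (n.+1%:R^-1 * \sum_(k < n.+1) f k)%:E)%E.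
Proof.
move=> f0; rewrite ge0_integral_mscale//; last by move=> k _; rewrite lee_fin.
rewrite ge0_integral_measure_sum//; last by move=> k _; rewrite lee_fin.
rewrite EFinM -sumEFin; congr (_ * _)%E.
by apply: eq_bigr => k _; rewrite integral_dirac// diracT mul1e.
Qed.

Lemma Rintegral_unif_nat (f : nat -> R) :
  \int[unif_nat]_k f k = n.+1%:R^-1 * \sum_(k < n.+1) f k.
Proof.
rewrite /Rintegral integralE.
rewrite (eq_integral (fun k => (Num.max (f k) 0)%:E)); last first.
  by move=> k _; rewrite funeposE EFin_max.
rewrite [X in (_ - X)%E](eq_integral (fun k => (Num.max (- f k) 0)%:E)); last first.
  by move=> k _; rewrite funenegE EFin_max.
rewrite !ge0_integral_unif_nat; try by move=> k; rewrite le_max lexx orbT.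
rewrite -EFinB /= -mulrBr -sumrB; congr (_ * _); apply: eq_bigr => k _.
by case: (leP (f k) 0) => H; case: (leP (- f k) 0) => H'; lra.
Qed.

Definition nat_rv (f : nat -> R) : nat -> R := f.

Lemma measurable_nat_rv f : measurable_fun [set: nat] (nat_rv f).
Proof. by []. Qed.

HB.instance Definition _ f :=
  isMeasurableFun.Build _ _ _ _ (nat_rv f) (measurable_nat_rv f).

End uniform_measure_nat.

Section empirical_laws.
Context (R : realType).

Lemma has_law_empP2 (n m : nat) (y : nat -> R) (x : 'rV[R]_n.+1) :
  (forall A : set R, m.+1%:R^-1 * \sum_(k < m.+1) (y k \in A)%:R =
    n.+1%:R^-1 * \sum_(i < n.+1) (x 0 i \in A)%:R :> R) ->
  has_law (unif_nat R m) (nat_rv y) (empP2 x).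
Proof.
move=> H A mA; rewrite [RHS](empiricalE x A) [LHS](unif_natE R m (nat_rv y @^-1` A)).
transitivity ((m.+1%:R^-1 * \sum_(k < m.+1) (y k \in A)%:R)%:E : \bar R).
  by congr (_ * _)%:E; apply: eq_bigr => k _; congr (_%:R); rewrite !inE.
by rewrite H EFinM -sumEFin.
Qed.

Lemma has_law_coords (n : nat) (x : 'rV[R]_n.+1) :
  has_law (unif_nat R n) (nat_rv (fun k => x 0 (inord k))) (empP2 x).
Proof.
apply: has_law_empP2 => A; congr (_ * _); apply: eq_bigr => i _.
by rewrite inord_val.
Qed.

Lemma Lions_same_law (u : P2 R -> R) mu nu g m (y : nat -> R) :
  is_Lions_derivative u mu g -> has_law (unif_nat R m) (nat_rv y) mu ->
  has_law (unif_nat R m) (nat_rv y) nu -> u nu = u mu.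
Proof.
(* The increment Y = 0 joins the two measures. *)
move=> [_ _ H] Xmu Xnu; have [del del0 Hdel] := H _ _ _ (nat_rv y) Xmu 1 ltr01.
have law0 : has_law (unif_nat R m) (nat_rv y \+ nat_rv (fun=> 0)) nu.
  rewrite (_ : _ \+ _ = nat_rv y)//.
  by apply/funext => k; rewrite /nat_rv/= addr0.
have := Hdel (nat_rv (fun=> 0)) nu law0; rewrite !Rintegral_unif_nat.
rewrite !big1 ?mulr0 ?sqrtr0 ?subr0 ?mul1r => [|i _|i _]; last 2 first.
- by rewrite /nat_rv mulr0.
- by rewrite /nat_rv expr0n.
by move=> /(_ (ltW del0)); rewrite normr_le0 subr_eq0 => /eqP.
Qed.

(** The lift is tested at X = the coordinate map and Y = h v, whose L^2 norm is |h| times the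
    normalised norm [q] of [v]. In a coordinate direction this is the classical rule: 1/N times the
    Lions derivative at that atom. *)
Lemma Lions_empirical_derive (n : nat) (u : P2 R -> R) g (x v : 'rV[R]_n.+1) :
  is_Lions_derivative u (empP2 x) g ->
  is_derive x v (fun y => u (empP2 y)) (n.+1%:R^-1 * \sum_i g (x 0 i) * v 0 i).
Proof.
move=> [_ _ H]; apply/is_derive_epsP => e e0.
pose q := Num.sqrt (n.+1%:R^-1 * \sum_i v 0 i ^+ 2).
have q1 : 0 < 1 + q by rewrite ltr_pwDl// sqrtr_ge0.
have [del del0 Hdel] := H _ _ _ (nat_rv (fun k => x 0 (inord k)))
  (has_law_coords x) (e / (1 + q)) (divr_gt0 e0 q1).
exists (del / (1 + q)) => [|h]; first by rewrite divr_gt0.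
rewrite ltr_pdivlMr// => hd.
have lawh : has_law (unif_nat R n) (nat_rv (fun k => x 0 (inord k))
    \+ nat_rv (fun k => h * v 0 (inord k))) (empP2 (x + h *: v)).
  rewrite (_ : _ \+ _ = nat_rv (fun k => (x + h *: v) 0 (inord k))).
    exact: has_law_coords.
  by apply/funext => k; rewrite /nat_rv !mxE.
have := Hdel _ _ lawh.
rewrite !Rintegral_unif_nat. rewrite /= /nat_rv.
have E2 : \sum_(k < n.+1) (h * v 0 (inord k)) ^+ 2 = h ^+ 2 * \sum_i v 0 i ^+ 2.
  by rewrite mulr_sumr; apply: eq_bigr => i _; rewrite inord_val exprMn.
have E1 : \sum_(k < n.+1) g (x 0 (inord k)) * (h * v 0 (inord k)) =
    h * \sum_i g (x 0 i) * v 0 i.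
  by rewrite mulr_sumr; apply: eq_bigr => i _; rewrite inord_val mulrCA.
rewrite E1 E2 [_^-1 * (h ^+ 2 * _)]mulrCA sqrtrM ?sqr_ge0// sqrtr_sqr -/q.
have hq : `|h| * q <= `|h| * (1 + q) by rewrite ler_wpM2l// lerDr.
move=> /(_ (ltW (le_lt_trans hq hd))).
rewrite [_^-1 * (h * _)]mulrCA => /le_trans; apply.
by rewrite mulrAC ler_pdivrMr// -[leRHS]mulrA; apply: ler_wpM2l; first exact: ltW.
Qed.

(** The size is spelled as a successor because [empP2] expects one; each coordinate of [x] appears
    [k.+1] times. *)
Definition replicate (n k : nat) (x : 'rV[R]_n.+1) : 'rV[R]_((n.+1 * k.+1).-1.+1) :=
  \row_j x 0 (inord (j %% n.+1)).

Lemma replicate_size (n k : nat) : (n.+1 * k.+1).-1.+1 = (k.+1 * n.+1)%N.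
Proof. by rewrite mulnC. Qed.

Lemma sum_replicate (n k : nat) (F : 'I_n.+1 -> R) :
  \sum_(j < (n.+1 * k.+1).-1.+1) F (inord (j %% n.+1)) = k.+1%:R * \sum_i F i.
Proof.
rewrite -(big_mkord xpredT (fun j => F (inord (j %% n.+1)))) replicate_size.
elim: k.+1 => [|m IH]; first by rewrite mul0n big_nil mul0r.
rewrite (big_cat_nat (n := m * n.+1)) ?leq_mul2r ?leqnSn ?orbT//=.
rewrite IH mulSn addnC -natr1 mulrDl mul1r; congr (_ + _).
rewrite -{1}[(m * n.+1)%N]add0n big_addn addKn big_mkord; apply: eq_bigr => i _.
by rewrite addnC modnMDl modn_small// inord_val.
Qed.

(** Repeating atoms does not change the measure. The number of atoms can thus grow at a fixed
    measure, which is what gives strength to a condition imposed for all N. *)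
Lemma Lions_replicate (n k : nat) (u : P2 R -> R) g (x : 'rV[R]_n.+1) :
  is_Lions_derivative u (empP2 x) g -> u (empP2 (replicate k x)) = u (empP2 x).
Proof.
move=> ug; apply: (Lions_same_law (y := fun j => x 0 (inord (j %% n.+1))) ug).
  apply: (has_law_empP2 (m := (n.+1 * k.+1).-1)) => A.
  rewrite (sum_replicate k (fun i => (x 0 i \in A)%:R)) replicate_size natrM.
  by rewrite invfM mulrACA mulVf ?mul1r// pnatr_eq0.
apply: has_law_empP2 => A; congr (_ * _); apply: eq_bigr => j _.
by rewrite mxE.
Qed.

End empirical_laws.

(** * Lipschitz and second-order estimates along empirical measures *)

Section coefficient_estimates.
Context (R : realType) (n : nat).
Local Notation rV := 'rV[R]_n.+1.
Implicit Types (x y h : rV).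

(** Transport cost of matching atoms by index: an upper bound for the first Wasserstein distance
    between the empirical measures of [x] and [x + h]. *)
Definition avg1 h : R := n.+1%:R^-1 * \sum_i `|h 0 i|.

Lemma avg1_ge0 h : 0 <= avg1 h.
Proof. by rewrite mulr_ge0// ?invr_ge0// sumr_ge0. Qed.

Lemma avg1Z (s : R) h : avg1 (s *: h) = `|s| * avg1 h.
Proof.
rewrite /avg1 mulrCA; congr (_ * _); rewrite mulr_sumr; apply: eq_bigr => i _.
by rewrite mxE normrM.
Qed.

Lemma avg1_sqr_le h : avg1 h ^+ 2 <= n.+1%:R^-1 * sqn h.
Proof.
pose a : rV := \row_i `|h 0 i|.
have Ea : sqn a = sqn h.
  by apply: eq_bigr => i _; rewrite mxE real_normK ?num_real.
have Ed : dot a (const_mx 1) = \sum_i `|h 0 i|.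
  by apply: eq_bigr => i _; rewrite !mxE mulr1.
have := dot_sqr_le a (const_mx 1); rewrite sqn_ones Ea Ed => H.
rewrite /avg1 exprMn expr2 -mulrA ler_wpM2l ?invr_ge0//.
by rewrite ler_pdivrMl// mulrC.
Qed.

Lemma is_derive_derive1 (g : R -> R) (s : R) :
  derivable g s 1 -> is_derive s 1 g (g^`() s).
Proof. by move=> /derivableP; rewrite derive1E. Qed.

Lemma MVT_bound (g : R -> R) (K a b : R) :
  (forall s, derivable g s 1 /\ `|g^`() s| <= K) -> `|g b - g a| <= K * `|b - a|.
Proof.
move=> H; have [|s _ ->] := @MVT_R R g (g^`()) a b.
  by move=> s; apply: is_derive_derive1; case: (H s).
by rewrite normrM ler_wpM2r//; case: (H (a + s * (b - a))).
Qed.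

Lemma Lions_empirical_MVT (u : P2 R -> R) (g : P2 R -> R -> R) x h :
  (forall y : rV, is_Lions_derivative u (empP2 y) (g (empP2 y))) ->
  exists2 s : R, 0 < s < 1 & u (empP2 (x + h)) - u (empP2 x) =
    n.+1%:R^-1 * \sum_i g (empP2 (x + s *: h)) ((x + s *: h) 0 i) * h 0 i.
Proof.
move=> ug.
have [|s s01 E] := @MVT_line R _ (fun y : rV => u (empP2 y))
  (fun s => n.+1%:R^-1 * \sum_i g (empP2 (x + s *: h)) ((x + s *: h) 0 i) * h 0 i) x h.
  by move=> s _; apply: Lions_empirical_derive.
by exists s.
Qed.

Lemma weighted_avg_le (K : R) (a : 'I_n.+1 -> R) h :
  (forall i, `|a i| <= K) -> `|n.+1%:R^-1 * \sum_i a i * h 0 i| <= K * avg1 h.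
Proof.
move=> aK; rewrite normrM ger0_norm ?invr_ge0// mulrCA ler_wpM2l ?invr_ge0//.
rewrite (le_trans (ler_norm_sum _ _ _))// mulr_sumr ler_sum// => i _.
by rewrite normrM ler_wpM2r.
Qed.

Lemma Lions_empirical_lipschitz (u : P2 R -> R) (g : P2 R -> R -> R) (K : R) x y :
  (forall z : rV, is_Lions_derivative u (empP2 z) (g (empP2 z))) ->
  (forall mu z, `|g mu z| <= K) ->
  `|u (empP2 y) - u (empP2 x)| <= K * avg1 (y - x).
Proof.
move=> ug gK; have [s _] := Lions_empirical_MVT x (y - x) ug.
by rewrite subrKC => ->; apply: weighted_avg_le => i.
Qed.

(** A bounded Lions derivative gives a Lipschitz bound in mean displacement, not only in quadratic
    mean. One atom sent very far among many others is then a small change of the measure, which the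
    remote-atom test exploits. *)
Lemma derivatives_bounded_lipschitz (T K : R) (f : coef R) fmu :
  derivatives_bounded T K f fmu ->
  forall (t th th' z z' : R) x y, 0 <= t <= T ->
  `|f t th' z' (empP2 y) - f t th z (empP2 x)| <=
  K * (`|th' - th| + `|z' - z| + avg1 (y - x)).
Proof.
move=> H t th th' z z' x y tT.
have H1 : `|f t th' z' (empP2 y) - f t th z' (empP2 y)| <= K * `|th' - th|.
  apply: (@MVT_bound (fun th => f t th z' (empP2 y))) => s.
  by have [? _ _ [? _] _] := H t s z' (empP2 y) tT.
have H2 : `|f t th z' (empP2 y) - f t th z (empP2 y)| <= K * `|z' - z|.
  apply: (@MVT_bound (fun z => f t th z (empP2 y))) => s.
  by have [_ ? _ [_ ?] _] := H t th s (empP2 y) tT.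
have H3 : `|f t th z (empP2 y) - f t th z (empP2 x)| <= K * avg1 (y - x).
  apply: (@Lions_empirical_lipschitz (f t th z) (fmu t th z)) => [w|mu w].
    by have [_ _ ? _ _] := H t th z (empP2 w) tT.
  by have [_ _ _ _ ?] := H t th z mu tT.
rewrite !mulrDr; apply: le_trans (lerD (lerD H1 H2) H3).
rewrite -[_ - _](subrKA (f t th z' (empP2 y))) (le_trans (ler_normD _ _))//.
rewrite -addrA lerD// -[_ - _](subrKA (f t th z (empP2 y))).
exact: ler_normD.
Qed.

(** The lift is not expanded to second order: the mean value theorem in [z] and in the measure
    leaves first derivatives at intermediate points, and these are Lipschitz. The factor 3 collects
    the cross terms. *)
Lemma coefficient_first_order (T K : R) (f : coef R) (fmu : mcoef R)
    (fmumu : R -> R -> R -> P2 R -> R -> R -> R) :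
  derivatives_bounded T K f fmu ->
  derivatives_bounded T K (Dx f) (at_y (@Dx R) fmu) ->
  (forall y : R, derivatives_bounded T K (slice fmu y)
     (fun t th z mu => fmumu t th z mu y)) ->
  (forall (t th x : R) (mu : P2 R) (y : R), 0 <= t <= T ->
     derivable (fmu t th x mu) y 1 /\ `|(fmu t th x mu)^`() y| <= K) ->
  forall (t th z a : R) x h, 0 <= t <= T ->
  `|f t th (z + a) (empP2 (x + h)) - f t th z (empP2 x)
    - (Dx f t th z (empP2 x) * a
       + n.+1%:R^-1 * \sum_i fmu t th z (empP2 x) (x 0 i) * h 0 i)|
  <= 3 * K * (a ^+ 2 + n.+1%:R^-1 * sqn h).
Proof.
move=> Hf Hfx Hfmu Hfy t th z a x h tT.
have K0 : 0 <= K by have [_ _ _ [+ _] _] := Hf t th z (empP2 x) tT; exact: le_trans.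
have [s /andP[s0 s1] Es] := @MVT_R R (fun z => f t th z (empP2 (x + h)))
  (fun z => Dx f t th z (empP2 (x + h))) z (z + a) (fun w =>
   is_derive_derive1 (let: And5 _ d _ _ _ := Hf t th w (empP2 (x + h)) tT in d)).
have [r /andP[r0 r1] Er] := @Lions_empirical_MVT (f t th z) (fmu t th z) x h
  (fun w => let: And5 _ _ d _ _ := Hf t th z (empP2 w) tT in d).
have A1 : `|Dx f t th (z + s * a) (empP2 (x + h)) - Dx f t th z (empP2 x)|
    <= K * (`|a| + avg1 h).
  have := derivatives_bounded_lipschitz Hfx th th z (z + s * a) x (x + h) tT.
  rewrite subrr normr0 add0r [z + _]addrC addrK [x + h]addrC addrK => /le_trans; apply.
  by rewrite ler_wpM2l// lerD2r normrM (gtr0_norm s0) ler_piMl// ltW.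
(* [fmu] changes through its last argument, the moved atom, and through the measure; [B1] and [B2]
   treat the two effects. *)
have A2 i : `|fmu t th z (empP2 (x + r *: h)) ((x + r *: h) 0 i)
     - fmu t th z (empP2 x) (x 0 i)| <= K * (avg1 h + `|h 0 i|).
  have B1 : `|fmu t th z (empP2 (x + r *: h)) ((x + r *: h) 0 i)
     - fmu t th z (empP2 (x + r *: h)) (x 0 i)| <= K * `|h 0 i|.
    have := @MVT_bound (fmu t th z (empP2 (x + r *: h))) K (x 0 i) ((x + r *: h) 0 i).
    move=> /(_ (fun w => Hfy t th z _ w tT))/le_trans; apply.
    rewrite ler_wpM2l// !mxE addrAC subrr add0r normrM (gtr0_norm r0).
    by rewrite ler_piMl// ltW.
  have B2 : `|fmu t th z (empP2 (x + r *: h)) (x 0 i)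
     - fmu t th z (empP2 x) (x 0 i)| <= K * avg1 h.
    have := derivatives_bounded_lipschitz (Hfmu (x 0 i)) th th z z x (x + r *: h) tT.
    rewrite !subrr !normr0 !add0r addrAC subrr add0r avg1Z (gtr0_norm r0).
    move=> /le_trans; apply; rewrite ler_wpM2l// ler_piMl ?avg1_ge0//.
    exact: ltW.
  rewrite mulrDr [leRHS]addrC -[_ - _](subrKA (fmu t th z (empP2 (x + r *: h)) (x 0 i))).
  by rewrite (le_trans (ler_normD _ _))// lerD.
have E : f t th (z + a) (empP2 (x + h)) - f t th z (empP2 x)
    - (Dx f t th z (empP2 x) * a
       + n.+1%:R^-1 * \sum_i fmu t th z (empP2 x) (x 0 i) * h 0 i) =
   (Dx f t th (z + s * a) (empP2 (x + h)) - Dx f t th z (empP2 x)) * a +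
   n.+1%:R^-1 * \sum_i (fmu t th z (empP2 (x + r *: h)) ((x + r *: h) 0 i)
     - fmu t th z (empP2 x) (x 0 i)) * h 0 i.
  have -> : f t th (z + a) (empP2 (x + h)) - f t th z (empP2 x) =
      (f t th (z + a) (empP2 (x + h)) - f t th z (empP2 (x + h)))
      + (f t th z (empP2 (x + h)) - f t th z (empP2 x)) by rewrite addrA subrK.
  rewrite Er Es [z + a]addrC addrK opprD addrACA -mulrBl -mulrBr -sumrB.
  by congr (_ + _ * _); apply: eq_bigr => i _; rewrite mulrBl.
rewrite {}E; apply: (le_trans (ler_normD _ _)).
have C1 : `|(Dx f t th (z + s * a) (empP2 (x + h)) - Dx f t th z (empP2 x)) * a|
    <= K * (`|a| + avg1 h) * `|a| by rewrite normrM ler_wpM2r.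
have C2 : `|n.+1%:R^-1 * \sum_i (fmu t th z (empP2 (x + r *: h)) ((x + r *: h) 0 i)
     - fmu t th z (empP2 x) (x 0 i)) * h 0 i| <=
    K * (avg1 h ^+ 2 + n.+1%:R^-1 * sqn h).
  rewrite normrM ger0_norm ?invr_ge0//.
  apply: (@le_trans _ _ (n.+1%:R^-1 * \sum_i K * (avg1 h + `|h 0 i|) * `|h 0 i|)).
    rewrite ler_wpM2l ?invr_ge0// (le_trans (ler_norm_sum _ _ _))//.
    by apply: ler_sum => i _; rewrite normrM ler_wpM2r.
  rewrite (eq_bigr (fun i => K * avg1 h * `|h 0 i| + K * h 0 i ^+ 2)) => [|i _].
    rewrite big_split/= -!mulr_sumr le_eqVlt; apply/orP; left; apply/eqP.
    have aux (d b c k : R) : d * (k * (d * b) * b + k * c) = k * ((d * b) ^+ 2 + d * c).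
      by ring.
    exact: aux.
  by rewrite -[h 0 i ^+ 2]real_normK ?num_real//; ring.
have := avg1_sqr_le h; have := avg1_ge0 h; move: C1 C2.
have aux (x1 x2 k b c S : R) : 0 <= k -> x1 <= k * (b + c) * b ->
    x2 <= k * (c ^+ 2 + S) -> c ^+ 2 <= S ->
    x1 + x2 <= 3 * k * (b ^+ 2 + S).
  move=> k0 H1 H2 H3; have H4 : (b + c) * b + (c ^+ 2 + S) <= 3 * (b ^+ 2 + S).
    by have := sqr_ge0 (b - c); have := sqr_ge0 b; nra.
  have := ler_wpM2l k0 H4; lra.
move=> C1 C2 _ H3; have := aux _ _ _ _ _ _ K0 C1 C2 H3.
by rewrite real_normK ?num_real.
Qed.

End coefficient_estimates.

(** * Affine dependence of the drift when C11 > 0 *)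

Section rigidity.
Context (R : realType) (T K C11 C10 Gamma1 Gamma2 lambda0 : R).
Variables (f : coef R) (fmu : mcoef R).

Lemma Gbound_ge n (i : 'I_n.+1) (x : 'rV[R]_n.+1) (Gamma M : R) :
  0 <= C11 -> 0 <= C10 -> 0 < Gamma -> 0 <= M ->
  M ^+ 2 <= n.+1%:R^-1 * sqn x ->
  Gamma * C11 / n.+1%:R * M <= Gbound C11 C10 i x Gamma.
Proof.
move=> c11 c10 G0 M0 H; rewrite /Gbound -[leLHS]addr0 lerD//; last first.
  by rewrite divr_ge0// mulr_ge0// ltW.
apply: ler_wpM2l; first by rewrite divr_ge0// mulr_ge0// ltW.
rewrite -(ger0_norm M0) -sqrtr_sqr ler_wsqrtr// (le_trans H)//.
by rewrite lerDr addr_ge0// sqr_ge0.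
Qed.

Lemma Gbound_ge0 n (i : 'I_n.+1) (x : 'rV[R]_n.+1) (Gamma : R) :
  0 <= C11 -> 0 <= C10 -> 0 < Gamma -> 0 <= Gbound C11 C10 i x Gamma.
Proof.
move=> c11 c10 G0; have := @Gbound_ge n i x Gamma 0 c11 c10 G0 (lexx _).
by rewrite expr0n mulr0 /= mulr_ge0 ?invr_ge0 ?sqn_ge0//; apply.
Qed.

Hypothesis theta_convex : forall n (t th : R) (x p : 'rV[R]_n.+1), 0 <= t <= T ->
  Aset C11 C10 Gamma1 Gamma2 (x, p) ->
  0 <= lambda0 + \sum_i Dtheta (Dtheta f) t th (x 0 i) (empP2 x) * p 0 i.
Hypothesis C11_gt0 : 0 < C11.
Hypothesis C10_ge0 : 0 <= C10.
Hypothesis Gamma1_gt0 : 0 < Gamma1.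
Hypothesis Gamma2_gt0 : 0 < Gamma2.

(* Testing the convexity condition with p supported on the atoms equal to z. *)
Lemma Dtheta2_le n (t th z M : R) (x : 'rV[R]_n.+1) (J : pred 'I_n.+1) (k : nat) :
  0 <= t <= T -> (forall j, J j -> x 0 j = z) -> (k <= #|J|)%N ->
  0 <= M -> M ^+ 2 <= n.+1%:R^-1 * sqn x ->
  `|Dtheta (Dtheta f) t th z (empP2 x)| *
    (Num.min Gamma1 Gamma2 * C11 / n.+1%:R * M) * k%:R <= lambda0.
Proof.
move=> tT Jz kJ M0 Mx; set D := Dtheta (Dtheta f) t th z (empP2 x).
set g := _ / _ * M.
have mG : 0 < Num.min Gamma1 Gamma2 by rewrite lt_min Gamma1_gt0.
have g0 : 0 <= g by rewrite mulr_ge0// divr_ge0// mulr_ge0// ltW.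
have gG j Gamma : Num.min Gamma1 Gamma2 <= Gamma -> g <= Gbound C11 C10 j x Gamma.
  move=> HG; apply: (le_trans _ (@Gbound_ge n j x Gamma M (ltW C11_gt0) C10_ge0 _ M0 Mx)).
    by rewrite ler_wpM2r// ler_wpM2r ?invr_ge0// ler_wpM2r// ltW.
  exact: lt_le_trans mG HG.
have g1 j : g <= Gbound C11 C10 j x Gamma1 by apply: gG; rewrite ge_min lexx.
have g2 j : g <= Gbound C11 C10 j x Gamma2 by apply: gG; rewrite ge_min lexx orbT.
(* On [J] the momentum sits at the end of its admissible interval whose sign is opposite to that of
   [D], so each term of the sum is at most -|D| g. *)
pose p : 'rV[R]_n.+1 := \row_j
  if J j then
    if 0 <= D then - Gbound C11 C10 j x Gamma1 else Gbound C11 C10 j x Gamma2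
  else 0.
have Ap : Aset C11 C10 Gamma1 Gamma2 (x, p).
  move=> j /=; rewrite mxE; have := (le_trans g0 (g1 j), le_trans g0 (g2 j)) => -[a b].
  by case: ifP => _; [case: ifP => _|]; apply/andP; split; lra.
have := theta_convex th tT Ap.
have : \sum_i Dtheta (Dtheta f) t th (x 0 i) (empP2 x) * p 0 i <=
    \sum_(j | J j) (- (`|D| * g)).
  rewrite [leRHS]big_mkcond; apply: ler_sum => j _; rewrite mxE.
  case: ifP => [/Jz ->|_]; last by rewrite mulr0.
  rewrite -/D; have := g1 j; have := g2 j.
  case: (leP 0 D) => D0 Hg2 Hg1.
    by rewrite ger0_norm// mulrN lerN2 ler_wpM2l.
  by rewrite ltr0_norm// mulNr opprK ler_wnM2l// ltW.
rewrite sumr_const -mulr_natr.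
have : `|D| * g * k%:R <= `|D| * g * #|J|%:R.
  by apply: ler_wpM2l; [exact: mulr_ge0|rewrite ler_nat].
lra.
Qed.

(** Exactly [k.+1] indices repeat coordinate [i]; [ord0], the atom about to be moved away, may be
    one of them. *)
Lemma card_replicate_class n k (i : 'I_n.+1) :
  (k <= #|[pred j : 'I_(n.+1 * k.+1).-1.+1 |
      (j != ord0) && (inord (j %% n.+1) == i :> 'I_n.+1)]|)%N.
Proof.
pose P : pred 'I_(n.+1 * k.+1).-1.+1 := fun j => inord (j %% n.+1) == i :> 'I_n.+1.
have H : #|P| = k.+1.
  apply/eqP; rewrite -(eqr_nat R) -sum1_card natr_sum big_mkcond/=.
  have S : \sum_(l < n.+1) (l == i)%:R = 1 :> R.
    by rewrite (bigD1 i)//= eqxx big1 ?addr0// => l /negbTE ->.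
  have := @sum_replicate R n k (fun l => (l == i)%:R); rewrite S mulr1 => <-.
  by apply/eqP; apply: eq_bigr => j _; rewrite unfold_in; case: (_ == _).
have := cardD1 ord0 P; rewrite H => E.
have -> : #|[pred j : 'I_(n.+1 * k.+1).-1.+1 | (j != ord0) && P j]| = #|[predD1 P & ord0]|.
  by apply: eq_card => j; rewrite !inE.
move: (#|_|) E => c; case: (ord0 \in P); first by rewrite add1n => -[->].
by rewrite add0n => <-.
Qed.

Hypothesis Df_bounded : derivatives_bounded T K (Dtheta f) (at_y (@Dtheta R) fmu).

(* Moving one of N = M^4 atoms to distance M^3 changes the measure by O(1/M) in the
   first Wasserstein distance but gives it a second moment M^2, so that the test
   above bounds the second theta-derivative by O(1/M). *)
Lemma Dtheta_constant n (t th : R) (x : 'rV[R]_n.+1) (i : 'I_n.+1) : 0 <= t <= T ->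
  Dtheta f t th (x 0 i) (empP2 x) = Dtheta f t 0 (x 0 i) (empP2 x).
Proof.
move=> tT; set a := Dtheta f t th _ _; set b := Dtheta f t 0 _ _.
pose G := Num.min Gamma1 Gamma2.
have G0 : 0 < G by rewrite lt_min Gamma1_gt0.
have K0 : 0 <= K.
  by have [_ _ _ [+ _] _] := Df_bounded th (x 0 i) (empP2 x) tT; exact: le_trans.
pose B := 2 * K * (1 + `|x 0 0|) + 2 * n.+1%:R * lambda0 / (G * C11) * `|th|.
suff H (m : nat) : `|a - b| * m.+2%:R <= B.
  apply/eqP; rewrite -subr_eq0 -normr_eq0; apply/negPn/negP => ab.
  have ab0 : 0 < `|a - b| by rewrite lt_neqAle eq_sym ab normr_ge0.
  have := H (Num.truncn (B / `|a - b|)); rewrite leNgt => /negP; apply.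
  rewrite mulrC -ltr_pdivrMr//.
  have := truncnS_gt (B / `|a - b|) => /lt_le_trans; apply.
  by rewrite ler_nat.
(* [k] makes the total number of atoms (n+1)(k+1) equal to M^4, which is divisible by n+1 since [M]
   is; [m.+2] in place of [m.+1] ensures [k >= 1]. *)
pose M := (n.+1 * m.+2)%N.
pose k := (n.+1 ^ 3 * m.+2 ^ 4).-1.
have kE : k.+1 = (n.+1 ^ 3 * m.+2 ^ 4)%N by rewrite prednK// muln_gt0 !expn_gt0.
have NE : (n.+1 * k.+1).-1.+1 = (M ^ 4)%N.
  by rewrite kE mulnA -expnS -expnMn prednK// expn_gt0.
pose Y := M%:R ^+ 3 - x 0 0.
pose z : 'rV[R]_((n.+1 * k.+1).-1.+1) := replicate k x + Y *: delta_mx 0 ord0.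
have M1 : 1 <= M%:R :> R by rewrite ler1n muln_gt0.
have M0 : 0 < M%:R :> R by exact: lt_le_trans M1.
have z0 : z 0 ord0 = M%:R ^+ 3.
  rewrite !mxE eqxx mulr1 mod0n (_ : inord 0 = 0) ?subrKC//.
  by apply/val_inj; rewrite /= inordK.
have zM : M%:R ^+ 2 <= ((n.+1 * k.+1).-1.+1)%:R^-1 * sqn z.
  rewrite NE natrX ler_pdivlMl ?exprn_gt0// -exprD.
  by have := sqr_coord_le_sqn z ord0; rewrite z0 -exprM.
pose J : pred 'I_(n.+1 * k.+1).-1.+1 := [pred j | (j != ord0) && (inord (j %% n.+1) == i)].
have Jz j : J j -> z 0 j = x 0 i.
  move=> /andP[j0 /eqP ji]; rewrite !mxE ji (negbTE j0) andbF mulr0 addr0//.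
have kJ : (k <= #|J|)%N by exact: card_replicate_class.
have k2 : 2 <= k.+1%:R :> R.
  have h1 : (2 <= m.+2 ^ 4)%N by rewrite (@leq_trans (m.+2 ^ 1)%N)// leq_pexp2l.
  have h2 : (m.+2 ^ 4 <= n.+1 ^ 3 * m.+2 ^ 4)%N by rewrite leq_pmull// expn_gt0.
  by rewrite ler_nat kE (leq_trans h1 h2).
have k0 : 0 < k%:R :> R by rewrite -natr1 in k2; lra.
have NM : n.+1%:R * k.+1%:R = M%:R ^+ 4 :> R.
  by rewrite -natrM -natrX -NE prednK// muln_gt0.
(* At least k >= M^4 / (2 (n+1)) atoms remain at [x 0 i], each with a momentum of order M / M^4; the
   test has total strength of order M, whence a bound of order 1/M. *)
have D_le s : `|Dtheta (Dtheta f) t s (x 0 i) (empP2 z)|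
    <= 2 * n.+1%:R * lambda0 / (G * C11) / M%:R.
  have := Dtheta2_le s tT Jz kJ (ltW M0) zM; rewrite NE natrX -/G.
  have := normr_ge0 (Dtheta (Dtheta f) t s (x 0 i) (empP2 z)).
  move: (`|Dtheta _ _ _ _ _|) => D D0 H.
  have GC0 : 0 < G * C11 by exact: mulr_gt0.
  rewrite !ler_pdivlMr// -(ler_pM2r k0).
  have E : D * (G * C11 / M%:R ^+ 4 * M%:R) * k%:R * M%:R ^+ 4
     = D * M%:R * (G * C11) * k%:R by field; rewrite gt_eqF.
  rewrite -E; apply: (le_trans (ler_wpM2r _ H)); first by rewrite exprn_ge0// ltW.
  rewrite -NM.
  have L0 : 0 <= lambda0.
    by apply: le_trans H; rewrite !mulr_ge0 ?invr_ge0 ?exprn_ge0// ltW.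
  have k1 : k.+1%:R <= 2 * k%:R :> R by rewrite -natr1; rewrite -natr1 in k2; lra.
  have nk : n.+1%:R * k.+1%:R <= n.+1%:R * (2 * k%:R) :> R by rewrite ler_wpM2l.
  by apply: (le_trans (ler_wpM2l L0 nk)); rewrite le_eqVlt; apply/orP; left; apply/eqP; ring.
have Dth : `|Dtheta f t th (x 0 i) (empP2 z) - Dtheta f t 0 (x 0 i) (empP2 z)| <=
    2 * n.+1%:R * lambda0 / (G * C11) / M%:R * `|th|.
  have := @MVT_bound R (fun s => Dtheta f t s (x 0 i) (empP2 z))
    (2 * n.+1%:R * lambda0 / (G * C11) / M%:R) 0 th; rewrite subr0; apply => s.
  split; last exact: D_le.
  by have [? _ _ _ _] := Df_bounded s (x 0 i) (empP2 z) tT.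
have Dz s : `|Dtheta f t s (x 0 i) (empP2 z) - Dtheta f t s (x 0 i) (empP2 x)| <=
    K * (1 + `|x 0 0|) / M%:R.
  have [_ _ Lx _ _] := Df_bounded s (x 0 i) (empP2 x) tT.
  rewrite -(Lions_replicate k Lx).
  have := derivatives_bounded_lipschitz Df_bounded s s (x 0 i) (x 0 i)
    (replicate k x) z tT; rewrite !subrr normr0 !add0r => /le_trans; apply.
  rewrite -mulrA ler_wpM2l// /z addrAC subrr add0r avg1Z /avg1 (bigD1 ord0)//= big1.
    rewrite addr0 mxE eqxx normr1 mulr1 NE natrX ler_pdivrMr ?exprn_gt0//.
    have -> : (1 + `|x 0 0|) / M%:R * M%:R ^+ 4 = (1 + `|x 0 0|) * M%:R ^+ 3 :> R.
      by field; rewrite gt_eqF.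
    have M3 : 1 <= M%:R ^+ 3 :> R by rewrite exprn_ege1.
    apply: (le_trans (ler_normB _ _)); rewrite ger0_norm ?exprn_ge0 ?(ltW M0)//.
    by have := ler_wpM2l (normr_ge0 (x 0 0)) M3; lra.
  by move=> j j0; rewrite mxE (negbTE j0) andbF normr0.
(* Three legs: from the measure of [x] to that of [z], there from [th] to 0, and back. Each costs
   O(1/M). *)
have ab : `|a - b| * M%:R <= B.
  have -> : B = (K * (1 + `|x 0 0|) / M%:R + 2 * n.+1%:R * lambda0 / (G * C11) / M%:R * `|th|
      + K * (1 + `|x 0 0|) / M%:R) * M%:R.
    rewrite /B -[RHS]mulrC !mulrDr; move: (2 * n.+1%:R * lambda0 / (G * C11)) => c.
    by field; rewrite gt_eqF.
  rewrite ler_wpM2r ?(ltW M0)//.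
  have -> : a - b = - (Dtheta f t th (x 0 i) (empP2 z) - a)
     + (Dtheta f t th (x 0 i) (empP2 z) - Dtheta f t 0 (x 0 i) (empP2 z))
     + (Dtheta f t 0 (x 0 i) (empP2 z) - b) by ring.
  rewrite (le_trans (ler_normD _ _))// lerD ?Dz// (le_trans (ler_normD _ _))//.
  by rewrite lerD ?Dth// normrN Dz.
by apply: le_trans ab; rewrite ler_wpM2l// ler_nat /M leq_pmull.
Qed.

End rigidity.

(** * The Hamiltonian *)

Lemma convex_midpoint (R : realType) (E : lmodType R) (F : E -> R) m h :
  convex_function (setT : set E) F -> 2 * F m <= F (m + h) + F (m - h).
Proof.
move=> cF.
have h01 : (0 <= (2^-1 : R) <= 1)%R by rewrite invr_ge0 ler0n invf_le1// ler1n.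
have := cF (Itv01 (proj1 (andP h01)) (proj2 (andP h01))) (m + h) (m - h).
rewrite !in_setT => /(_ isT isT); rewrite convRE /conv/=.
have -> : unstable.onem (2^-1 : R) = 2^-1 by rewrite /unstable.onem; lra.
have -> : 2^-1 *: (m + h) + 2^-1 *: (m - h) = m.
  by rewrite -scalerDr addrACA subrr addr0 scalerDr -scalerDl (_ : _ + _ = 1) ?scale1r//; lra.
by rewrite -mulrDr ler_pdivlMl.
Qed.

Lemma inf_of_min (R : realType) (E : set R) m : E m -> lbound E m -> inf E = m.
Proof.
move=> Em lbm; apply/eqP; rewrite eq_le; apply/andP; split.
  by apply: ge_inf => //; exists m.
by apply: lb_le_inf => //; exists m.
Qed.

Section hamiltonian.
Context (R : realType) (n : nat).
Local Notation rV := 'rV[R]_n.+1.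
Variables (T K lambda : R) (f : coef R) (fmu : mcoef R) (L : R -> R).
Hypothesis f_bounded : derivatives_bounded T K f fmu.
Hypothesis lambda_gt0 : 0 < lambda.

Definition running_cost (t : R) (x p : rV) (th : R) : R :=
  lambda / 2 * th ^+ 2 + \sum_i f t th (x 0 i) (empP2 x) * p 0 i
  + n.+1%:R^-1 * \sum_i L (x 0 i).

Local Notation H := (@Htilde R f L lambda n).

Lemma K_ge0 (t : R) : 0 <= t <= T -> 0 <= K.
Proof.
by move=> tT; have [_ _ _ [+ _] _] := f_bounded 0 0 (diracP2 0) tT; exact: le_trans.
Qed.

Lemma drift_theta_lipschitz (t th : R) (x p : rV) : 0 <= t <= T ->
  `|\sum_i f t th (x 0 i) (empP2 x) * p 0 i - \sum_i f t 0 (x 0 i) (empP2 x) * p 0 i|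
  <= K * `|th| * \sum_i `|p 0 i|.
Proof.
move=> tT; rewrite -sumrB (le_trans (ler_norm_sum _ _ _))// mulr_sumr.
apply: ler_sum => i _; rewrite -mulrBl normrM ler_wpM2r//.
have := derivatives_bounded_lipschitz f_bounded 0 th (x 0 i) (x 0 i) x x tT.
have avg0 : avg1 (0 : rV) = 0 by rewrite -(scale0r 0) avg1Z normr0 mul0r.
by rewrite !subrr avg0 normr0 subr0 !addr0.
Qed.

Lemma running_cost_ge (t th : R) (x p : rV) : 0 <= t <= T ->
  running_cost t x p 0 + lambda / 2 * th ^+ 2 - K * `|th| * \sum_i `|p 0 i|
  <= running_cost t x p th.
Proof.
move=> tT; have := drift_theta_lipschitz th x p tT.
rewrite /running_cost expr0n/= mulr0 add0r ler_norml => /andP[H1 _].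
have aux (a b c d e : R) : - e <= b - a -> a + c + d - e <= d + b + c by move=> *; lra.
exact: aux.
Qed.

(** Completing the square. Without a lower bound [inf] would be a default value and [Htilde] would
    not be the infimum of the running costs. *)
Lemma running_cost_has_lbound (t : R) (x p : rV) : 0 <= t <= T ->
  has_lbound [set running_cost t x p th | th in [set: R]].
Proof.
move=> tT; set Q := \sum_i `|p 0 i|.
exists (running_cost t x p 0 - (K * Q) ^+ 2 / (2 * lambda)) => _ [th _ <-].
apply: le_trans (running_cost_ge th x p tT); rewrite -/Q.
have aux (a b c e : R) : 0 <= c - b + e -> a - e <= a + c - b by move=> *; lra.
apply: aux.
have : 0 <= lambda / 2 * (`|th| - K * Q / lambda) ^+ 2.
  by rewrite mulr_ge0 ?sqr_ge0// divr_ge0// ltW.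
rewrite -[th ^+ 2]real_normK ?num_real//.
have -> : K * `|th| * Q = `|th| * (K * Q) by rewrite mulrAC mulrC.
move: `|th| (K * Q) => s q.
rewrite (_ : lambda / 2 * (s - q / lambda) ^+ 2
  = lambda / 2 * s ^+ 2 - s * q + q ^+ 2 / (2 * lambda))//.
by field; rewrite gt_eqF.
Qed.

Lemma Htilde_le (t th : R) (x p : rV) : 0 <= t <= T ->
  H t x p <= running_cost t x p th.
Proof. by move=> tT; apply: ge_inf; [exact: running_cost_has_lbound|exists th]. Qed.

Lemma Htilde_near (t e : R) (x p : rV) : 0 <= t <= T -> 0 < e ->
  exists th, running_cost t x p th < H t x p + e.
Proof.
move=> tT e0; have [|_ [th _ <-] ?] := @inf_adherent _
    [set running_cost t x p th | th in [set: R]] _ e0.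
  by split; [exists (running_cost t x p 0); exists 0|exact: running_cost_has_lbound].
by exists th.
Qed.

(** The quadratic cost of the control can be offset only by a drift term linear in it, which limits
    nearly optimal controls to linear growth in the momentum. *)
Lemma near_optimal_bounded (t th : R) (x p : rV) : 0 <= t <= T ->
  running_cost t x p th <= running_cost t x p 0 + 1 ->
  `|th| <= 1 + 2 * (K * (\sum_i `|p 0 i|) + 1) / lambda.
Proof.
move=> tT Hth; have := running_cost_ge th x p tT; set Q := \sum_i `|p 0 i|.
move=> Hge; have {}Hth : lambda / 2 * th ^+ 2 <= K * `|th| * Q + 1.
  have aux (a b c d : R) : a + c - d <= b -> b <= a + 1 -> c <= d + 1 by move=> *; lra.
  exact: aux Hge Hth.
have KQ : 0 <= K * Q by rewrite mulr_ge0 ?(K_ge0 tT)// sumr_ge0.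
have [th1|th1] := leP `|th| 1.
  by rewrite (le_trans th1)// lerDl divr_ge0 ?(ltW lambda_gt0)// mulr_ge0// addr_ge0.
rewrite ler_wpDl// ler_pdivlMr//.
rewrite -[th ^+ 2]real_normK ?num_real// in Hth.
move: `|th| th1 Hth => s s1 Hs.
have s0 : 0 < s by lra.
rewrite -(ler_pM2l s0).
have -> : s * (s * lambda) = 2 * (lambda / 2 * s ^+ 2) by field.
nra.
Qed.

(** A nearly optimal control for [q] is used at [p], hence only [x] and [q] are bounded by [r]. This
    control and the drift grow at most linearly in [r], and so does the Lipschitz constant. Its
    dependence on the dimension is harmless, since it will only multiply the penalty. *)
Lemma Htilde_lipschitz (F0 : R) :
  (forall t : R, 0 <= t <= T -> `|f t 0 0 (empP2 (0 : rV))| <= F0) ->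
  exists2 B : R, 0 <= B & forall (t r d : R) (x p q : rV), 0 <= t <= T -> 1 <= r ->
    (forall i, `|x 0 i| <= r) -> (forall i, `|q 0 i| <= r) ->
    (forall i, `|p 0 i - q 0 i| <= d) -> H t x p <= H t x q + B * r * d.
Proof.
move=> F0f.
have [[tmp tT0]|noT] := pselect (exists t, 0 <= t <= T); last first.
  by exists 0 => // t r d x p q tT; exfalso; apply: noT; exists t.
have K0 := K_ge0 tT0.
have F00 : 0 <= F0 by apply: le_trans (F0f _ tT0).
pose c := 1 + 2 * (K * n.+1%:R + 1) / lambda.
have c0 : 0 <= c.
  by rewrite addr_ge0// divr_ge0 ?(ltW lambda_gt0)// mulr_ge0// addr_ge0// mulr_ge0.
exists (n.+1%:R * (F0 + K * (c + 2))) => [|t r d x p q tT r1 xr qr pqd].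
  by rewrite mulr_ge0// addr_ge0// mulr_ge0// addr_ge0.
have r0 : 0 <= r by lra.
have sum_le (a : 'I_n.+1 -> R) b : (forall i, a i <= b) -> \sum_i a i <= n.+1%:R * b.
  move=> ab; apply: (@le_trans _ _ (\sum_(i < n.+1) b)); first exact: ler_sum.
  by rewrite sumr_const card_ord mulr_natl.
apply/ler_addgt0Pr => e e0.
have e1 : 0 < Num.min e 1 by rewrite lt_min e0 ltr01.
have [th Hth] := Htilde_near x q tT e1.
have thr : `|th| <= c * r.
  have := @near_optimal_bounded t th x q tT.
  have := Htilde_le 0 x q tT; have : Num.min e 1 <= 1 by rewrite ge_min lexx orbT.
  move=> m1 H0 /(_ _)/le_trans; apply; first by lra.
  have Hq : \sum_i `|q 0 i| <= n.+1%:R * r by exact: sum_le.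
  have : 2 * (K * (\sum_i `|q 0 i|) + 1) / lambda <= 2 * (K * n.+1%:R + 1) / lambda * r.
    rewrite [leRHS]mulrAC ler_wpM2r ?invr_ge0 ?(ltW lambda_gt0)//.
    by have := ler_wpM2l K0 Hq; lra.
  rewrite /c; lra.
have fi i : `|f t th (x 0 i) (empP2 x)| <= (F0 + K * (c + 2)) * r.
  have := derivatives_bounded_lipschitz f_bounded 0 th 0 (x 0 i) 0 x tT.
  rewrite !subr0 => Hf.
  have ax : avg1 x <= r by rewrite /avg1 ler_pdivrMl//; exact: sum_le.
  have := ler_normD (f t th (x 0 i) (empP2 x) - f t 0 0 (empP2 (0 : rV)))
    (f t 0 0 (empP2 (0 : rV))).
  rewrite subrK => /le_trans; apply.
  have : K * (`|th| + `|x 0 i| + avg1 x) <= K * (c * r + r + r).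
    by rewrite ler_wpM2l// !lerD.
  have : F0 <= F0 * r by rewrite ler_peMr.
  have := F0f t tT; lra.
apply: (le_trans (Htilde_le th x p tT)).
have -> : running_cost t x p th = running_cost t x q th
    + \sum_i f t th (x 0 i) (empP2 x) * (p 0 i - q 0 i).
  have E : \sum_i f t th (x 0 i) (empP2 x) * (p 0 i - q 0 i) =
      \sum_i f t th (x 0 i) (empP2 x) * p 0 i - \sum_i f t th (x 0 i) (empP2 x) * q 0 i.
    by rewrite -sumrB; apply: eq_bigr => i _; rewrite mulrBr.
  by rewrite /running_cost E; ring.
have : \sum_i f t th (x 0 i) (empP2 x) * (p 0 i - q 0 i) <=
    n.+1%:R * ((F0 + K * (c + 2)) * r * d).
  apply: sum_le => i; apply: (le_trans (ler_norm _)); rewrite normrM.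
  by apply: ler_pM.
have : Num.min e 1 <= e by rewrite ge_min lexx.
lra.
Qed.

End hamiltonian.

Lemma quadratic_ge0_lead (R : realType) (a b c : R) :
  (forall s, 0 <= c + s * b + s ^+ 2 * a) -> 0 <= a.
Proof.
move=> H; rewrite leNgt; apply/negP => a0.
have c0 : 0 <= c by have := H 0; rewrite mul0r expr0n mul0r !addr0.
pose s := 1 + (c + 1) / - a.
have na : 0 < - a by rewrite oppr_gt0.
have sE : (s - 1) * - a = c + 1 by rewrite /s addrC addKr divfK// gt_eqF.
have s1 : 1 <= s by rewrite /s lerDl divr_ge0 ?(ltW na)// addr_ge0.
by have := H s; have := H (- s); nra.
Qed.

Lemma affine_ge0_slope (R : realType) (b c : R) :
  (forall s, 0 <= c + s * b) -> b = 0.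
Proof.
move=> H; apply/eqP/negPn/negP => b0.
by have := H (- (c + 1) / b); rewrite divfK//; lra.
Qed.

(** If [q] dropped by [d] along one step [h], concavity would force a drop of at least [d] at every
    further step, and eventually a negative value. *)
Lemma midpoint_concave_ge0_constant (R : realType) (E : lmodType R) (q : E -> R) :
  (forall m h, q (m + h) + q (m - h) <= 2 * q m) -> (forall m, 0 <= q m) ->
  forall m h, q (m + h) = q m.
Proof.
move=> cq q0.
suff H m h : q m <= q (m + h).
  by move=> m h; apply/eqP; rewrite eq_le H andbT -{2}(addrK h m) H.
rewrite leNgt; apply/negP; rewrite -subr_gt0; set d := q m - _ => d0.
have step (k : nat) :
    q (m + h *+ k.+1) <= q (m + h *+ k) - d /\ q (m + h *+ k) <= q m - k%:R * d.
  elim: k => [|k [IH1 IH2]]; first by rewrite mulr1n mulr0n !addr0 mul0r subr0 /d; lra.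
  have := cq (m + h *+ k.+1) h.
  have -> : m + h *+ k.+1 + h = m + h *+ k.+2 by rewrite -addrA -mulrSr.
  have -> : m + h *+ k.+1 - h = m + h *+ k by rewrite [h *+ k.+1]mulrSr addrA addrK.
  by rewrite -natr1; lra.
have [_ H] := step (Num.truncn (q m / d)).+1.
have := q0 (m + h *+ (Num.truncn (q m / d)).+1); apply/negP; rewrite -ltNge.
apply: (le_lt_trans H); rewrite subr_lt0 -ltr_pdivrMr//; exact: truncnS_gt.
Qed.

(** The values of [g] are [g 0] and [- g 0]. On a grid of mesh 1/N with c/N < |g 0|, a change of
    sign between neighbours would be a jump of size 2 |g 0|, too large for the Lipschitz bound. *)
Lemma constant_square_constant (R : realType) (g : R -> R) (c : R) :
  (forall s s', g s ^+ 2 = g s' ^+ 2) ->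
  (forall s s', `|g s - g s'| <= c * `|s - s'|) -> g 1 = g 0.
Proof.
move=> g2 gc; have [g00|g00] := eqVneq (g 0) 0.
  by have := g2 1 0; rewrite g00 expr0n => /eqP; rewrite sqrf_eq0 => /eqP.
have a0 : 0 < `|g 0| by rewrite normr_gt0.
have c0 : 0 <= c.
  by have := gc 1 0; rewrite subr0 normr1 mulr1; apply: le_trans.
pose N := (Num.truncn (c / `|g 0|)).+1.
have N0 : 0 < N%:R :> R by rewrite ltr0n.
have cN : c < `|g 0| * N%:R by rewrite mulrC -ltr_pdivrMr//; exact: truncnS_gt.
have step (k : nat) : g (k%:R / N%:R) = g 0.
  elim: k => [|k IH]; first by rewrite mul0r.
  have := gc (k.+1%:R / N%:R) (k%:R / N%:R); rewrite IH -mulrBl -natr1 addrAC subrr add0r.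
  rewrite mul1r (ger0_norm (x := N%:R^-1)) ?invr_ge0// => H.
  have /eqP := g2 ((k%:R + 1) / N%:R) 0; rewrite eqf_sqr => /orP[/eqP//|/eqP E].
  exfalso; move: H; rewrite E; apply/negP; rewrite -ltNge ltr_pdivrMr//.
  rewrite -opprD normrN -mulr2n normrMn mulr2n mulrDl.
  by apply: (lt_le_trans cN); rewrite lerDl mulr_ge0// ltW.
by have := step N; rewrite divff// gt_eqF.
Qed.

Lemma cost_second_difference (R : realType) (phi : R -> R) (C11 C10 C20 x h : R) :
  cost_assumption phi C11 C10 C20 ->
  `|phi (x + h) + phi (x - h) - 2 * phi x| <= 2 * C20 * h ^+ 2.
Proof.
move=> H.
have dphi (y : R) : is_derive y 1 phi (phi^`() y).
  by apply: is_derive_derive1; have [_ ? _ _ _] := H y.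
have [s /andP[s0 s1] Es] := MVT_R x (x + h) dphi.
have [r /andP[r0 r1] Er] := MVT_R (x - h) x dphi.
have -> : phi (x + h) + phi (x - h) - 2 * phi x =
  (phi (x + h) - phi x) - (phi x - phi (x - h)) by ring.
rewrite Es Er opprB [x + h - x]addrAC subrr add0r addrCA subrr addr0 -mulrBl normrM.
have := @MVT_bound R phi^`() C20 (x - h + r * h) (x + s * h).
move=> /(_ (fun y => let: And5 _ _ d _ b := H y in conj d b)).
have -> : x + s * h - (x - h + r * h) = (s + 1 - r) * h by ring.
rewrite normrM ger0_norm; last by lra.
have C20_ge0 : 0 <= C20 by have [_ _ _ _] := H 0; exact: le_trans.
move=> /(ler_wpM2r (normr_ge0 h))/le_trans; apply.
rewrite -[h ^+ 2]real_normK ?num_real//.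
have -> : C20 * ((s + 1 - r) * `|h|) * `|h| = (s + 1 - r) * (C20 * `|h| ^+ 2) by ring.
rewrite -mulrA ler_wpM2r//; last by lra.
by rewrite mulr_ge0// sqr_ge0.
Qed.

(** * Second differences of the drift and of the Hamiltonian *)

Section drift.
Context (R : realType) (n : nat).
Local Notation rV := 'rV[R]_n.+1.
Variables (T K lambda : R) (f : coef R) (fmu : mcoef R) (L : R -> R).
Hypothesis f_bounded : derivatives_bounded T K f fmu.
Hypothesis lambda_gt0 : 0 < lambda.
Local Notation H := (@Htilde R f L lambda n).

Definition drift (t th : R) (i : 'I_n.+1) (x : rV) : R := f t th (x 0 i) (empP2 x).

(** For an affine drift the running cost is a quadratic polynomial in the control, minimal at
    [- (s * b / lambda)]. *)
Lemma Htilde_affine (t a b s : R) (i : 'I_n.+1) (x : rV) : 0 <= t <= T ->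
  (forall th, drift t th i x = a + th * b) ->
  H t x (s *: delta_mx 0 i) =
    n.+1%:R^-1 * (\sum_j L (x 0 j)) + s * a - (s * b) ^+ 2 / (2 * lambda).
Proof.
move=> tT dE.
have E th : running_cost lambda f L t x (s *: delta_mx 0 i) th =
    lambda / 2 * th ^+ 2 + (a + th * b) * s + n.+1%:R^-1 * (\sum_j L (x 0 j)).
  rewrite /running_cost; congr (_ + _ + _).
  rewrite (bigD1 i)//= big1 => [|j ji]; last first.
    by rewrite !mxE eqxx (negbTE ji) !mulr0.
  by rewrite addr0 !mxE !eqxx mulr1 -dE.
apply: inf_of_min.
  exists (- (s * b / lambda)) => //; rewrite -/(running_cost _ _ _ _ _ _ _) E.
  by move: (n.+1%:R^-1 * _) => S; field; rewrite gt_eqF.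
move=> _ [th _ <-]; rewrite -/(running_cost _ _ _ _ _ _ _) E.
have : 0 <= lambda / 2 * (th + s * b / lambda) ^+ 2.
  by rewrite mulr_ge0 ?sqr_ge0// divr_ge0// ltW.
have -> : lambda / 2 * (th + s * b / lambda) ^+ 2 =
    lambda / 2 * th ^+ 2 + th * b * s + (s * b) ^+ 2 / (2 * lambda).
  by field; rewrite gt_eqF.
move: (\sum_j _) => S; move: ((s * b) ^+ 2 / _) (lambda / 2 * _) (_^-1 * S) => u v w.
lra.
Qed.

Hypothesis Df_bounded : derivatives_bounded T K (Dtheta f) (at_y (@Dtheta R) fmu).

(* Testing convexity of H at p = s e_i for all real s: the drift is affine in the
   control, so H is a quadratic polynomial in s. *)
Lemma drift_second_difference_eq0 (t : R) (i : 'I_n.+1) : 0 <= t <= T ->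
  (forall (x : rV) th, Dtheta f t th (x 0 i) (empP2 x) = Dtheta f t 0 (x 0 i) (empP2 x)) ->
  (forall p, convex_function (setT : set rV) (fun x => H t x p)) ->
  forall th m h, diff2 (drift t th i) m h = 0.
Proof.
move=> tT Dconst Hconvex.
pose a := drift t 0 i; pose b (x : rV) := Dtheta f t 0 (x 0 i) (empP2 x).
have dE x th : drift t th i x = a x + th * b x.
  have [|s _] := @MVT_R R (fun th => drift t th i x) (fun=> b x) 0 th.
    move=> s; rewrite /b -(Dconst x s); apply: is_derive_derive1.
    by have [? _ _ _ _] := f_bounded s (x 0 i) (empP2 x) tT.
  by rewrite subr0 => E; rewrite -[LHS](subrK (a x)) E addrC mulrC.
pose g (x : rV) := n.+1%:R^-1 * (\sum_j L (x 0 j)).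
have Hs m h s : 0 <= diff2 g m h + s * diff2 a m h
    + s ^+ 2 * ((2 * b m ^+ 2 - b (m + h) ^+ 2 - b (m - h) ^+ 2) / (2 * lambda)).
  have := convex_midpoint m h (Hconvex (s *: delta_mx 0 i)).
  rewrite !(Htilde_affine s tT (dE _)) -!/(g _) /diff2.
  have aux (g1 g2 g3 a1 a2 a3 b1 b2 b3 l : R) :
     2 * (g3 + s * a3 - (s * b3) ^+ 2 / l) <=
       g1 + s * a1 - (s * b1) ^+ 2 / l + (g2 + s * a2 - (s * b2) ^+ 2 / l) ->
     0 <= g1 + g2 - 2 * g3 + s * (a1 + a2 - 2 * a3)
       + s ^+ 2 * ((2 * b3 ^+ 2 - b1 ^+ 2 - b2 ^+ 2) / l).
    by rewrite -subr_ge0 => H0; apply: (le_trans H0); rewrite le_eqVlt; apply/orP;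
      left; apply/eqP; ring.
  exact: aux.
(* The coefficient of [s ^+ 2] in [Hs] must be nonnegative, so [b ^+ 2] is midpoint concave and
   nonnegative, hence constant. *)
have b2 m h : b (m + h) ^+ 2 = b m ^+ 2.
  apply: (@midpoint_concave_ge0_constant R _ (fun x => b x ^+ 2)) => [{}m {}h|{}m].
    have := quadratic_ge0_lead (Hs m h); rewrite pmulr_lge0 ?invr_gt0 ?mulr_gt0//; lra.
  exact: sqr_ge0.
(* The quadratic term is gone, and a nonnegative affine function of [s] has slope zero. *)
have a2 m h : diff2 a m h = 0.
  apply: (@affine_ge0_slope R _ (diff2 g m h)) => s.
  have := Hs m h s; rewrite (b2 m h) (b2 m (- h)).
  by rewrite (_ : 2 * _ - _ - _ = 0) ?mul0r ?mulr0 ?addr0//; ring.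
(* [b] could still change sign; its Lipschitz bound along lines excludes this. *)
have bh m h : b (m + h) = b m.
  have := @constant_square_constant R (fun s => b (m + s *: h)) (K * (`|h 0 i| + avg1 h)).
  rewrite scale1r scale0r addr0; apply => [s s'|s s'].
    by rewrite (b2 m (s *: h)) (b2 m (s' *: h)).
  have := derivatives_bounded_lipschitz Df_bounded 0 0 ((m + s' *: h) 0 i)
    ((m + s *: h) 0 i) (m + s' *: h) (m + s *: h) tT.
  move=> /le_trans; apply; rewrite subrr normr0 add0r -mulrA ler_wpM2l ?(K_ge0 f_bounded tT)//.
  have -> : m + s *: h - (m + s' *: h) = (s - s') *: h.
    by rewrite opprD addrACA subrr add0r -scalerBl.
  have -> : (m + s *: h) 0 i - (m + s' *: h) 0 i = (s - s') * h 0 i by rewrite !mxE; ring.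
  by rewrite avg1Z normrM -mulrDr mulrC.
move=> th m h; rewrite /diff2 !dE !bh.
by have := a2 m h; rewrite /diff2; lra.
Qed.

(** The control nearly optimal at the centre is tried at both outer points. The opposite shifts of
    the momentum by [c *: h] cancel except against the odd part of the drift, itself Lipschitz in
    [h], which costs [4 * K * c * sqn h]. *)
Lemma Htilde_semiconcave (CL11 CL10 CL20 A1 : R) (t c : R) (m h P : rV) :
  cost_assumption L CL11 CL10 CL20 -> 0 <= t <= T -> 0 <= c ->
  (forall th, \sum_i P 0 i * diff2 (drift t th i) m h <= A1 * sqn h) ->
  H t (m + h) (P + c *: h) + H t (m - h) (P - c *: h) - 2 * H t m P <=
  (A1 + 2 * CL20 / n.+1%:R + 4 * K * c) * sqn h.
Proof.
move=> HL tT c0 HA; apply/ler_addgt0Pr => e e0.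
have e2 : 0 < e / 2 by rewrite divr_gt0.
have [th Hth] := Htilde_near L f_bounded lambda_gt0 m P tT e2.
have H1 := Htilde_le L f_bounded lambda_gt0 th (m + h) (P + c *: h) tT.
have H2 := Htilde_le L f_bounded lambda_gt0 th (m - h) (P - c *: h) tT.
pose D i x := drift t th i x.
have EL : n.+1%:R^-1 * (\sum_i L ((m + h) 0 i)) + n.+1%:R^-1 * (\sum_i L ((m - h) 0 i))
   - 2 * (n.+1%:R^-1 * (\sum_i L (m 0 i))) <= 2 * CL20 / n.+1%:R * sqn h.
  have ES : \sum_i L ((m + h) 0 i) + \sum_i L ((m - h) 0 i) - 2 * \sum_i L (m 0 i)
      <= 2 * CL20 * sqn h.
    have -> : 2 * \sum_i L (m 0 i) = \sum_i 2 * L (m 0 i) by rewrite mulr_sumr.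
    have -> : 2 * CL20 * sqn h = \sum_i 2 * CL20 * h 0 i ^+ 2 by rewrite -mulr_sumr.
    rewrite -big_split/= -sumrB; apply: ler_sum => i _; rewrite !mxE.
    by have := cost_second_difference (m 0 i) (h 0 i) HL; rewrite ler_norml => /andP[].
  have := ler_wpM2l (_ : 0 <= n.+1%:R^-1) ES; rewrite invr_ge0 => /(_ (ler0n _ _)).
  move: (n.+1%:R^-1) => v; move: (\sum_i L _) (\sum_i L _) (\sum_i L _) (sqn h) => a b d q.
  lra.
have EP : \sum_i D i (m + h) * (P + c *: h) 0 i + \sum_i D i (m - h) * (P - c *: h) 0 i
   - 2 * \sum_i D i m * P 0 i =
   \sum_i P 0 i * diff2 (drift t th i) m h + c * \sum_i h 0 i * (D i (m + h) - D i (m - h)).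
  rewrite !mulr_sumr -!big_split/= -sumrB; apply: eq_bigr => i _.
  by rewrite !mxE /diff2 /D /=; ring.
have Ec : \sum_i h 0 i * (D i (m + h) - D i (m - h)) <= 4 * K * sqn h.
  have Di i : h 0 i * (D i (m + h) - D i (m - h)) <= 2 * K * (h 0 i ^+ 2 + `|h 0 i| * avg1 h).
    apply: (le_trans (ler_norm _)); rewrite normrM.
    have := derivatives_bounded_lipschitz f_bounded th th ((m - h) 0 i) ((m + h) 0 i)
      (m - h) (m + h) tT.
    have -> : m + h - (m - h) = 2 *: h.
      by rewrite opprB (addrC m) addrACA subrr addr0 scaler_nat mulr2n.
    rewrite avg1Z subrr normr0 add0r.
    have -> : (m + h) 0 i - (m - h) 0 i = 2 * h 0 i by rewrite !mxE; ring.
    rewrite normrM (ger0_norm (x := 2))// -mulrDr.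
    move=> /(ler_wpM2l (normr_ge0 (h 0 i)))/le_trans; apply.
    rewrite -[h 0 i ^+ 2]real_normK ?num_real// le_eqVlt; apply/orP; left; apply/eqP; ring.
  apply: (le_trans (ler_sum _ (fun i _ => Di i))).
  rewrite -mulr_sumr big_split/= -mulr_suml -/(sqn h).
  have := avg1_sqr_le h; rewrite ler_pdivlMl//.
  have -> : \sum_i `|h 0 i| = n.+1%:R * avg1 h by rewrite /avg1 mulVKf// pnatr_eq0.
  rewrite -mulrA -expr2 => Hs.
  have := ler_wpM2l (K_ge0 f_bounded tT) Hs; lra.
have {}Ec := ler_wpM2l c0 Ec; have := HA th.
rewrite /running_cost in H1 H2 Hth.
have aux (h1 h2 h0 l d1 d2 d0 g1 g2 g0 pd hc k1 k2 k3 q : R) :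
  h1 <= l + d1 + g1 -> h2 <= l + d2 + g2 -> l + d0 + g0 < h0 + e / 2 ->
  g1 + g2 - 2 * g0 <= k2 * q -> d1 + d2 - 2 * d0 = pd + c * hc -> pd <= k1 * q ->
  c * hc <= c * (k3 * q) -> h1 + h2 - 2 * h0 <= (k1 + k2 + k3 * c) * q + e.
  move=> A1' A2' A3' A4' A5' A6' A7'.
  have : (k1 + k2 + k3 * c) * q = k1 * q + k2 * q + c * (k3 * q) by ring.
  move: (c * (k3 * q)) (c * hc) (k1 * q) (k2 * q) A4' A5' A6' A7' => *; lra.
move=> HP; exact: (aux _ _ _ _ _ _ _ _ _ _ _ _ _ _ _ _ H1 H2 Hth EL EP HP Ec).
Qed.

End drift.

(** * Bounds on the solution *)

Section cost_bounds.
Context (R : realType) (phi : R -> R) (C11 C10 C20 : R).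
Hypothesis Hphi : cost_assumption phi C11 C10 C20.

Lemma cost_C20_ge0 : 0 <= C20.
Proof. by have [_ _ _ _] := Hphi 0; exact: le_trans. Qed.

Lemma cost_C10_ge0 : 0 <= C10.
Proof. by have [_ _ _ + _] := Hphi 0; rewrite normr0 mulr0 add0r; exact: le_trans. Qed.

Lemma cost_C11_ge0 : 0 <= C11.
Proof.
rewrite leNgt; apply/negP => C110; have C100 := cost_C10_ge0.
have nC : 0 < - C11 by rewrite oppr_gt0.
(* At this point the bound on the derivative would equal -1. *)
have x0 : 0 <= (C10 + 1) / - C11 by rewrite divr_ge0 ?(ltW nC)// addr_ge0.
have [_ _ _ + _] := Hphi ((C10 + 1) / - C11); rewrite (ger0_norm x0).
have -> : C11 * ((C10 + 1) / - C11) = - (C10 + 1) by field; rewrite lt_eqF.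
by rewrite opprD addrAC addNr add0r => /(le_trans (normr_ge0 _)); rewrite ler0N1.
Qed.

Lemma cost_growth x : `|phi x| <= (`|phi 0| + C11 + C10) * (1 + x ^+ 2).
Proof.
have dphi (y : R) : is_derive y 1 phi (phi^`() y).
  by apply: is_derive_derive1; have [_ ? _ _ _] := Hphi y.
have [s /andP[s0 s1] Es] := MVT_R 0 x dphi.
rewrite -[phi x](subrK (phi 0)) Es subr0 add0r (le_trans (ler_normD _ _))//.
have : `|phi^`()%classic (s * x) * x| <= (C11 * `|x| + C10) * `|x|.
  rewrite normrM ler_wpM2r//; have [_ _ _ + _] := Hphi (s * x) => /le_trans; apply.
  by rewrite lerD2r ler_wpM2l ?cost_C11_ge0// normrM (gtr0_norm s0) ler_piMl// ltW.
rewrite -[x ^+ 2]real_normK ?num_real//; move: `|_ * x| => z.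
have := (cost_C11_ge0, cost_C10_ge0, normr_ge0 x, normr_ge0 (phi 0)).
move: `|x| `|phi 0| => u v [[[c11 c10] u0] v0] H.
have uu : u <= 1 + u ^+ 2 by have := sqr_ge0 (u - 1); have := sqr_ge0 u; nra.
have := ler_wpM2l c10 uu; have := mulr_ge0 v0 (sqr_ge0 u).
have := mulr_ge0 c10 u0 => *; lra.
Qed.

Lemma convex_derive2_ge0 x :
  convex_function (setT : set R^o) phi -> 0 <= phi^`()%classic^`()%classic x.
Proof.
move=> cphi; rewrite -oppr_le0.
apply: (@second_difference_derive2_le R (fun s => - phi (x + s * 1))
  (fun s => - (1 * phi^`()%classic (x + s * 1)))) => [s||s _].
- apply: is_deriveN; apply: is_derive_affine.
  by apply: is_derive_derive1; have [_ ? _ _ _] := Hphi (x + s * 1).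
- apply: is_deriveN; under eq_fun do rewrite mul1r.
  rewrite -[phi^`()%classic^`()%classic x]mul1r; apply: is_derive_affine; rewrite mul0r addr0.
  by apply: is_derive_derive1; have [_ _ ? _ _] := Hphi x.
rewrite mul0r !mulr1 mul0r addr0.
by have := @convex_midpoint R R^o phi x s cphi; lra.
Qed.

End cost_bounds.

Section gradient_bounds.
Context (R : realType) (C11 C10 Gamma1 Gamma2 : R).
Hypothesis C11_ge0 : 0 <= C11.
Hypothesis C10_ge0 : 0 <= C10.
Hypothesis Gamma1_gt0 : 0 < Gamma1.
Hypothesis Gamma2_gt0 : 0 < Gamma2.

Lemma Aset_norm_le n (x p : 'rV[R]_n.+1) i :
  Aset C11 C10 Gamma1 Gamma2 (x, p) ->
  `|p 0 i| <= Gbound C11 C10 i x (Gamma1 + Gamma2).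
Proof.
move=> /(_ i) /= H.
have := (@Gbound_ge0 R C11 C10 n i x Gamma1 C11_ge0 C10_ge0 Gamma1_gt0,
  @Gbound_ge0 R C11 C10 n i x Gamma2 C11_ge0 C10_ge0 Gamma2_gt0) => -[g1 g2].
have -> : Gbound C11 C10 i x (Gamma1 + Gamma2) =
  Gbound C11 C10 i x Gamma1 + Gbound C11 C10 i x Gamma2 by rewrite /Gbound; ring.
by move: H => /andP[? ?]; rewrite ler_norml; apply/andP; split; lra.
Qed.

(** The factor 1/N is given away: this bound serves the growth of [V] and the errors of the penalty,
    neither of which enters the final constant. The 2 comes from 1 + r^2 + r^2 <= 4 r^2. *)
Lemma Aset_linear_growth n (x p : 'rV[R]_n.+1) i (r : R) :
  Aset C11 C10 Gamma1 Gamma2 (x, p) -> 1 <= r -> (forall j, `|x 0 j| <= r) ->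
  `|p 0 i| <= (Gamma1 + Gamma2) * (2 * C11 + C10) * r.
Proof.
move=> Ap r1 xr; apply: (le_trans (Aset_norm_le i Ap)).
have r0 : 0 <= r by lra.
have G0 : 0 <= Gamma1 + Gamma2 by rewrite addr_ge0// ltW.
have N1 : n.+1%:R^-1 <= 1 :> R by rewrite invf_le1// ler1n.
have Ni : 0 <= n.+1%:R^-1 :> R by [].
have x2 j : x 0 j ^+ 2 <= r ^+ 2.
  by rewrite -[leLHS]real_normK ?num_real// lerXn2r// nnegrE.
have S : n.+1%:R^-1 * \sum_j x 0 j ^+ 2 <= r ^+ 2.
  rewrite ler_pdivrMl//; apply: (@le_trans _ _ (\sum_(j < n.+1) r ^+ 2)).
    exact: ler_sum.
  by rewrite sumr_const card_ord mulr_natl.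
have sq : Num.sqrt (1 + x 0 i ^+ 2 + n.+1%:R^-1 * \sum_j x 0 j ^+ 2) <= 2 * r.
  have -> : 2 * r = Num.sqrt ((2 * r) ^+ 2) by rewrite sqrtr_sqr ger0_norm// mulr_ge0.
  rewrite ler_wsqrtr// exprMn.
  have : 1 <= r ^+ 2 := exprn_ege1 2 r1; move: S (x2 i).
  move: (_^-1 * _) (x 0 i ^+ 2) (r ^+ 2) => a b d *; lra.
rewrite /Gbound; set s := Num.sqrt _ in sq *; have s0 : 0 <= s by exact: sqrtr_ge0.
have G11 : 0 <= (Gamma1 + Gamma2) * C11 by exact: mulr_ge0.
have G10 : 0 <= (Gamma1 + Gamma2) * C10 by exact: mulr_ge0.
have H1 : (Gamma1 + Gamma2) * C11 / n.+1%:R * s <= (Gamma1 + Gamma2) * C11 * (2 * r).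
  by apply: ler_pM => //; [exact: mulr_ge0|rewrite ler_piMr].
have H2 : (Gamma1 + Gamma2) * C10 / n.+1%:R <= (Gamma1 + Gamma2) * C10 * r.
  by apply: ler_wpM2l => //; exact: le_trans r1.
apply: (le_trans (lerD H1 H2)).
by rewrite le_eqVlt; apply/orP; left; apply/eqP; ring.
Qed.

End gradient_bounds.

Section drift_second_difference.
Context (R : realType) (T K : R) (f : coef R) (fmu : mcoef R)
  (fmumu : R -> R -> R -> P2 R -> R -> R -> R) (L : R -> R) (lambda lambda0 : R)
  (C11 C10 Gamma1 Gamma2 : R).
Hypothesis Hf : derivatives_bounded T K f fmu.
Hypothesis Hfth : derivatives_bounded T K (Dtheta f) (at_y (@Dtheta R) fmu).
Hypothesis Hfx : derivatives_bounded T K (Dx f) (at_y (@Dx R) fmu).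
Hypothesis Hfmu : forall y, derivatives_bounded T K (slice fmu y)
  (fun t th x mu => fmumu t th x mu y).
Hypothesis Hfy : forall (t th x : R) (mu : P2 R) (y : R), 0 <= t <= T ->
  derivable (fmu t th x mu) y 1 /\ `|(fmu t th x mu)^`()%classic y| <= K.
Hypothesis C11_ge0 : 0 <= C11.
Hypothesis C10_ge0 : 0 <= C10.
Hypothesis Gamma1_gt0 : 0 < Gamma1.
Hypothesis Gamma2_gt0 : 0 < Gamma2.
Hypothesis lambda_gt0 : 0 < lambda.

(** Opposite increments cancel the first-order terms; each of the two expansions leaves [3 * K]. *)
Lemma drift_diff2_le n (t th : R) i (m h : 'rV[R]_n.+1) : 0 <= t <= T ->
  `|diff2 (drift f t th i) m h| <= 6 * K * (h 0 i ^+ 2 + n.+1%:R^-1 * sqn h).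
Proof.
move=> tT; rewrite /diff2 /drift.
have H1 := coefficient_first_order Hf Hfx Hfmu Hfy th (m 0 i) (h 0 i) m h tT.
have H2 := coefficient_first_order Hf Hfx Hfmu Hfy th (m 0 i) (- h 0 i) m (- h) tT.
rewrite sqrrN sqnN in H2; rewrite !mxE.
set D := Dx _ _ _ _ _ * _ + _ in H1.
have E : Dx f t th (m 0 i) (empP2 m) * - h 0 i +
    n.+1%:R^-1 * (\sum_i0 fmu t th (m 0 i) (empP2 m) (m 0 i0) * (- h) 0 i0) = - D.
  rewrite /D opprD mulrN; congr (_ + _); rewrite -mulrN -sumrN; congr (_ * _).
  by apply: eq_bigr => j _; rewrite mxE mulrN.
rewrite E in H2.
have aux (a b c d q : R) : `|a - c - d| <= 3 * K * q -> `|b - c - - d| <= 3 * K * q ->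
    `|a + b - 2 * c| <= 6 * K * q.
  have -> : a + b - 2 * c = (a - c - d) + (b - c - - d) by ring.
  move=> Ha Hb; apply: (le_trans (ler_normD _ _)); apply: (le_trans (lerD Ha Hb)).
  by rewrite le_eqVlt; apply/orP; left; apply/eqP; ring.
exact: aux H1 H2.
Qed.

(* If C11 = 0 the momenta are O(1/N) and bounded second derivatives suffice;
   otherwise hypothesis (R) forces the drift to be affine. *)
Lemma weighted_drift_diff2_le n (t th : R) (m h P : 'rV[R]_n.+1) : 0 <= t <= T ->
  (forall n (t th : R) (x p : 'rV[R]_n.+1), 0 <= t <= T ->
        Aset C11 C10 Gamma1 Gamma2 (x, p) ->
        0 <= lambda0
             + \sum_i Dtheta (Dtheta f) t th (x 0 i) (empP2 x) * p 0 i) ->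
  (forall p : 'rV[R]_n.+1,
     convex_function (setT : set 'rV[R]_n.+1) (fun x => Htilde f L lambda t x p)) ->
  Aset C11 C10 Gamma1 Gamma2 (m, P) ->
  \sum_i P 0 i * diff2 (drift f t th i) m h <=
    12 * K * ((Gamma1 + Gamma2) * C10) / n.+1%:R * sqn h.
Proof.
move=> tT HR Hconvex Ap; have K0 := K_ge0 Hf tT.
have G0 : 0 <= (Gamma1 + Gamma2) * C10 by rewrite mulr_ge0// addr_ge0// ltW.
have Ni : 0 <= n.+1%:R^-1 :> R by [].
have [C110|C110] := eqVneq C11 0; last first.
  have C11_gt0 : 0 < C11 by rewrite lt_neqAle eq_sym C110.
  rewrite big1 => [|i _].
    apply: mulr_ge0; last exact: sqn_ge0.
    by apply: mulr_ge0 => //; apply: mulr_ge0 => //; exact: mulr_ge0.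
  rewrite (drift_second_difference_eq0 Hf lambda_gt0 Hfth tT _ Hconvex) ?mulr0// => x th'.
  exact: (Dtheta_constant HR C11_gt0 C10_ge0 Gamma1_gt0 Gamma2_gt0 Hfth).
have Pi i : `|P 0 i| <= (Gamma1 + Gamma2) * C10 / n.+1%:R.
  have := Aset_norm_le C11_ge0 C10_ge0 Gamma1_gt0 Gamma2_gt0 i Ap.
  by rewrite /Gbound C110 mulr0 !mul0r add0r.
apply: (@le_trans _ _ (\sum_i (Gamma1 + Gamma2) * C10 / n.+1%:R *
    (6 * K * (h 0 i ^+ 2 + n.+1%:R^-1 * sqn h)))).
  apply: ler_sum => i _; apply: (le_trans (ler_norm _)); rewrite normrM.
  by apply: ler_pM; rewrite ?Pi//; exact: drift_diff2_le.
have E : \sum_i (h 0 i ^+ 2 + n.+1%:R^-1 * sqn h) = 2 * sqn h.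
  rewrite big_split/= sumr_const card_ord -[_ *+ n.+1]mulr_natl mulVKf ?pnatr_eq0//.
  by rewrite mulr2n mulrDl !mul1r.
rewrite -!mulr_sumr E.
by rewrite le_eqVlt; apply/orP; left; apply/eqP; ring.
Qed.

End drift_second_difference.

Section classical_solutions.
Context (R : realType) (T : R) (f : coef R) (L U : R -> R) (lambda sigma eps : R)
  (n : nat).
Local Notation rV := 'rV[R]_n.+1.
Variable V : R -> rV -> R.
Hypothesis T_gt0 : 0 < T.
Hypothesis sol : classical_solution T f L U lambda sigma eps V.

Lemma solution_C2 (t : R) : 0 <= t < T -> C2 (V t).
Proof.
move=> tT i j; have [_ _ H _ _] := sol; have [d1 c1 d2 c2] := H i j.
have slice (g : R -> rV -> R) :
    {within [set z : R * rV | 0 <= z.1 < T], continuous (fun z : R * rV => g z.1 z.2)} ->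
    continuous (g t).
  move=> cg.
  have : {within [set: rV], continuous (fun x : rV => g t x)}.
    apply: (@within_continuous_comp _ _ _ (fun x : rV => (t, x)) _ _ _ _ _ cg) => //.
    by apply: pair_continuous_map; [exact: cst_continuous|move=> x; exact: cvg_id].
  move/subspace_continuousP => H' x A gA.
  have H2 : nbhs x [set y : rV | [set: rV] y -> A (g t y)] := H' x I A gA.
  suff : nbhs x [set y : rV | A (g t y)] by []; by apply: filterS H2 => y; apply.
split.
- by move=> x; exact: d1.
- exact: (slice (fun s => partial j (V s))).
- by move=> x; exact: d2.
- exact: (slice (fun s => partial i (partial j (V s)))).
Qed.

Lemma solution_continuous_time (x : rV) : {within `[0, T], continuous (fun t => V t x)}.
Proof.
have [cV _ _ _ _] := sol.
apply: (@within_continuous_comp _ _ _ (fun t : R => (t, x)) _ _ _ _ _ cV).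
  by apply: pair_continuous_map; [move=> t; exact: cvg_id|exact: cst_continuous].
by move=> t /=; rewrite in_itv.
Qed.

(** Continuity in time bounds [V] at the origin, and the linear growth of the gradient does the
    rest. At [t = T], where [classical_solution] provides no space derivative, the terminal cost
    gives the bound directly. *)
Lemma solution_growth (C11 C10 Gamma1 Gamma2 CU11 CU10 CU20 : R) :
  0 <= C11 -> 0 <= C10 -> 0 < Gamma1 -> 0 < Gamma2 ->
  cost_assumption U CU11 CU10 CU20 ->
  (forall (t : R) x, 0 <= t <= T -> Aset C11 C10 Gamma1 Gamma2 (x, grad (V t) x)) ->
  exists2 C : R, 0 <= C & forall (t : R) x, 0 <= t <= T -> `|V t x| <= C * (1 + sqn x).
Proof.
move=> C11_ge0 C10_ge0 G1 G2 HU HA.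
have [t1 t1T Ht1] : exists2 t1 : R, t1 \in `[0, T]%R &
    forall t, t \in `[0, T]%R -> `|V t 0| <= `|V t1 0|.
  apply: (@EVT_max R (fun t => `|V t 0|) 0 T (ltW T_gt0)).
  move=> t; apply: (@continuous_comp (subspace `[0, T]) R R (fun t => V t 0) Num.norm).
    exact: (@solution_continuous_time 0).
  exact: (@norm_continuous _ R^o).
pose Cg := (Gamma1 + Gamma2) * (2 * C11 + C10).
have Cg0 : 0 <= Cg by rewrite mulr_ge0 ?addr_ge0 ?mulr_ge0// ltW.
pose CU := `|U 0| + CU11 + CU10.
have CU0 : 0 <= CU by rewrite !addr_ge0 ?(cost_C11_ge0 HU) ?(cost_C10_ge0 HU).
have N0 : 0 <= n.+1%:R * Cg by exact: mulr_ge0.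
exists (`|V t1 0| + n.+1%:R * Cg + CU) => [|t x tT].
  exact: addr_ge0 (addr_ge0 (normr_ge0 _) N0) CU0.
have w1 : 1 <= 1 + sqn x by rewrite lerDl sqn_ge0.
have w0 : 0 <= 1 + sqn x by rewrite (le_trans _ w1).
have [tltT|Tlet] := ltP t T.
  have tT' : 0 <= t < T by case/andP: tT => -> _.
  have C2t := solution_C2 tT'.
  have [s _|s /andP[s0 s1]] := @MVT_line R _ (V t) (fun s => dgrad (V t) x (s *: x)) 0 x.
    rewrite add0r.
    apply: (@partial_line_derive _ _ (V t) (fun j => partial j (V t))) => [j y|j].
      by have [+ _ _ _] := C2t j j => /(_ y) /derivableP.
    by have [_ + _ _] := C2t j j; apply.
  rewrite add0r => Es; rewrite -[V t x](subrK (V t 0)) Es (le_trans (ler_normD _ _))//.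
  pose r := Num.sqrt (1 + sqn x).
  have r2 : r ^+ 2 = 1 + sqn x by rewrite sqr_sqrtr.
  have r1 : 1 <= r by rewrite -sqrtr1 ler_wsqrtr.
  have xr j : `|x 0 j| <= r.
    by rewrite -sqrtr_sqr ler_wsqrtr// (le_trans (sqr_coord_le_sqn x j))// lerDr.
  have gr j : `|partial j (V t) (s *: x)| <= Cg * r.
    have := @Aset_linear_growth R C11 C10 Gamma1 Gamma2 C11_ge0 C10_ge0 G1 G2 n
      (s *: x) (grad (V t) (s *: x)) j r (HA t (s *: x) tT) r1.
    rewrite mxE; apply => i; rewrite mxE normrM (gtr0_norm s0).
    by apply: le_trans (xr i); rewrite ler_piMl// ltW.
  have : `|dgrad (V t) x (s *: x)| <= n.+1%:R * Cg * (1 + sqn x).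
    rewrite (le_trans (ler_norm_sum _ _ _))//.
    apply: (@le_trans _ _ (\sum_(j < n.+1) Cg * r ^+ 2)).
      apply: ler_sum => j _; rewrite normrM mulrC expr2 mulrA.
      by apply: ler_pM.
    by rewrite sumr_const card_ord r2 -[_ *+ n.+1]mulr_natl mulrA.
  have : `|V t 0| <= `|V t1 0| * (1 + sqn x).
    by apply: (le_trans (Ht1 t _)); rewrite ?in_itv//= ler_peMr.
  by have := mulr_ge0 CU0 w0; rewrite !mulrDl; lra.
have -> : t = T by apply/eqP; rewrite eq_le Tlet andbT; case/andP: tT.
have [_ _ _ _ ->] := sol.
have : `|n.+1%:R^-1 * \sum_i U (x 0 i)| <= CU * (1 + sqn x).
  rewrite normrM ger0_norm ?invr_ge0// ler_pdivrMl// (le_trans (ler_norm_sum _ _ _))//.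
  apply: (@le_trans _ _ (\sum_(j < n.+1) CU * (1 + sqn x))).
    apply: ler_sum => j _; apply: (le_trans (cost_growth HU _)).
    by rewrite ler_wpM2l// lerD2l sqr_coord_le_sqn.
  by rewrite sumr_const card_ord mulr_natl.
have := mulr_ge0 N0 w0; have := mulr_ge0 (normr_ge0 (V t1 0)) w0; rewrite !mulrDl; lra.
Qed.

(** The surplus 1 keeps the terminal weight at least 1/N even when [CU20 = 0]; errors of order 1/N
    are later absorbed by it. *)
Lemma terminal_diff2 (CU11 CU10 CU20 : R) m h : cost_assumption U CU11 CU10 CU20 ->
  diff2 (V T) m h <= (1 + 2 * CU20) / n.+1%:R * sqn h.
Proof.
move=> HU; have [_ _ _ _ VT] := sol; rewrite /diff2 !VT.
have ES : \sum_i U ((m + h) 0 i) + \sum_i U ((m - h) 0 i) - 2 * \sum_i U (m 0 i)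
    <= (1 + 2 * CU20) * sqn h.
  have -> : 2 * \sum_i U (m 0 i) = \sum_i 2 * U (m 0 i) by rewrite mulr_sumr.
  have -> : (1 + 2 * CU20) * sqn h = \sum_i (1 + 2 * CU20) * h 0 i ^+ 2 by rewrite -mulr_sumr.
  rewrite -big_split/= -sumrB; apply: ler_sum => i _; rewrite !mxE.
  have := cost_second_difference (m 0 i) (h 0 i) HU.
  rewrite ler_norml => /andP[_ /le_trans]; apply.
  by rewrite [leRHS]mulrDl mul1r lerDr sqr_ge0.
have := ler_wpM2l (_ : 0 <= n.+1%:R^-1) ES; rewrite invr_ge0 => /(_ (ler0n _ _)).
have -> : (1 + 2 * CU20) / n.+1%:R * sqn h = n.+1%:R^-1 * ((1 + 2 * CU20) * sqn h) by ring.
move=> /(le_trans _); apply; rewrite le_eqVlt; apply/orP; left; apply/eqP; ring.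
Qed.

Lemma terminal_diff2_ge0 m h : convex_function (setT : set R^o) U -> 0 <= diff2 (V T) m h.
Proof.
move=> cU; have [_ _ _ _ VT] := sol; rewrite /diff2 !VT.
rewrite mulrCA -mulrDr -mulrBr mulr_ge0 ?invr_ge0//.
have -> : 2 * \sum_i U (m 0 i) = \sum_i 2 * U (m 0 i) by rewrite mulr_sumr.
rewrite -big_split/= -sumrB; apply: sumr_ge0 => i _; rewrite !mxE subr_ge0.
exact: (@convex_midpoint R R^o U).
Qed.

(** The comparison reaches only interior times, since the equation is not stated at 0; continuity of
    [V] in time recovers [t = 0]. *)
Lemma diff2_time_closed (S c : R) m h :
  (forall t, 0 < t < T -> S * diff2 (V t) m h <= c) -> S * diff2 (V 0) m h <= c.
Proof.
move=> H; rewrite leNgt; apply/negP => c0.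
have cF : {within `[0, T], continuous (fun t => S * diff2 (V t) m h)}.
  move=> t; apply: (@cvgM R); first exact: cvg_cst.
  apply: (@cvgB _ R^o).
    by apply: (@cvgD _ R^o); exact: solution_continuous_time.
  by apply: (@cvgM R); [exact: cvg_cst|exact: solution_continuous_time].
move/subspace_continuousP: cF => /(_ 0); rewrite /= in_itv/= lexx ltW// => /(_ isT).
move=> /cvgrPdist_lt /(_ (S * diff2 (V 0) m h - c)); rewrite subr_gt0 => /(_ c0).
move=> /nbhs_ballP[d /= d0 Hd].
pose t := Num.min (d / 2) (T / 2).
have t0 : 0 < t by rewrite lt_min !divr_gt0.
have tT : t < T by rewrite gt_min orbC ltr_pdivrMr// ltr_pMr// ltr1n.
have td : t < d by rewrite gt_min ltr_pdivrMr// ltr_pMr// ltr1n.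
have := Hd t; rewrite /ball/= sub0r normrN gtr0_norm// => /(_ td).
rewrite in_itv/= (ltW t0) (ltW tT) => /(_ isT) /ltr_normlP[H1 H2].
have Ht := H t (introT andP (conj t0 tT)).
by move: H2; rewrite ltrD2l ltrN2 ltNge => /negP; apply.
Qed.

End classical_solutions.

(** * Convexity and semiconcavity of the solution *)

Section hessian_bounds.
Context (R : realType) (T K lambda lambda0 sigma eps C11 C10 Gamma1 Gamma2 : R)
  (f : coef R) (fmu : mcoef R) (fmumu : R -> R -> R -> P2 R -> R -> R -> R)
  (L U : R -> R) (CL11 CL10 CL20 CU11 CU10 CU20 : R) (n : nat).
Local Notation rV := 'rV[R]_n.+1.
Variable V : R -> rV -> R.
Hypothesis T_gt0 : 0 < T.
Hypothesis Hf : derivatives_bounded T K f fmu.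
Hypothesis Hf_time : forall th x mu,
  derivable_oo_LRcontinuous (fun t => f t th x mu) 0 T.
Hypothesis HL : cost_assumption L CL11 CL10 CL20.
Hypothesis HU : cost_assumption U CU11 CU10 CU20.
Hypothesis lambda_gt0 : 0 < lambda.
Hypothesis C11_ge0 : 0 <= C11.
Hypothesis C10_ge0 : 0 <= C10.
Hypothesis Gamma1_gt0 : 0 < Gamma1.
Hypothesis Gamma2_gt0 : 0 < Gamma2.
Hypothesis sol : classical_solution T f L U lambda sigma eps V.
Hypothesis VA : forall (t : R) x, 0 <= t <= T ->
  Aset C11 C10 Gamma1 Gamma2 (x, grad (V t) x).
Hypothesis Hconvex : forall (t : R) (p : rV), 0 <= t <= T ->
  convex_function (setT : set rV) (fun x => Htilde f L lambda t x p).
Hypothesis Uconvex : convex_function (setT : set R^o) U.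
Hypothesis drift_le : forall (t th : R) (m h P : rV), 0 <= t <= T ->
  Aset C11 C10 Gamma1 Gamma2 (m, P) ->
  \sum_i P 0 i * diff2 (drift f t th i) m h <=
    12 * K * ((Gamma1 + Gamma2) * C10) / n.+1%:R * sqn h.

Local Notation H := (Htilde f L lambda).
Let Cg := (Gamma1 + Gamma2) * (2 * C11 + C10).

Let inT (t : R) : 0 < t < T -> 0 <= t <= T.
Proof. by move=> /andP[t0 tT]; rewrite !ltW. Qed.

Lemma drift_time_bounded :
  exists F0 : R, forall t : R, 0 <= t <= T -> `|f t 0 0 (empP2 (0 : rV))| <= F0.
Proof.
have cf := derivable_oo_LRcontinuous_within (Hf_time 0 0 (empP2 (0 : rV))).
have [t1 t1T Ht1] : exists2 t1 : R, t1 \in `[0, T]%R & forall t, t \in `[0, T]%R ->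
    `|f t 0 0 (empP2 (0 : rV))| <= `|f t1 0 0 (empP2 (0 : rV))|.
  apply: (@EVT_max R (fun t => `|f t 0 0 (empP2 (0 : rV))|) 0 T (ltW T_gt0)) => t.
  apply: (@continuous_comp (subspace `[0, T]) R R
    (fun t => f t 0 0 (empP2 (0 : rV))) Num.norm); first exact: cf.
  exact: (@norm_continuous _ R^o).
by exists `|f t1 0 0 (empP2 (0 : rV))| => t tT; apply: Ht1; rewrite in_itv.
Qed.

(** The momenta are off by 2 rho W x, of order rho W^{3/2}, and the Hamiltonian is Lipschitz there
    with a constant of order W^{1/2}; [r] is the square root of [W]. *)
Lemma Htilde_perturbation (Cq : R) : 0 <= Cq -> exists2 B : R, 0 <= B &
  forall (t rho s W : R) (x p q : rV), 0 <= t <= T -> 0 <= rho -> 1 <= W -> `|s| <= 1 ->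
    sqn x <= 2 * W ->
    (forall r, 1 <= r -> W <= r ^+ 2 -> (forall i, `|x 0 i| <= 2 * r) ->
       forall i, `|q 0 i| <= Cq * r) ->
    (forall i, p 0 i = q 0 i + s * (2 * rho * W) * x 0 i) ->
    H t x p <= H t x q + B * rho * W ^+ 2.
Proof.
move=> Cq0; have [F0 HF0] := drift_time_bounded.
have [B B0 HB] := Htilde_lipschitz L Hf lambda_gt0 HF0.
exists (B * ((2 + Cq) * 4)) => [|t rho s W x p q tT rho0 W1 s1 xW qle pE].
  by rewrite mulr_ge0// mulr_ge0// addr_ge0.
pose r := Num.sqrt W.
have W0 : 0 <= W by lra.
have r2 : r ^+ 2 = W by rewrite sqr_sqrtr.
have r1 : 1 <= r by rewrite -sqrtr1 ler_wsqrtr.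
have r0 : 0 <= r by lra.
have xr i : `|x 0 i| <= 2 * r.
  have -> : 2 * r = Num.sqrt (4 * W).
    by rewrite -r2 -[4](_ : 2 ^+ 2 = _ :> R) -?exprMn ?sqrtr_sqr ?ger0_norm ?mulr_ge0//; ring.
  rewrite -sqrtr_sqr ler_wsqrtr// (le_trans (sqr_coord_le_sqn x i))// (le_trans xW)//.
  lra.
have Cr : 0 <= Cq * r by exact: mulr_ge0.
have := HB t ((2 + Cq) * r) (2 * rho * W * (2 * r)) x p q tT _ _ _ _.
have -> : B * ((2 + Cq) * r) * (2 * rho * W * (2 * r)) = B * ((2 + Cq) * 4) * rho * W ^+ 2.
  have -> : W ^+ 2 = W * r ^+ 2 by rewrite r2 expr2.
  by ring.
apply.
- by rewrite [leRHS]mulrDl; lra.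
- by move=> i; apply: (le_trans (xr i)); rewrite [leRHS]mulrDl lerDl.
- move=> i; apply: (le_trans (qle r r1 _ xr i)); first by rewrite r2.
  by rewrite [leRHS]mulrDl lerDr mulr_ge0.
- move=> i; rewrite pE addrC addKr -mulrA normrM.
  apply: (@le_trans _ _ (1 * (2 * rho * W * (2 * r)))); last by rewrite mul1r.
  apply: ler_pM => //; rewrite normrM ger0_norm; last by rewrite !mulr_ge0.
  by rewrite ler_wpM2l// !mulr_ge0.
Qed.

Let GH (t : R) (x : rV) : R := H t x (grad (V t) x).

Let grad_le (t : R) (x : rV) (r : R) i : 0 <= t <= T -> 1 <= r ->
  (forall j, `|x 0 j| <= 2 * r) -> `|grad (V t) x 0 i| <= 2 * Cg * r.
Proof.
move=> tT r1 xr.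
have := @Aset_linear_growth R C11 C10 Gamma1 Gamma2 C11_ge0 C10_ge0 Gamma1_gt0
  Gamma2_gt0 n x (grad (V t) x) i (2 * r) (VA x tT) _ xr.
rewrite -/Cg => HA; have -> : 2 * Cg * r = Cg * (2 * r) by ring.
by apply: HA; lra.
Qed.

Let Cg_ge0 : 0 <= Cg.
Proof. by rewrite mulr_ge0 ?addr_ge0 ?mulr_ge0// ltW. Qed.

Let weight_ge1 (m h : rV) : 1 <= 1 + sqn m + sqn h.
Proof. by rewrite -addrA lerDl addr_ge0// sqn_ge0. Qed.

Let sqnD_le_weight (m h : rV) : sqn (m + h) <= 2 * (1 + sqn m + sqn h).
Proof. have := sqnD_le m h; lra. Qed.

Let sqnB_le_weight (m h : rV) : sqn (m - h) <= 2 * (1 + sqn m + sqn h).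
Proof. have := sqnD_le m (- h); rewrite sqnN; lra. Qed.

(** With [M = 0] the momenta are not shifted by multiples of [h]: the three gradients agree up to
    the penalty, and the single momentum at [m] can be used for convexity in [x]. *)
Lemma solution_convex (t : R) m h : 0 < t < T -> 0 <= diff2 (V t) m h.
Proof.
move=> tT; have [C C0 HC] := solution_growth T_gt0 sol C11_ge0 C10_ge0
  Gamma1_gt0 Gamma2_gt0 HU VA.
have [B B0 HB] := Htilde_perturbation (mulr_ge0 (ler0n _ 2) Cg_ge0).
have [cV [dV _] _ pde _] := sol.
suff : -1 * diff2 (V t) m h <= 0 * expR (0 * (T - t)) * sqn h.
  by rewrite !mul0r mulN1r oppr_le0.
apply: (@three_point_comparison R n T sigma eps (-1) 0 0 C (2 * B) V GH) => //.
- by rewrite normrN1.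
- by rewrite mulr_ge0.
- by move=> s /andP[s0 sT]; apply: (solution_C2 sol); rewrite sT (ltW s0).
- by move=> m' h'; rewrite mul0r mulN1r oppr_le0; exact: (terminal_diff2_ge0 sol).
move=> {tT}{}t rho {}m {}h tT rho0 w Ec Es; have tT' := inT tT.
have w1 : 1 <= w := weight_ge1 m h.
have Ep i : grad (V t) m 0 i = grad (V t) (m + h) 0 i + 1 * (2 * rho * w) * (m + h) 0 i.
  have := Ec i; have := Es i; rewrite !mxE !mul0r mulr0 add0r => E1 E2.
  move: E1 E2; move: (partial i _ (m + h)) (partial i _ (m - h)) (partial i _ m) => a b c.
  lra.
have Em i : grad (V t) m 0 i = grad (V t) (m - h) 0 i + 1 * (2 * rho * w) * (m - h) 0 i.
  have := Ec i; have := Es i; rewrite !mxE !mul0r mulr0 add0r => E1 E2.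
  move: E1 E2; move: (partial i _ (m + h)) (partial i _ (m - h)) (partial i _ m) => a b c.
  lra.
have n1 : `|1 : R| <= 1 by rewrite normr1.
have Hp := HB t rho 1 w (m + h) (grad (V t) m) _ tT' rho0 w1 n1 (sqnD_le_weight m h)
  (fun r r1 _ xr i => grad_le i tT' r1 xr) Ep.
have Hm := HB t rho 1 w (m - h) (grad (V t) m) _ tT' rho0 w1 n1 (sqnB_le_weight m h)
  (fun r r1 _ xr i => grad_le i tT' r1 xr) Em.
have := convex_midpoint m h (Hconvex (grad (V t) m) tT').
rewrite !mul0r add0r /diff2 /GH; move: Hp Hm.
have aux (a b c d e k q : R) : d <= a + k * rho * q -> e <= b + k * rho * q ->
  2 * c <= d + e -> -1 * (a + b - 2 * c) <= 2 * k * rho * q by move=> *; lra.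
exact: aux.
Qed.

(** The rate adds the curvature of the drift weighted by the momentum, the curvature of [L], and the
    drift increments met by the shifted momenta. Only the last arrives multiplied by c; the others
    carry 1/N. *)
Let Bc := 12 * K * ((Gamma1 + Gamma2) * C10) + 2 * CL20 + 4 * K.
Let M := (1 + 2 * CU20) / n.+1%:R.

Lemma solution_semiconcave (t : R) m h : 0 < t < T ->
  diff2 (V t) m h <= (1 + 2 * CU20) * expR (Bc * T) / n.+1%:R * sqn h.
Proof.
move=> tT; have [C C0 HC] := solution_growth T_gt0 sol C11_ge0 C10_ge0
  Gamma1_gt0 Gamma2_gt0 HU VA.
have K0 := K_ge0 Hf (inT tT).
have CL0 := cost_C20_ge0 HL; have CU0 := cost_C20_ge0 HU.
have A0 : 0 <= 12 * K * ((Gamma1 + Gamma2) * C10).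
  by apply: mulr_ge0; [exact: mulr_ge0|apply: mulr_ge0 => //; rewrite addr_ge0// ltW].
have Bc0 : 0 <= Bc by rewrite /Bc; lra.
have Ni : 0 <= n.+1%:R^-1 :> R by [].
have M0 : 0 <= M by apply: mulr_ge0 => //; lra.
have expT s : 0 < s < T -> expR (Bc * (T - s)) <= expR (Bc * T).
  by move=> /andP[s0 _]; rewrite ler_expR ler_wpM2l// gerBl ltW.
(* A bound on c uniform in time, because the constant [B] of the perturbation is fixed before the
   time of the maximum is known. *)
pose cmax := M * expR (Bc * T).
have cmax0 : 0 <= cmax by rewrite mulr_ge0// expR_ge0.
have Cq0 : 0 <= 2 * Cg + 2 * cmax by rewrite addr_ge0// mulr_ge0.
have [B B0 HB] := Htilde_perturbation Cq0.
have [cV [dV _] _ pde _] := sol.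
have mono : M * expR (Bc * (T - t)) * sqn h
    <= (1 + 2 * CU20) * expR (Bc * T) / n.+1%:R * sqn h.
  rewrite ler_wpM2r ?sqn_ge0// [leRHS]mulrAC ler_wpM2l//; exact: expT.
apply: le_trans mono; rewrite -[leLHS]mul1r.
apply: (@three_point_comparison R n T sigma eps 1 M Bc C (2 * B) V GH) => //.
- by rewrite normr1.
- by rewrite mulr_ge0.
- by move=> s /andP[s0 sT]; apply: (solution_C2 sol); rewrite sT (ltW s0).
- by move=> m' h'; rewrite mul1r; exact: (terminal_diff2 sol _ _ HU).
move=> {tT}{}t rho {}m {}h tT rho0 w Ec Es; have tT' := inT tT.
have w1 : 1 <= w := weight_ge1 m h.
pose c := M * expR (Bc * (T - t)); rewrite -/c in Es *.
have c0 : 0 <= c by rewrite mulr_ge0// expR_ge0.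
have cle : c <= cmax by rewrite ler_wpM2l// expT.
(* Here the surplus 1 in [M] pays off: terms of order 1/N become multiples of [c]. *)
have cN : n.+1%:R^-1 <= c.
  have E1 : 1 <= expR (Bc * (T - t)).
    by rewrite -expR0 ler_expR mulr_ge0// subr_ge0; case/andP: tT' => _.
  have M1 : n.+1%:R^-1 <= M by rewrite /M ler_peMl//; lra.
  by apply: (le_trans M1); rewrite /c ler_peMr.
pose P := grad (V t) m.
have Ep i : grad (V t) (m + h) 0 i = (P + c *: h) 0 i + 1 * (2 * rho * w) * (m + h) 0 i.
  have := Ec i; have := Es i; rewrite !mxE !mul1r.
  move: (partial i _ (m + h)) (partial i _ (m - h)) (partial i _ m) => a b d.
  lra.
have Em i : grad (V t) (m - h) 0 i = (P - c *: h) 0 i + 1 * (2 * rho * w) * (m - h) 0 i.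
  have := Ec i; have := Es i; rewrite !mxE !mul1r.
  move: (partial i _ (m + h)) (partial i _ (m - h)) (partial i _ m) => a b d.
  lra.
have n1 : `|1 : R| <= 1 by rewrite normr1.
have coord (r : R) i : 1 <= r -> w <= r ^+ 2 ->
    `|P 0 i| <= 2 * Cg * r /\ `|(c *: h) 0 i| <= 2 * cmax * r.
  move=> r1 wr; have r0 : 0 <= r by lra.
  have bd (y : rV) j : sqn y <= w -> `|y 0 j| <= 2 * r.
    move=> yw; have : `|y 0 j| <= r; last by lra.
    have -> : r = Num.sqrt (r ^+ 2) by rewrite sqrtr_sqr ger0_norm.
    by rewrite -sqrtr_sqr ler_wsqrtr// (le_trans (sqr_coord_le_sqn y j))// (le_trans yw).
  split.
    by apply: grad_le => // j; apply: bd; rewrite /w; have := sqn_ge0 h; lra.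
  have bh : `|h 0 i| <= 2 * r by apply: bd; rewrite /w; have := sqn_ge0 m; lra.
  rewrite mxE normrM (ger0_norm c0) (_ : 2 * cmax * r = cmax * (2 * r)); last by ring.
  exact: ler_pM.
have qp (r : R) : 1 <= r -> w <= r ^+ 2 ->
    forall i, `|(P + c *: h) 0 i| <= (2 * Cg + 2 * cmax) * r.
  move=> r1 wr i; have [a b] := coord r i r1 wr.
  by rewrite mxE (le_trans (ler_normD _ _))// mulrDl lerD.
have qm (r : R) : 1 <= r -> w <= r ^+ 2 ->
    forall i, `|(P - c *: h) 0 i| <= (2 * Cg + 2 * cmax) * r.
  move=> r1 wr i; have [a b] := coord r i r1 wr.
  by rewrite mxE [X in _ + X]mxE (le_trans (ler_normB _ _))// mulrDl lerD.
have Hp := HB t rho 1 w (m + h) _ (P + c *: h) tT' rho0 w1 n1 (sqnD_le_weight m h)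
  (fun r r1 wr _ => qp r r1 wr) Ep.
have Hm := HB t rho 1 w (m - h) _ (P - c *: h) tT' rho0 w1 n1 (sqnB_le_weight m h)
  (fun r r1 wr _ => qm r r1 wr) Em.
have Hs := Htilde_semiconcave Hf lambda_gt0 HL tT' c0
  (fun th => drift_le th h tT' (VA m tT')).
have cB : (12 * K * ((Gamma1 + Gamma2) * C10) / n.+1%:R + 2 * CL20 / n.+1%:R
      + 4 * K * c) * sqn h
    <= Bc * c * sqn h.
  rewrite ler_wpM2r ?sqn_ge0//.
  have -> : Bc * c = 12 * K * ((Gamma1 + Gamma2) * C10) * c + 2 * CL20 * c + 4 * K * c.
    by rewrite /Bc; ring.
  by rewrite lerD2r lerD// ler_wpM2l// mulr_ge0.
rewrite mul1r /diff2 /GH; move: Hp Hm Hs cB; rewrite -/P.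
have aux (a b d e g X Y k q : R) : a <= d + k * rho * q -> b <= e + k * rho * q ->
  d + e - 2 * g <= X -> X <= Y -> a + b - 2 * g <= Y + 2 * k * rho * q by move=> *; lra.
exact: aux.
Qed.

End hessian_bounds.

(** * From second differences to the Hessian *)

Section hessian_conclusion.
Context (R : realType) (n : nat).
Local Notation rV := 'rV[R]_n.+1.

Lemma hess_ge0_of_diff2 (g : rV -> R) v x : C2 g ->
  (forall h, 0 <= diff2 g x h) -> 0 <= hess g v x.
Proof.
move=> g2 H; rewrite -oppr_le0.
have -> : - hess g v x = (-1) * hess g v x + 0 * hess g v x + 0 * hess g v x.
  by rewrite mul0r !addr0 mulN1r.
apply: hess_le_second_difference => // s _; rewrite !mul0r !addr0 scaleNr.
have := H (s *: v); rewrite /diff2; move: (g _) (g _) (g _) => a b c; lra.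
Qed.

Lemma hess_le_of_diff2 (g : rV -> R) (c : R) v x : C2 g ->
  (forall h, diff2 g x h <= c * sqn h) -> hess g v x <= c * sqn v.
Proof.
move=> g2 H.
have -> : hess g v x = 1 * hess g v x + 0 * hess g v x + 0 * hess g v x.
  by rewrite mul0r !addr0 mul1r.
apply: hess_le_second_difference => // s _; rewrite !mul0r !addr0 !mul1r scaleNr.
have -> : c * sqn v * s ^+ 2 = c * sqn (s *: v).
  rewrite -[s *: v]add0r sqnDZ.
  have -> : sqn (0 : rV) = 0 by rewrite /sqn big1// => i _; rewrite mxE expr0n.
  have -> : dot (0 : rV) v = 0 by rewrite /dot big1// => i _; rewrite mxE mul0r.
  by ring.
exact: H.
Qed.

Lemma partial_separable (phi dphi : R -> R) (a : R) i (x : rV) :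
  (forall y : R, is_derive y 1 phi (dphi y)) ->
  partial i (fun y : rV => a * \sum_j phi (y 0 j)) x = a * dphi (x 0 i).
Proof.
move=> dp; apply: derive_val.
apply/is_derive_line_at0.
rewrite (_ : (fun _ => _) = fun s => a * (phi (x 0 i + s * 1)
    + \sum_(j | j != i) phi (x 0 j))); last first.
  apply/funext => s; congr (_ * _); rewrite (bigD1 i)//=; congr (_ + _).
    by rewrite !mxE !eqxx mulr1.
  by apply: eq_bigr => j ji; rewrite !mxE eqxx (negbTE ji) mulr0 addr0.
have ds : is_derive (0 : R) 1 (fun s => phi (x 0 i + s * 1)) (dphi (x 0 i)).
  rewrite -[dphi (x 0 i)]mul1r; apply: is_derive_affine.
  by rewrite mul0r addr0.
apply: is_derive_eq; rewrite -[_ *: _]/(_ * _); ring.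
Qed.

Lemma partial_coord_eq0 (phi : R -> R) (a : R) i j (x : rV) : i != j ->
  partial i (fun y : rV => a * phi (y 0 j)) x = 0.
Proof.
move=> ij; apply: derive_val; apply/is_derive_line_at0.
rewrite (_ : (fun _ => _) = cst (a * phi (x 0 j))).
  exact: is_derive_cst.
by apply/funext => s; rewrite !mxE eqxx eq_sym (negbTE ij) mulr0 addr0.
Qed.

Lemma partial_coord (phi dphi : R -> R) (a : R) i (x : rV) :
  (forall y : R, is_derive y 1 phi (dphi y)) ->
  partial i (fun y : rV => a * phi (y 0 i)) x = a * dphi (x 0 i).
Proof.
move=> dp; apply: derive_val; apply/is_derive_line_at0.
rewrite (_ : (fun _ => _) = fun s => a * phi (x 0 i + s * 1)); last first.
  by apply/funext => s; rewrite !mxE !eqxx mulr1.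
have ds : is_derive (0 : R) 1 (fun s => phi (x 0 i + s * 1)) (dphi (x 0 i)).
  rewrite -[dphi (x 0 i)]mul1r; apply: is_derive_affine.
  by rewrite mul0r addr0.
apply: is_derive_eq; rewrite -[_ *: _]/(_ * _); ring.
Qed.

(** Serves [t = T], where the Hessian has to be computed from the terminal cost. *)
Lemma hess_separable (phi : R -> R) (C11 C10 C20 a : R) (v x : rV) :
  cost_assumption phi C11 C10 C20 ->
  hess (fun y : rV => a * \sum_j phi (y 0 j)) v x =
  a * \sum_i phi^`()%classic^`()%classic (x 0 i) * v 0 i ^+ 2.
Proof.
move=> Hphi.
have d1 (y : R) : is_derive y 1 phi (phi^`()%classic y).
  by apply: is_derive_derive1; have [_ ? _ _ _] := Hphi y.
have d2 (y : R) : is_derive y 1 phi^`()%classic (phi^`()%classic^`()%classic y).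
  by apply: is_derive_derive1; have [_ _ ? _ _] := Hphi y.
rewrite /hess mulr_sumr; apply: eq_bigr => i _.
have E j : partial j (fun y : rV => a * \sum_j phi (y 0 j)) =
    (fun y => a * phi^`()%classic (y 0 j)).
  by apply/funext => y; exact: partial_separable.
rewrite (bigD1 i)//= big1 => [|j ji]; last first.
  by rewrite E partial_coord_eq0 ?mul0r// eq_sym.
by rewrite E (partial_coord _ _ _ d2) addr0; ring.
Qed.

End hessian_conclusion.

Unset Implicit Arguments.
Set Strict Implicit.

Theorem proposition3p16 (R : realType) (T : R) (f : coef R) (fmu : mcoef R)
    (fmumu : R -> R -> R -> P2 R -> R -> R -> R) (L U : R -> R)
    (CL11 CL10 CL20 CU11 CU10 CU20 Gamma1 Gamma2 : R) :
  0 < T ->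
  f_assumption T f fmu fmumu ->
  cost_assumption L CL11 CL10 CL20 ->
  cost_assumption U CU11 CU10 CU20 ->
  growth_assumption L U ->
  0 < Gamma1 -> 0 < Gamma2 ->
  exists C6 : R -> R -> R,
  forall (lambda lambda0 sigma : R) (V : forall n, R -> R -> 'rV[R]_n.+1 -> R),
  0 < lambda ->
  (forall n (eps : R), 0 < eps ->
     classical_solution T f L U lambda sigma eps (V n eps)) ->
  (forall n (eps t : R) x, 0 < eps -> 0 <= t <= T ->
     Aset (CL11 + CU11) (CL10 + CU10) Gamma1 Gamma2
       (x, grad (V n eps t) x)) ->
  hypothesis_R1 T f fmu L U (CL11 + CU11) (CL10 + CU10) Gamma1 Gamma2
    lambda lambda0 ->
  forall n (eps t : R) (x xi : 'rV[R]_n.+1), 0 < eps -> 0 <= t <= T ->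
    0 <= \sum_i \sum_j partial i (partial j (V n eps t)) x * xi 0 i * xi 0 j
      <= C6 (Num.sqrt lambda)^-1 (lambda - lambda0)^-1 / n.+1%:R
         * \sum_i xi 0 i ^+ 2.
Proof.
move=> T0 [_ Hft [K [_ Hf [Hfth Hfx] Hfmu Hfy]]] HL HU _ G1 G2.
pose C11 := CL11 + CU11; pose C10 := CL10 + CU10.
have C11_ge0 : 0 <= C11 := addr_ge0 (cost_C11_ge0 HL) (cost_C11_ge0 HU).
have C10_ge0 : 0 <= C10 := addr_ge0 (cost_C10_ge0 HL) (cost_C10_ge0 HU).
pose B := 12 * K * ((Gamma1 + Gamma2) * C10) + 2 * CL20 + 4 * K.
pose C6 := (1 + 2 * CU20) * expR (B * T).
(* The bounds on [f] are uniform in the control, so one constant serves all [lambda] and [lambda0];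
   the size of nearly optimal controls matters only for the penalty. *)
exists (fun _ _ => C6) => lambda lambda0 sigma V lam0 Hsol HA.
move=> [[_ HR _ _] Ucvx Hcvx] n eps t x xi eps0 tT.
have sol := Hsol n eps eps0.
have VA s y : 0 <= s <= T -> Aset C11 C10 Gamma1 Gamma2 (y, grad (V n eps s) y).
  exact: HA.
have drift_le (s th : R) (m h P : 'rV[R]_n.+1) : 0 <= s <= T ->
    Aset C11 C10 Gamma1 Gamma2 (m, P) ->
    \sum_i P 0 i * diff2 (drift f s th i) m h <=
    12 * K * ((Gamma1 + Gamma2) * C10) / n.+1%:R * sqn h.
  move=> sT; apply: (weighted_drift_diff2_le Hf Hfth Hfx Hfmu Hfy C11_ge0 C10_ge0
    G1 G2 lam0 th h sT HR) => p.
  exact: Hcvx.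
have Hlow s m h : 0 < s < T -> 0 <= diff2 (V n eps s) m h.
  exact: (solution_convex T0 Hf Hft HU lam0 C11_ge0 C10_ge0 G1 G2 sol VA
    (fun s p => Hcvx n s p) Ucvx).
have Hup s m h : 0 < s < T -> diff2 (V n eps s) m h <= C6 / n.+1%:R * sqn h.
  exact: (solution_semiconcave T0 Hf Hft HL HU lam0 C11_ge0 C10_ge0 G1 G2 sol VA drift_le).
rewrite -/(hess (V n eps t) xi x) -/(sqn xi).
(* Interior times come from the comparison, [t = 0] from continuity of the second differences, and
   [t = T] from the explicit terminal cost. *)
have [tltT|Tlet] := ltP t T.
  have C2t : C2 (V n eps t).
    by apply: (solution_C2 sol); rewrite tltT andbT; case/andP: tT.
  have [t0|tle0] := ltP 0 t.
    apply/andP; split; first by apply: hess_ge0_of_diff2 => // h; apply: Hlow; rewrite t0.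
    by apply: hess_le_of_diff2 => // h; apply: Hup; rewrite t0.
  have t0 : t = 0 by apply/eqP; rewrite eq_le tle0; case/andP: tT.
  rewrite t0 in C2t *; apply/andP; split.
    apply: hess_ge0_of_diff2 => // h; rewrite -oppr_le0 -mulN1r.
    apply: (diff2_time_closed T0 sol) => s sT; rewrite mulN1r oppr_le0; exact: Hlow.
  apply: hess_le_of_diff2 => // h; rewrite -[leLHS]mul1r.
  by apply: (diff2_time_closed T0 sol) => s sT; rewrite mul1r; exact: Hup.
have -> : t = T by apply/eqP; rewrite eq_le Tlet andbT; case/andP: tT.
have -> : V n eps T = (fun y => n.+1%:R^-1 * \sum_j U (y 0 j)).
  by apply/funext => y; have [_ _ _ _ ->] := sol.
rewrite (hess_separable _ _ _ HU).
have CU0 := cost_C20_ge0 HU.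
have K0 : 0 <= K by apply: (K_ge0 Hf (t := 0)); rewrite lexx ltW.
have B0 : 0 <= B.
  rewrite /B !addr_ge0 ?mulr_ge0 ?(cost_C20_ge0 HL)//; last by rewrite addr_ge0// ltW.
have C6_ge : CU20 <= C6.
  have e1 : 1 <= expR (B * T) by rewrite -expR0 ler_expR mulr_ge0// ltW.
  have H12 : 0 <= 1 + 2 * CU20 by lra.
  have := ler_wpM2l H12 e1; rewrite /C6; lra.
apply/andP; split.
  rewrite mulr_ge0 ?invr_ge0// sumr_ge0// => i _.
  by rewrite mulr_ge0 ?sqr_ge0//; exact: (convex_derive2_ge0 HU).
rewrite mulrAC mulrC ler_wpM2r ?invr_ge0// /sqn mulr_sumr ler_sum// => i _.
rewrite ler_wpM2r ?sqr_ge0// (le_trans _ C6_ge)//.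
by have [_ _ _ _] := HU (x 0 i); apply: le_trans; exact: ler_norm.
Qed.
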